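(* Assume that $\Theta=A\times B$ is open and convex, that conditions A1, A2 and A3 (stated in full in the context) are fulfilled, and that $T_n\to\infty$ and $\{h_n\}$ is bounded. Then the family $\{\mathrm{P}^{n}_\theta:\theta\in\Theta\}$ is uniformly locally asymptotically normal in any compact subset $K$ of $\Theta$. That is, there are random $d$-vectors $\Delta_n^{(\theta)}$ ($n\ge1$, $\theta\in\Theta$), functions of $(Y_0,\dots,Y_n)$ and $\theta$, such that for any compact subset $K$ of $\Theta$ and for arbitrary sequences $\{\theta_n\}\subset K$ and $\{w_n\}\subset\mathbb{R}^d$ with $\theta_n+w_n\Phi_n^{(\theta_n)}\in K$ and $w_n\to w\in\mathbb{R}^d$ as $n\to\infty$, the log-likelihood ratio can be decomposed as $$\Lambda_n^{(\theta_n,w_n)}=\Delta_n^{(\theta_n)}w^{*}-\frac12|w|^2+r_n(\theta_n,w_n),$$ where $\Delta_n^{(\theta_n)}$ converges in law to the standard normal distribution, $$\lim_{n\to\infty}\mathcal{L}_{\theta_n}\big[\Delta_n^{(\theta_n)}\big]=\mathcal{N}_d(0_d,I_{d\times d}),\qquad d=p+q,$$ and the random variable $r_n(\theta_n,w_n)$ converges in $\mathrm{P}_{\theta_n}$-probability to $0$.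
   Context: Model. $A\subset\mathbb{R}^p$ and $B\subset\mathbb{R}^q$ are bounded open convex sets, $p,q\ge 0$, $p+q>0$, $d=p+q$, $\Theta=A\times B$, $\theta=(\alpha,\beta)$. The functions $f:A\times\mathbb{R}^+\to\mathbb{R}$ and $\sigma:B\times\mathbb{R}^+\to\mathbb{R}^+$ are measurable, $f(\alpha,t)$ is continuous in $\alpha$ and $\sigma(\beta,t)$ is continuous in $\beta$. The process $\{X_t\}$ satisfies $dX_t=f(\alpha,t)\,dt+\sigma(\beta,t)\,dW_t$, $t\ge 0$, where $\{W_t\}$ is a Wiener process; $X_0$ is independent of $\{W_t\}$ and its law does not depend on $\theta$. Observations. For each $n$, the process is observed at deterministic instants $0=t_0<t_1<\dots<t_n=T_n$ (which may depend on $n$), $h_n:=\max_i(t_i-t_{i-1})$. It is assumed that $T_n\to\infty$ as $n\to\infty$ and that $\{h_n\}$ is bounded. Put $Y_0:=X_0$, $Y_i:=X_{t_i}-X_{t_{i-1}}$, $$F_i(\alpha):=\int_{t_{i-1}}^{t_i}f(\alpha,t)\,dt,\qquad G_i(\beta):=\left(\int_{t_{i-1}}^{t_i}\sigma^2(\beta,t)\,dt\right)^{1/2}.$$ Under parameter value $\theta$ (law $\mathrm{P}_\theta$; $\mathcal{L}_\theta[\cdot]$ denotes the law of a random variable), $Y_0,\dots,Y_n$ are independent and $Y_i\sim\mathcal{N}(F_i(\alpha),G_i^2(\beta))$ for $i\ge1$. $\mathrm{P}^n_\theta$ denotes the distribution of $(Y_0,\dots,Y_n)$ when the parameter is $\theta$.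 Conventions. Vectors are row vectors, ${}^{*}$ is the transpose, $\nabla_\alpha,\nabla_\beta$ are gradients (row vectors), $\nabla_\beta^2$ is the Hessian matrix, $|\cdot|$ is the Euclidean norm (operator norm for matrices). A1. $\alpha\mapsto f(\alpha,t)$ is differentiable and $\beta\mapsto\sigma^2(\beta,t)$ is twice differentiable; $\alpha\mapsto\nabla_\alpha f(\alpha,t)$ is uniformly continuous on $A$, uniformly in $t\in\mathbb{R}^+$, and $\beta\mapsto\nabla_\beta\sigma^2(\beta,t)$, $\beta\mapsto\nabla_\beta^2\sigma^2(\beta,t)$ are uniformly continuous on $B$, uniformly in $t\in\mathbb{R}^+$. That is, for every $\gamma>0$ there is $\eta>0$ such that $|\alpha-\alpha'|\le\eta$ and $|\beta-\beta'|\le\eta$ imply $\sup_t|\nabla_\alpha f(\alpha,t)-\nabla_\alpha f(\alpha',t)|\le\gamma$ and $\sup_t\big(|\nabla_\beta\sigma^2(\beta,t)-\nabla_\beta\sigma^2(\beta',t)|+|\nabla^2_\beta\sigma^2(\beta,t)-\nabla^2_\beta\sigma^2(\beta',t)|\big)\le\gamma$. A2. $t\mapsto f(\alpha,t)$ is locally integrable on $\mathbb{R}^+$ for every $\alpha\in A$; $0<\inf_{\beta,t}\sigma^2(\beta,t)\le\sup_{\beta,t}\sigma^2(\beta,t)<\infty$; $\sup_{\alpha,t}|\nabla_\alpha f(\alpha,t)|<\infty$ and $\sup_{\beta,t}|\nabla_\beta\sigma^2(\beta,t)|<\infty$. A3. There exist positive definite matrices $J_p^{(\alpha,\beta)}$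 ($p\times p$) and $J_q^{(\beta)}$ ($q\times q$) such that $$J_p^{(\alpha,\beta)}=\lim_{n\to\infty}\frac1{T_n}\sum_{i=1}^n\frac{\nabla_\alpha^{*}F_i(\alpha)\,\nabla_\alpha F_i(\alpha)}{G_i^2(\beta)},\qquad J_q^{(\beta)}=\lim_{n\to\infty}\frac1{2n}\sum_{i=1}^n\nabla_\beta^{*}\ln G_i^2(\beta)\,\nabla_\beta\ln G_i^2(\beta),$$ the convergences being uniform in $\theta\in\Theta$. Normalization and likelihood ratio. $\varphi_n^{(\alpha,\beta)}:=(T_nJ_p^{(\alpha,\beta)})^{-1/2}$, $\psi_n^{(\beta)}:=(nJ_q^{(\beta)})^{-1/2}$, $\Phi_n^{(\theta)}:=\mathrm{diag}[\varphi_n^{(\alpha,\beta)},\psi_n^{(\beta)}]$ (a $d\times d$ matrix), and for $w\in\mathbb{R}^d$ with $\theta+w\Phi_n^{(\theta)}\in\Theta$, $$\Lambda_n^{(\theta,w)}:=\ln\left(\frac{d\mathrm{P}^n_{\theta+w\Phi_n^{(\theta)}}}{d\mathrm{P}^n_\theta}(Y_0,\dots,Y_n)\right).$$ *)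

(* Defs.v *)
From HB Require Import structures.
From mathcomp Require Import all_boot all_order all_algebra.
From mathcomp Require Import all_classical all_reals all_analysis.
From mathcomp Require Import measurable_realfun.

Set Implicit Arguments.
Unset Strict Implicit.
Unset Printing Implicit Defensive.

Import Order.TTheory GRing.Theory Num.Theory.
Import numFieldNormedType.Exports.

Local Open Scope classical_set_scope.
Local Open Scope ring_scope.

Section LinearAlgebra.
Context {R : realType}.

(* The library norm of ['rV[R]_n] is the sup norm, hence the Euclidean one here. *)
Definition enorm n (v : 'rV[R]_n) : R := Num.sqrt (\sum_i v 0 i ^+ 2).

(* Operator norm for the Euclidean norms, matrices acting on row vectors. *)
Definition opnorm m n (M : 'M[R]_(m, n)) : R :=
  sup [set enorm (v *m M) | v in [set v : 'rV[R]_m | enorm v <= 1]].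

Definition posdef n (M : 'M[R]_n) : Prop :=
  M^T = M /\ forall v : 'rV[R]_n, v != 0 -> 0 < (v *m M *m v^T) 0 0.

(* [M^(-1/2)]: the unique positive definite square root of [M^-1] when [M] is
   positive definite; the default value is irrelevant. *)
Definition inv_sqrtmx n (M : 'M[R]_n) : 'M[R]_n :=
  xget 0 [set S | posdef S /\ S *m S = invmx M].

Definition grad n (g : 'rV[R]_n -> R) (a : 'rV[R]_n) : 'rV[R]_n :=
  \row_i 'D_(delta_mx 0 i) g a.

Definition hess n (g : 'rV[R]_n -> R) (a : 'rV[R]_n) : 'M[R]_n :=
  'J (grad g) a.

End LinearAlgebra.

Section Probability.
Context {R : realType}.

(* Borel measurability of the restriction of [g] to the Borel set [D]. *)
Definition borel_fun_on (T : topologicalType) (D : set T) (g : T -> R) : Prop :=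
  forall U : set R, measurable U ->
    <<s [set O : set T | open O] >> (D `&` g @^-1` U).

Definition cons_pair n (x : measurableTypeR R * n.-tuple R) : n.+1.-tuple R :=
  [the n.+1.-tuple R of x.1 :: x.2].

Fact measurable_cons_pair n : measurable_fun [set: measurableTypeR R * n.-tuple R] (@cons_pair n).
Proof. exact: measurable_cons. Qed.

HB.instance Definition _ n :=
  isMeasurableFun.Build _ _ _ _ (@cons_pair n) (@measurable_cons_pair n).

(* [N(0, I)] on [R^d], as the [d]-fold product of [N(0, 1)]. *)
Fixpoint std_normal (d : nat) : probability (d.-tuple R) R :=
  match d with
  | 0 => \d_([tuple] : 0.-tuple R)
  | d'.+1 => distribution (normal_prob (0 : R) 1 \x std_normal d')%E (@cons_pair d')
  end.

Definition row_of_tuple n (v : n.-tuple R) : 'rV[R]_n := \row_i tnth v i.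

(* Convergence in law of [Z n] under [P n] to [Z'] under [Q]. *)
Definition cvg_in_law d (dO dO' : measure_display) (Om : measurableType dO)
    (Om' : measurableType dO') (P : nat -> probability Om R)
    (Z : nat -> Om -> 'rV[R]_d) (Q : probability Om' R)
    (Z' : Om' -> 'rV[R]_d) : Prop :=
  forall g : 'rV[R]_d -> R, continuous g -> (exists M, forall x, `|g x| <= M) ->
    (\int[P n]_w (g (Z n w))%:E)%E @[n --> \oo] --> (\int[Q]_w (g (Z' w))%:E)%E.

Definition cvg_in_prob0 (dO : measure_display) (Om : measurableType dO)
    (P : nat -> probability Om R) (r : nat -> Om -> R) : Prop :=
  forall e : R, 0 < e -> P n [set w | e < `|r n w|] @[n --> \oo] --> 0%E.

Section Wiener.
Context {dO : measure_display} {Om : measurableType dO}.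
Variable P : probability Om R.

Definition independent_family k (Z : 'I_k -> Om -> R) : Prop :=
  forall U : 'I_k -> set R, (forall i, measurable (U i)) ->
    P (\bigcap_(i in [set: 'I_k]) (Z i @^-1` U i)) =
    (\prod_(i < k) P (Z i @^-1` U i))%E.

Record wiener_process (W : R -> Om -> R) : Prop := {
  wiener_meas : forall t, 0 <= t -> measurable_fun [set: Om] (W t);
  wiener0 : {ae P, forall w, W 0 w = 0};
  wiener_normal : forall s t, 0 <= s -> s < t -> forall U : set R, measurable U ->
    P ((fun w => W t w - W s w) @^-1` U) = normal_prob 0 (Num.sqrt (t - s)) U;
  wiener_indep : forall k (u : nat -> R), 0 <= u 0%N ->
    (forall i, (i < k)%N -> u i <= u i.+1) ->
    independent_family (fun (i : 'I_k) w => W (u i.+1) w - W (u i) w);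
  wiener_cont : {ae P, forall w, {within `[0, +oo[, continuous (fun t => W t w)}} }.

(* Independence of [Z] and the sigma-algebra generated by [W t], [0 <= t]. *)
Definition independent_of_process (Z : Om -> R) (W : R -> Om -> R) : Prop :=
  forall (U : set R) (E : set Om), measurable U ->
    <<s [set F | exists2 t, 0 <= t &
           exists2 V : set R, measurable V & F = W t @^-1` V] >> E ->
    P (Z @^-1` U `&` E) = (P (Z @^-1` U) * P E)%E.

(* The step function equal to [c j] on [`]u j, u j.+1]], [j < m], and its
   stochastic integral. *)
Definition step_fun (m : nat) (u c : nat -> R) (s : R) : R :=
  \sum_(j < m) c j * \1_(`]u j, u j.+1]) s.

Definition step_integral (W : R -> Om -> R) (m : nat) (u c : nat -> R)
    (w : Om) : R :=
  \sum_(j < m) c j * (W (u j.+1) w - W (u j) w).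

(* [I] is (a version of) the stochastic integral of the deterministic function
   [g] over [[a, b]]: the limit in [L^2(P)] of the integrals of step functions
   that tend to [g] in [L^2([a, b])]. *)
Definition is_wiener_integral (W : R -> Om -> R) (a b : R) (g : R -> R)
    (I : Om -> R) : Prop :=
  exists (m : nat -> nat) (u c : nat -> nat -> R),
    [/\ forall k, [/\ u k 0%N = a, u k (m k) = b &
          forall j, (j < m k)%N -> u k j <= u k j.+1],
        (\int[lebesgue_measure]_(s in `[a, b])
          ((g s - step_fun (m k) (u k) (c k) s) ^+ 2)%:E)%E @[k --> \oo] --> 0%E &
        (\int[P]_w ((I w - step_integral W (m k) (u k) (c k) w) ^+ 2)%:E)%E
          @[k --> \oo] --> 0%E].

(* [dX_t = b(t) dt + s(t) dW_t], [t >= 0], with deterministic coefficients,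
   in integrated form. *)
Definition solves_sde (W X : R -> Om -> R) (b s : R -> R) : Prop :=
  forall t0 t1, 0 <= t0 -> t0 <= t1 ->
    is_wiener_integral W t0 t1 s (fun w =>
      X t1 w - X t0 w - \int[lebesgue_measure]_(t in `[t0, t1]) b t).

End Wiener.
End Probability.

Section Model.
Context {R : realType} {p q : nat}.
Variables (f : 'rV[R]_p -> R -> R) (sigma : 'rV[R]_q -> R -> R).
Variable t : nat -> nat -> R.

(* [t n i] is the [i]-th observation instant in the [n]-th scheme. *)
Definition horizon n : R := t n n.
Definition mesh n : R := \big[Num.max/0]_(1 <= i < n.+1) (t n i - t n i.-1).

Definition F_ n i (a : 'rV[R]_p) : R :=
  \int[lebesgue_measure]_(s in `[t n i.-1, t n i]) f a s.

Definition G_ n i (b : 'rV[R]_q) : R :=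
  Num.sqrt (\int[lebesgue_measure]_(s in `[t n i.-1, t n i]) (sigma b s ^+ 2)).

Definition info_alpha n (a : 'rV[R]_p) (b : 'rV[R]_q) : 'M[R]_p :=
  (horizon n)^-1 *: \sum_(1 <= i < n.+1)
    (G_ n i b ^+ 2)^-1 *: ((grad (F_ n i) a)^T *m grad (F_ n i) a).

Definition info_beta n (b : 'rV[R]_q) : 'M[R]_q :=
  (2 * n%:R)^-1 *: \sum_(1 <= i < n.+1)
    ((grad (fun b' => ln (G_ n i b' ^+ 2)) b)^T
       *m grad (fun b' => ln (G_ n i b' ^+ 2)) b).

Definition condA1 (A : set 'rV[R]_p) (B : set 'rV[R]_q) : Prop :=
  [/\ forall s, 0 <= s -> forall a, A a -> differentiable (f ^~ s) a,
      forall s, 0 <= s -> forall b, B b ->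
        differentiable (fun b' => sigma b' s ^+ 2) b,
      forall s, 0 <= s -> forall b, B b ->
        differentiable (grad (fun b' => sigma b' s ^+ 2)) b &
      forall gamma, 0 < gamma -> exists2 eta, 0 < eta &
        forall a a' b b', A a -> A a' -> B b -> B b' ->
          enorm (a - a') <= eta -> enorm (b - b') <= eta ->
        (forall s, 0 <= s ->
           enorm (grad (f ^~ s) a - grad (f ^~ s) a') <= gamma) /\
        (forall s, 0 <= s ->
           enorm (grad (fun c => sigma c s ^+ 2) b
                  - grad (fun c => sigma c s ^+ 2) b')
           + opnorm (hess (fun c => sigma c s ^+ 2) b
                     - hess (fun c => sigma c s ^+ 2) b') <= gamma)].

Definition condA2 (A : set 'rV[R]_p) (B : set 'rV[R]_q) : Prop :=
  [/\ forall a, A a -> forall T, 0 <= T ->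
        lebesgue_measure.-integrable `[0, T] (EFin \o f a),
      exists m M : R, 0 < m /\
        forall b s, B b -> 0 <= s -> m <= sigma b s ^+ 2 <= M,
      exists C : R, forall a s, A a -> 0 <= s -> enorm (grad (f ^~ s) a) <= C &
      exists C : R, forall b s, B b -> 0 <= s ->
        enorm (grad (fun c => sigma c s ^+ 2) b) <= C].

Definition condA3 (A : set 'rV[R]_p) (B : set 'rV[R]_q)
    (Jp : 'rV[R]_p -> 'rV[R]_q -> 'M[R]_p) (Jq : 'rV[R]_q -> 'M[R]_q) : Prop :=
  [/\ forall a b, A a -> B b -> posdef (Jp a b),
      forall b, B b -> posdef (Jq b),
      forall e, 0 < e -> \forall n \near \oo, forall a b, A a -> B b ->
        opnorm (info_alpha n a b - Jp a b) <= e &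
      forall e, 0 < e -> \forall n \near \oo, forall b, B b ->
        opnorm (info_beta n b - Jq b) <= e].

(* The parameter [theta] is the row vector [row_mx alpha beta]. *)
Definition Theta (A : set 'rV[R]_p) (B : set 'rV[R]_q) : set 'rV[R]_(p + q) :=
  [set th | A (lsubmx th) /\ B (rsubmx th)].

Definition Phi (Jp : 'rV[R]_p -> 'rV[R]_q -> 'M[R]_p) (Jq : 'rV[R]_q -> 'M[R]_q)
    n (th : 'rV[R]_(p + q)) : 'M[R]_(p + q) :=
  block_mx (inv_sqrtmx (horizon n *: Jp (lsubmx th) (rsubmx th))) 0
           0 (inv_sqrtmx (n%:R *: Jq (rsubmx th))).

Section Observations.
Context {dO : measure_display} {Om : measurableType dO}.
Variables (P : 'rV[R]_(p + q) -> probability Om R) (X : R -> {mfun Om >-> R}).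

Definition Y_ n i (w : Om) : R :=
  if i is j.+1 then X (t n j.+1) w - X (t n j) w else X 0 w.

Definition obs n (w : Om) : n.+1.-tuple R := [tuple Y_ n i w | i < n.+1].

Fact measurable_obs n : measurable_fun [set: Om] (obs n).
Proof.
apply/measurable_fun_tnthP => i.
rewrite (_ : _ \o _ = Y_ n i); last by apply/funext => w /=; rewrite tnth_mktuple.
by case: i => -[|i] ? //=; exact: measurable_funB.
Qed.

HB.instance Definition _ n :=
  isMeasurableFun.Build _ _ _ _ (obs n) (@measurable_obs n).

(* [P^n_theta], the law of the observations. *)
Definition Pn n (th : 'rV[R]_(p + q)) : probability (n.+1.-tuple R) R :=
  distribution (P th) (obs n).

Definition loglik_ratio n (th th' : 'rV[R]_(p + q)) (w : Om) : R :=
  ln (fine (Radon_Nikodym (charge_of_finite_measure (Pn n th')) (Pn n th)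
              (obs n w))).

End Observations.
End Model.

(* Main.v *)
Require Import Defs.
From mathcomp Require Import all_boot all_order all_algebra.
From mathcomp Require Import all_classical all_reals all_analysis.
From mathcomp Require Import measurable_realfun ring lra.

Set Implicit Arguments.
Unset Strict Implicit.
Unset Printing Implicit Defensive.

Import Order.TTheory GRing.Theory Num.Theory.
Import numFieldNormedType.Exports.

Local Open Scope classical_set_scope.
Local Open Scope ring_scope.

(* Under theta the standardized observations xi_i = (Y_i - F_i) / G_i are independent
   N(0, 1) (the increments of X are Wiener integrals plus constants, hence limits in
   L^2 of increments of W), and the score is
     Delta_n = (sum_i xi_i (grad F_i / G_i) phi_n, (1/2) sum_i (xi_i^2 - 1) (grad ln G_i^2) psi_n).
   The exact log-likelihood ratio of normal laws is, like [u Delta_n^*], a sum of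
   terms [const + a_i xi_i + b_i (xi_i^2 - 1)].  By A1-A3 the coefficients of the two
   differ by arrays whose sums of squares tend to 0, uniformly on compacts because the
   information matrices are equicontinuous and their limits bounded below there; so
   Chebyshev's inequality kills the remainder, and the constants tend to -|w|^2 / 2.
   The central limit theorem for [u Delta_n^*] comes from a Taylor expansion of the
   characteristic function of each term, whose errors are O((|a_i| + |b_i|)^3).
   Real characteristic functions [cos (c + u x)] are used throughout.  Levy's
   continuity theorem is obtained by approximating bounded continuous functions on
   cubes by trigonometric polynomials with the same bound. *)

(** * Linear algebra for the Euclidean norm *)

(** The estimates fit together by scaling. Over an interval of length h, the gradients and Taylor
    remainders of F_i and G_i^2 are O(h), and G_i^2 is at least m h. So the coefficients of xi_i are
    O(sqrt h) |phi_n|, with squares adding up to O(T_n |phi_n|^2), and those of xi_i^2 - 1 are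
    O(|psi_n|), with squares adding up to O(n |psi_n|^2): both sums stay bounded. Boundedness of h_n
    then forces the largest coefficient to 0, which turns the cubic errors into o(1) times the sums
    of squares. A3 says nothing on the continuity of J in theta; a lower bound for J on K comes from
    the equicontinuity of the information forms at finite n, carried to the limit by uniform
    convergence. The free phase c makes cosines alone a family that determines laws and whose
    products are again sums of its members; it also lets the coordinates of a product law be
    integrated one by one. With zero error the same product estimate yields exact Gaussian
    characteristic functions. The likelihood ratio is a Radon-Nikodym derivative, known only almost
    everywhere: the remainder is defined by subtraction, and its explicit form is used almost
    everywhere. *)

Section BilinearForms.
Context {R : realType}.
Implicit Types n : nat.

Definition bform n (M : 'M[R]_n) (v w : 'rV[R]_n) : R := (v *m M *m w^T) 0 0.

Definition dotr n (v w : 'rV[R]_n) : R := (v *m w^T) 0 0.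

Lemma dotrE n (v w : 'rV[R]_n) : dotr v w = \sum_i v 0 i * w 0 i.
Proof. by rewrite /dotr mxE; apply: eq_bigr => i _; rewrite mxE. Qed.

Lemma dotrC n (v w : 'rV[R]_n) : dotr v w = dotr w v.
Proof. by rewrite !dotrE; apply: eq_bigr => i _; rewrite mulrC. Qed.

Lemma dotrDl n (u v w : 'rV[R]_n) : dotr (u + v) w = dotr u w + dotr v w.
Proof. by rewrite /dotr mulmxDl mxE. Qed.

Lemma dotrZl n a (v w : 'rV[R]_n) : dotr (a *: v) w = a * dotr v w.
Proof. by rewrite /dotr -scalemxAl mxE. Qed.

Lemma dotrBl n (u v w : 'rV[R]_n) : dotr (u - v) w = dotr u w - dotr v w.
Proof. by rewrite dotrDl -scaleN1r dotrZl mulN1r. Qed.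

Lemma dotrBr n (u v w : 'rV[R]_n) : dotr u (v - w) = dotr u v - dotr u w.
Proof. by rewrite dotrC dotrBl !(dotrC u). Qed.

Lemma bformE n (M : 'M[R]_n) v w : bform M v w = dotr (v *m M) w.
Proof. by []. Qed.

Lemma bform_mulmxl n (M N : 'M[R]_n) v w : bform N (v *m M) w = bform (M *m N) v w.
Proof. by rewrite /bform !mulmxA. Qed.

Lemma bformC n (M : 'M[R]_n) v w : M^T = M -> bform M v w = bform M w v.
Proof.
move=> sM; rewrite !bformE dotrC /dotr trmx_mul sM mulmxA.
by [].
Qed.

Lemma dotrZr k (c : R) (u v : 'rV[R]_k) : dotr u (c *: v) = c * dotr u v.
Proof. by rewrite dotrC dotrZl dotrC. Qed.

Lemma dotr_sumr k I (r : seq I) (u : 'rV[R]_k) (v : I -> 'rV[R]_k) :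
  dotr u (\sum_(i <- r) v i) = \sum_(i <- r) dotr u (v i).
Proof.
elim/big_rec2: _ => [|i x y _ <-]; first by rewrite dotrC dotrE big1// => i _; rewrite mxE mul0r.
by rewrite dotrC dotrDl !(dotrC _ u).
Qed.

Lemma dotr_mulmx_sym k (M : 'M[R]_k) (u v : 'rV[R]_k) : M^T = M -> dotr u (v *m M) = dotr (u *m M) v.
Proof. by move=> sM; rewrite dotrC -!bformE bformC. Qed.

Lemma dotr_delta_mx n (v : 'rV[R]_n) i : dotr v (delta_mx 0 i) = v 0 i.
Proof.
rewrite dotrE (bigD1 i)//= mxE !eqxx mulr1 big1 ?addr0// => j /negPf ji.
by rewrite mxE ji andbF mulr0.
Qed.

Lemma bformDl n (M : 'M[R]_n) u v w : bform M (u + v) w = bform M u w + bform M v w.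
Proof. by rewrite !bformE mulmxDl dotrDl. Qed.

Lemma bformZl n (M : 'M[R]_n) a v w : bform M (a *: v) w = a * bform M v w.
Proof. by rewrite !bformE -scalemxAl dotrZl. Qed.

Lemma bform_mxD n (M N : 'M[R]_n) v w : bform (M + N) v w = bform M v w + bform N v w.
Proof. by rewrite !bformE mulmxDr dotrDl. Qed.

Lemma bform_mxZ n a (M : 'M[R]_n) v w : bform (a *: M) v w = a * bform M v w.
Proof. by rewrite !bformE -scalemxAr dotrZl. Qed.

Lemma bform_mxB n (M N : 'M[R]_n) v w : bform (M - N) v w = bform M v w - bform N v w.
Proof. by rewrite bform_mxD -scaleN1r bform_mxZ mulN1r. Qed.

Lemma bform_sum n I (r : seq I) (F : I -> 'M[R]_n) v w :
  bform (\sum_(i <- r) F i) v w = \sum_(i <- r) bform (F i) v w.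
Proof.
elim/big_rec2: _ => [|i x y _ <-]; last by rewrite bform_mxD.
by rewrite bformE mulmx0 /dotr mul0mx mxE.
Qed.

Lemma bform1 n (v w : 'rV[R]_n) : bform 1%:M v w = dotr v w.
Proof. by rewrite bformE mulmx1. Qed.

Lemma bform_outer n (g v w : 'rV[R]_n) :
  bform (g^T *m g) v w = dotr v g * dotr w g.
Proof.
rewrite /bform mulmxA -mulmxA mxE big_ord1 [in X in _ * X](_ : g *m w^T = (w *m g^T)^T).
  by rewrite [X in _ * X]mxE.
by rewrite trmx_mul trmxK.
Qed.

Lemma bform_expand n (M : 'M[R]_n) (v w : 'rV[R]_n) :
  bform M v w = \sum_i \sum_j v 0 j * M j i * w 0 i.
Proof.
rewrite bformE dotrE; apply: eq_bigr => i _.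
by rewrite mxE big_distrl.
Qed.

Lemma bform_delta n (M : 'M[R]_n) i j :
  bform M (delta_mx 0 i) (delta_mx 0 j) = M i j.
Proof.
rewrite bformE dotrE (bigD1 j)//= big1 => [|k kj]; last first.
  by rewrite [X in _ * X]mxE eqxx (negbTE kj) mulr0.
by rewrite -rowE !mxE !eqxx mulr1 addr0.
Qed.

Lemma enorm_sqr n (v : 'rV[R]_n) : enorm v ^+ 2 = dotr v v.
Proof.
rewrite /enorm sqr_sqrtr ?dotrE//; last by apply: sumr_ge0 => i _; exact: sqr_ge0.
Qed.

Lemma dotr_ge0 n (v : 'rV[R]_n) : 0 <= dotr v v.
Proof. by rewrite -enorm_sqr sqr_ge0. Qed.

Lemma enorm_ge0 n (v : 'rV[R]_n) : 0 <= enorm v.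
Proof. exact: sqrtr_ge0. Qed.

Lemma enormZ n a (v : 'rV[R]_n) : enorm (a *: v) = `|a| * enorm v.
Proof.
apply/eqP; rewrite -(@eqrXn2 _ 2)// ?mulr_ge0 ?enorm_ge0//.
by rewrite exprMn !enorm_sqr dotrZl dotrC dotrZl real_normK ?num_real// mulrA.
Qed.

Lemma enorm0 n : enorm (0 : 'rV[R]_n) = 0.
Proof. by rewrite -(scale0r 0) enormZ normr0 mul0r. Qed.

Lemma enorm_eq0 n (v : 'rV[R]_n) : enorm v = 0 -> v = 0.
Proof.
move=> v0; have : dotr v v = 0 by rewrite -enorm_sqr v0 expr0n.
rewrite dotrE => /eqP; rewrite psumr_eq0; last by move=> i _; rewrite -expr2 sqr_ge0.
move=> /allP h; apply/rowP => i; have := h i (mem_index_enum _).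
by rewrite mxE -expr2 sqrf_eq0 => /eqP.
Qed.

Lemma le_enorm_coord n (v : 'rV[R]_n) i : `|v 0 i| <= enorm v.
Proof.
rewrite -(@ler_pXn2r _ 2)// ?nnegrE ?enorm_ge0// enorm_sqr real_normK ?num_real//.
rewrite dotrE (bigD1 i)//= -expr2 lerDl sumr_ge0// => j _.
by rewrite -expr2 sqr_ge0.
Qed.

Lemma discriminant_le0 (a b c : R) :
  (forall s, 0 <= a + 2 * b * s + c * s ^+ 2) -> b ^+ 2 <= a * c.
Proof.
move=> h; have a0 : 0 <= a by have := h 0; rewrite mulr0 expr0n mulr0 !addr0.
have [c0|c0|c0] := ltgtP c 0.
- exfalso.
  (* The case [c < 0] is impossible: this [s >= 1] satisfies [c * s = c - (2|b| + a + 1)], so the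
     quadratic is at most [s * (c - 1) < 0] there. *)
  have := h ((`|b| * 2 + a + 1) / - c + 1).
  set s := _ / _ + 1.
  have sc : c * s = - (`|b| * 2 + a + 1) + c by rewrite /s; field; rewrite lt_eqF.
  have s1 : 1 <= s.
    rewrite /s lerDr divr_ge0// ?oppr_ge0 ?(ltW c0)//.
    by rewrite !addr_ge0// mulr_ge0.
  apply/negP; rewrite -ltNge expr2 [c * _]mulrA sc.
  have bs : b * s <= `|b| * s by rewrite ler_wpM2r ?ler_norm// (le_trans _ s1).
  have b0 := normr_ge0 b.
  have : a * 1 <= a * s by rewrite ler_wpM2l.
  nra.
- rewrite -(@ler_pM2r _ c^-1) ?invr_gt0// mulfK ?gt_eqF//.
  have := h (- b / c); rewrite -subr_ge0.
  by congr (0 <= _); field; rewrite gt_eqF.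
- rewrite c0 mulr0; have [->|b0] := eqVneq b 0; first by rewrite expr0n.
  have := h (- (a + 1) / (2 * b)).
  rewrite c0 mul0r addr0.
  have -> : a + 2 * b * (- (a + 1) / (2 * b)) = -1 by field.
  by rewrite ler0N1.
Qed.

(** Discriminant of the nonnegative quadratic [s -> M(v + s w, v + s w)]. Semidefinite forms are
    allowed: the square root below applies it to [1 - c^-1 N]. *)
Lemma bform_CauchySchwarz n (M : 'M[R]_n) v w : M^T = M ->
  (forall u, 0 <= bform M u u) ->
  bform M v w ^+ 2 <= bform M v v * bform M w w.
Proof.
move=> sM M0; apply: discriminant_le0 => s.
have := M0 (v + s *: w).
rewrite bformDl bformZl (bformC v) // (bformC w)// !bformDl !bformZl (bformC w v)//.
by congr (0 <= _); ring.
Qed.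

Lemma norm_dotr_le n (v w : 'rV[R]_n) : `|dotr v w| <= enorm v * enorm w.
Proof.
rewrite -(@ler_pXn2r _ 2)// ?nnegrE ?mulr_ge0 ?enorm_ge0//.
rewrite exprMn !enorm_sqr real_normK ?num_real// -!bform1.
by apply: bform_CauchySchwarz => [|u]; rewrite ?trmx1// bform1 dotr_ge0.
Qed.

(** A bound on the bilinear form rather than on [opnorm]: sums and products are handled without a
    supremum, and entries are read off at basis vectors. *)
Definition opbound n (r : R) (M : 'M[R]_n) :=
  forall v w, `|bform M v w| <= r * (enorm v * enorm w).

(** Test the form at [w = v M]: then [|v M|^2 <= r |v| |v M|], and one factor cancels. *)
Lemma opbound_enorm n (r : R) (M : 'M[R]_n) v : 0 <= r -> opbound r M ->
  enorm (v *m M) <= r * enorm v.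
Proof.
move=> r0 rM; have := rM v (v *m M).
rewrite bformE ger0_norm ?dotr_ge0// -enorm_sqr expr2 mulrA.
have [->|v0] := eqVneq (enorm (v *m M)) 0; first by rewrite mulr_ge0 ?enorm_ge0.
by rewrite ler_pM2r// lt_neqAle eq_sym v0 enorm_ge0.
Qed.

Lemma opboundD n (r s : R) (M N : 'M[R]_n) :
  opbound r M -> opbound s N -> opbound (r + s) (M + N).
Proof.
move=> rM sN v w; rewrite bform_mxD mulrDl (le_trans (ler_normD _ _))//.
exact: lerD.
Qed.

Lemma opboundZ n (a r : R) (M : 'M[R]_n) :
  opbound r M -> opbound (`|a| * r) (a *: M).
Proof. by move=> rM v w; rewrite bform_mxZ normrM -mulrA ler_wpM2l. Qed.

Lemma opboundM n (r s : R) (M N : 'M[R]_n) : 0 <= r -> 0 <= s ->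
  opbound r M -> opbound s N -> opbound (r * s) (M *m N).
Proof.
move=> r0 s0 rM sN v w; rewrite -bform_mulmxl (le_trans (sN _ _))//.
rewrite [r * s]mulrC -mulrA ler_wpM2l// mulrA ler_wpM2r ?enorm_ge0//.
exact: opbound_enorm.
Qed.

Lemma opbound_entries n (M : 'M[R]_n) :
  opbound (\sum_i \sum_j `|M j i|) M.
Proof.
move=> v w; rewrite bform_expand (le_trans (ler_norm_sum _ _ _))//.
rewrite mulr_suml ler_sum// => i _; rewrite (le_trans (ler_norm_sum _ _ _))//.
rewrite mulr_suml ler_sum// => j _; rewrite !normrM mulrAC mulrC ler_wpM2l//.
by rewrite ler_pM// le_enorm_coord.
Qed.

Lemma opbound_ge0 n (M : 'M[R]_n) : 0 <= \sum_i \sum_j `|M j i|.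
Proof. by apply: sumr_ge0 => i _; apply: sumr_ge0. Qed.

(** Without boundedness the [sup] in [opnorm] would be a default value; the crude bound by the
    entries suffices. *)
Lemma has_sup_opnorm n (M : 'M[R]_n) :
  has_sup [set enorm (v *m M) | v in [set v : 'rV[R]_n | enorm v <= 1]].
Proof.
split.
  by exists (enorm (0 *m M)); exists 0 => //=; rewrite enorm0.
exists (\sum_i \sum_j `|M j i|) => _ [v /= v1 <-].
rewrite (le_trans (opbound_enorm _ _ (@opbound_entries _ M)))// ?opbound_ge0//.
by rewrite ler_piMr// opbound_ge0.
Qed.

Lemma enorm_opnorm n (M : 'M[R]_n) v : enorm (v *m M) <= opnorm M * enorm v.
Proof.
have [v0|v0] := eqVneq (enorm v) 0.
  by rewrite (enorm_eq0 v0) mul0mx !enorm0 mulr0.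
have v_gt0 : 0 < enorm v by rewrite lt_neqAle eq_sym v0 enorm_ge0.
rewrite -ler_pdivrMr//.
rewrite (_ : _ / _ = enorm (((enorm v)^-1 *: v) *m M)).
  apply: (ub_le_sup (has_sup_opnorm M).2); exists ((enorm v)^-1 *: v) => //=.
  by rewrite enormZ gtr0_norm ?invr_gt0// mulVf.
by rewrite -scalemxAl enormZ gtr0_norm ?invr_gt0// mulrC.
Qed.

Lemma opnorm_ge0 n (M : 'M[R]_n) : 0 <= opnorm M.
Proof.
apply: le_trans (enorm_ge0 (0 *m M)) _.
apply: (ub_le_sup (has_sup_opnorm M).2); exists 0 => //=.
by rewrite enorm0.
Qed.

Lemma opbound_opnorm n (M : 'M[R]_n) : opbound (opnorm M) M.
Proof.
move=> v w; rewrite bformE (le_trans (norm_dotr_le _ _))// mulrA.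
by rewrite ler_wpM2r ?enorm_ge0// enorm_opnorm.
Qed.

End BilinearForms.

Lemma cvg_sumr (R : realType) (T : Type) (F : set_system T) {FF : Filter F}
    (I : Type) (r : seq I) (f : I -> T -> R) (a : I -> R) :
  (forall i, f i x @[x --> F] --> a i) ->
  \sum_(i <- r) f i x @[x --> F] --> \sum_(i <- r) a i.
Proof.
move=> h; elim: r => [|i r IH].
  rewrite big_nil; under eq_fun do rewrite big_nil; exact: cvg_cst.
rewrite big_cons; under eq_fun do rewrite big_cons.
exact: cvgD.
Qed.

(** * Square roots of positive definite matrices *)

Section PositiveDefinite.
Context {R : realType}.


Lemma posdef_unitmx n (M : 'M[R]_n) : posdef M -> M \in unitmx.
Proof.
move=> [_ M0]; rewrite -row_free_unit; apply: inj_row_free => v vM.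
apply/eqP; apply: contraT => /M0; rewrite vM mul0mx mxE ltxx.
by [].
Qed.

Lemma posdef_ge0 n (M : 'M[R]_n) v : posdef M -> 0 <= bform M v v.
Proof.
move=> [_ M0]; have [->|v0] := eqVneq v 0; last exact: ltW (M0 _ v0).
by rewrite /bform !mul0mx mxE.
Qed.

Lemma posdefV n (M : 'M[R]_n) : posdef M -> posdef (invmx M).
Proof.
move=> pM; have uM := posdef_unitmx pM; have [sM M0] := pM.
split; first by rewrite trmx_inv sM.
move=> v v0; pose w := v *m invmx M.
have vE : v = w *m M by rewrite /w mulmxKV.
have w0 : w != 0 by apply: contra_neq v0; rewrite vE => ->; rewrite mul0mx.
have := M0 _ w0; rewrite {1}/w mulmxKV//.
by rewrite /w trmx_mul trmx_inv sM mulmxA.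
Qed.

Lemma posdefZ n a (M : 'M[R]_n) : 0 < a -> posdef M -> posdef (a *: M).
Proof.
move=> a0 [sM M0]; split; first by rewrite linearZ/= sM.
by move=> v /M0 h; have := bform_mxZ a M v v; rewrite /bform => ->; rewrite mulr_gt0.
Qed.

(* By Cauchy-Schwarz for the form [M], applied to [v] and [v *m invmx M],
   [|v|^4 <= (v M v^T) (v M^-1 v^T)]. *)
Lemma posdef_lb n (M : 'M[R]_n) : posdef M ->
  exists2 l : R, 0 < l & forall v, l * enorm v ^+ 2 <= bform M v v.
Proof.
move=> pM; have uM := posdef_unitmx pM; have [sM M0] := pM.
pose C := \sum_i \sum_j `|invmx M j i| + 1.
have C0 : 0 < C by rewrite ltr_wpDl// opbound_ge0.
exists C^-1 => [|v]; first by rewrite invr_gt0.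
have := @bform_CauchySchwarz _ _ M v (v *m invmx M) sM (fun u => posdef_ge0 u pM).
rewrite (bformC v)// bform_mulmxl mulVmx// bform1 -enorm_sqr.
have -> : bform M (v *m invmx M) (v *m invmx M) = bform (invmx M) v v.
  by rewrite bform_mulmxl mulVmx// bform1 dotrC bformE.
have bV : bform (invmx M) v v <= C * enorm v ^+ 2.
  rewrite (le_trans (ler_norm _))// (le_trans (@opbound_entries _ _ _ v v))//.
  by rewrite -expr2 ler_wpM2r ?sqr_ge0// lerDl.
move=> h; rewrite ler_pdivrMl//.
have [v0|v0] := eqVneq (enorm v) 0.
  by rewrite v0 expr0n mulr_ge0 ?(ltW C0)// posdef_ge0.
have v2 : 0 < enorm v ^+ 2 by rewrite exprn_gt0// lt_neqAle eq_sym v0 enorm_ge0.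
rewrite -(ler_pM2r v2) -expr2 (le_trans h)//.
by rewrite mulrAC mulrC ler_wpM2r ?posdef_ge0.
Qed.

Section SquareRootIteration.
Variables (n : nat) (X : 'M[R]_n) (r : R).
Hypotheses (r0 : 0 <= r) (r1 : r < 1) (symX : X^T = X) (rX : opbound r X).

(* The limit [Y] satisfies [2 Y = X + Y^2], so that [(1 - Y)^2 = 1 - X]. *)
Fixpoint sqrt_iter k : 'M[R]_n :=
  if k is k'.+1 then 2^-1 *: (X + sqrt_iter k' *m sqrt_iter k') else 0.

Lemma opbound_half s (M : 'M[R]_n) : opbound s M -> opbound (2^-1 * s) (2^-1 *: M).
Proof. by move=> /(opboundZ 2^-1); rewrite ger0_norm. Qed.

Lemma opbound_le s s' (M : 'M[R]_n) : s <= s' -> opbound s M -> opbound s' M.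
Proof.
move=> ss h v w; apply: (le_trans (h v w)).
by rewrite ler_wpM2r// mulr_ge0 ?enorm_ge0.
Qed.

Lemma opbound0 : opbound 0 (0 : 'M[R]_n).
Proof. by move=> v w; rewrite bformE mulmx0 /dotr mul0mx mxE normr0 mul0r. Qed.

Lemma sqrt_iter_sym k : (sqrt_iter k)^T = sqrt_iter k.
Proof.
elim: k => [|k IH]/=; first by rewrite trmx0.
by rewrite linearZ/= linearD/= trmx_mul IH symX.
Qed.

(** The radius [r] is preserved because [(r + r^2) / 2 <= r] for [r < 1]. *)
Lemma sqrt_iter_bound k : opbound r (sqrt_iter k).
Proof.
elim: k => [|k IH]/=; first exact: opbound_le opbound0.
apply: (opbound_le _ (opbound_half (opboundD rX (opboundM r0 r0 IH IH)))).
have : r * r <= r by rewrite ler_piMl// ltW.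
by lra.
Qed.

(** The difference of squares [Y'^2 - Y^2 = Y' (Y' - Y) + (Y' - Y) Y] needs no commutation; as both
    iterates are bounded by [r], half of it contracts by the factor [r]. *)
Lemma sqrt_iter_diff k : opbound (r ^+ k.+1) (sqrt_iter k.+1 - sqrt_iter k).
Proof.
elim: k => [|k IH].
  rewrite /= mulmx0 addr0 subr0; apply: (opbound_le _ (opbound_half rX)).
  by rewrite expr1 ler_piMl// invf_le1 ?ltr0n// ler1n.
have -> : sqrt_iter k.+2 - sqrt_iter k.+1 =
    2^-1 *: (sqrt_iter k.+1 *m (sqrt_iter k.+1 - sqrt_iter k) +
             (sqrt_iter k.+1 - sqrt_iter k) *m sqrt_iter k).
  rewrite [sqrt_iter k.+2]/= [X in _ - X]/= -scalerBr.
  congr (_ *: _); rewrite mulmxBr mulmxBl opprD addrACA subrr add0r.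
  by rewrite addrA subrK.
have rk : 0 <= r ^+ k.+1 by exact: exprn_ge0.
apply: (opbound_le _ (opbound_half (opboundD
  (opboundM r0 rk (sqrt_iter_bound k.+1) IH) (opboundM rk r0 IH (sqrt_iter_bound k))))).
by rewrite [r ^+ k.+2]exprS; lra.
Qed.

(** An entry is the form at two basis vectors, so the telescoping series of the entries is dominated
    by a geometric one. *)
Lemma sqrt_iter_cvg i j : cvgn (fun k => sqrt_iter k i j).
Proof.
have -> : (fun k => sqrt_iter k i j) =
    series (fun k => sqrt_iter k.+1 i j - sqrt_iter k i j).
  apply/funext => k; rewrite /series/= telescope_sumr//.
  by rewrite [sqrt_iter 0]/= mxE subr0.
apply: normed_cvg; apply: (@series_le_cvg _ _ (geometric r r)) => [k|k|k|].
- exact: normr_ge0.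
- by rewrite /= mulr_ge0// exprn_ge0.
- rewrite /= -exprS; have := sqrt_iter_diff k (delta_mx 0 i) (delta_mx 0 j).
  rewrite bform_delta !mxE; move/le_trans; apply.
  have e1 (l : 'I_n) : enorm (delta_mx 0 l : 'rV[R]_n) = 1.
    apply/eqP; rewrite -(@eqrXn2 _ 2)// ?enorm_ge0// enorm_sqr -bform1.
    by rewrite bform_delta mxE eqxx expr1n.
  by rewrite !e1 !mulr1.
- by apply: is_cvg_geometric_series; rewrite ger0_norm.
Qed.

Definition sqrt_lim : 'M[R]_n := \matrix_(i, j) limn (fun k => sqrt_iter k i j).

Lemma sqrt_limP i j : sqrt_iter k i j @[k --> \oo] --> sqrt_lim i j.
Proof. by rewrite mxE; exact: sqrt_iter_cvg. Qed.

Lemma sqrt_lim_fix : sqrt_lim = 2^-1 *: (X + sqrt_lim *m sqrt_lim).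
Proof.
apply/matrixP => i j.
have h1 : sqrt_iter k.+1 i j @[k --> \oo] --> sqrt_lim i j.
  by have := @sqrt_limP i j; rewrite -(cvg_shiftS (fun k => sqrt_iter k i j)).
have h2 : sqrt_iter k.+1 i j @[k --> \oo] -->
    (2^-1 *: (X + sqrt_lim *m sqrt_lim)) i j.
  rewrite !mxE; under eq_fun do rewrite /= !mxE.
  apply: cvgMl_tmp; apply: cvgD; first exact: cvg_cst.
  apply: cvg_sumr => l; apply: cvgM; exact: sqrt_limP.
exact: cvg_unique h1 h2.
Qed.

Lemma sqrt_lim_sym : sqrt_lim^T = sqrt_lim.
Proof.
apply/matrixP => i j; rewrite !mxE; congr (lim (_ @ \oo)); apply/funext => k.
by rewrite -[in LHS]sqrt_iter_sym mxE.
Qed.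

Lemma sqrt_lim_le v : bform sqrt_lim v v <= r * enorm v ^+ 2.
Proof.
have h : bform (sqrt_iter k) v v @[k --> \oo] --> bform sqrt_lim v v.
  rewrite bform_expand; under eq_fun do rewrite bform_expand.
  apply: cvg_sumr => i; apply: cvg_sumr => j.
  by apply: cvgMr_tmp; apply: cvgMl_tmp; exact: sqrt_limP.
apply: (ler_cvg_to h (cvg_cst (r * enorm v ^+ 2))); apply: nearW => k.
rewrite (le_trans (ler_norm _))// expr2.
exact: sqrt_iter_bound.
Qed.

End SquareRootIteration.

(** Divide [N] by a constant [c] above both its norm and its lower bound [l]: then [X = 1 - N / c]
    is semidefinite with norm at most [r = 1 - l / c < 1], the iteration converges, and its limit
    [Y] satisfies [(1 - Y)^2 = N / c]. *)
Lemma posdef_sqrt n (N : 'M[R]_n) : posdef N -> exists S : 'M[R]_n, posdef S /\ S *m S = N.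
Proof.
move=> pN; have [sN N0] := pN; have [l l0 lN] := posdef_lb pN.
pose c : R := \sum_i \sum_j `|N j i| + l + 1.
have c1 : l < c by rewrite /c -addrA ltr_wpDl ?opbound_ge0// ltrDl.
have c0 : 0 < c by exact: lt_trans c1.
have Nc v : bform N v v <= c * enorm v ^+ 2.
  rewrite (le_trans (ler_norm _))// (le_trans (@opbound_entries _ _ _ v v))//.
  rewrite -expr2 ler_wpM2r ?sqr_ge0// /c -addrA lerDl addr_ge0//.
  exact: ltW.
pose X : 'M[R]_n := 1%:M - c^-1 *: N; pose r : R := 1 - l / c.
have sX : X^T = X by rewrite linearB/= trmx1 linearZ/= sN.
have r0 : 0 <= r by rewrite subr_ge0 ler_pdivrMr// mul1r ltW.
have r1 : r < 1 by rewrite ltrBlDr ltrDl divr_gt0.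
have XE v : bform X v v = enorm v ^+ 2 - c^-1 * bform N v v.
  by rewrite bform_mxB bform_mxZ bform1 enorm_sqr.
have X0 v : 0 <= bform X v v by rewrite XE subr_ge0 ler_pdivrMl.
have Xr v : bform X v v <= r * enorm v ^+ 2.
  rewrite XE mulrBl mul1r lerB// mulrAC mulrC ler_wpM2l ?invr_ge0 ?(ltW c0)//.
(* Cauchy-Schwarz for the semidefinite form [X] turns the bound on its quadratic form into one on
   the bilinear form. *)
have rX : opbound r X.
  move=> v w; rewrite -(@ler_pXn2r _ 2)// ?nnegrE ?mulr_ge0 ?enorm_ge0//.
  rewrite real_normK ?num_real// (le_trans (bform_CauchySchwarz v w sX X0))//.
  apply: (@le_trans _ _ ((r * enorm v ^+ 2) * (r * enorm w ^+ 2))).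
    by rewrite ler_pM.
  by rewrite le_eqVlt; apply/orP; left; apply/eqP; ring.
pose Z := 1%:M - sqrt_lim X.
have ZE : Z *m Z = c^-1 *: N.
  rewrite /Z mulmxBr !mulmxBl !mulmx1 !mul1mx.
  have := sqrt_lim_fix r0 r1 rX; set Y := sqrt_lim X => YE.
  have -> : Y *m Y = 2 *: Y - X.
    by rewrite [in RHS]YE scalerA divff ?pnatr_eq0// scale1r addrC addKr.
  rewrite /X opprB opprB; apply/matrixP => i j; rewrite !mxE; ring.
have pZ : posdef Z.
  split; first by rewrite linearB/= trmx1 sqrt_lim_sym.
  move=> v v0; have -> : (v *m Z *m v^T) 0 0 = bform Z v v by [].
  rewrite bform_mxB bform1 -enorm_sqr.
  apply: (@lt_le_trans _ _ ((1 - r) * enorm v ^+ 2)).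
    rewrite mulr_gt0 ?subr_gt0// exprn_gt0// lt_neqAle enorm_ge0 andbT.
    by apply: contra_neq v0 => /esym/enorm_eq0.
  by rewrite mulrBl mul1r lerB// sqrt_lim_le.
exists (Num.sqrt c *: Z); split; first by apply: posdefZ => //; rewrite sqrtr_gt0.
rewrite -scalemxAl -scalemxAr scalerA -expr2 sqr_sqrtr ?(ltW c0)// ZE.
by rewrite scalerA divff ?scale1r// gt_eqF.
Qed.

Lemma inv_sqrtmxP n (M : 'M[R]_n) : posdef M ->
  posdef (inv_sqrtmx M) /\ inv_sqrtmx M *m inv_sqrtmx M = invmx M.
Proof.
move=> pM; rewrite /inv_sqrtmx; case: xgetP => [S _ [] //|h].
by have [S /h] := posdef_sqrt (posdefV pM).
Qed.

Lemma inv_sqrtmxK n (M : 'M[R]_n) : posdef M ->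
  inv_sqrtmx M *m M *m inv_sqrtmx M = 1%:M.
Proof.
move=> pM; have [_ SS] := inv_sqrtmxP pM.
by apply: mulmx1C; rewrite mulmxA SS mulVmx ?posdef_unitmx.
Qed.

(** With [S = inv_sqrtmx M] one has [S M S = 1], so the form [M] at [v S] is [|v|^2]. *)
Lemma enorm_inv_sqrtmx n (M : 'M[R]_n) (l : R) v : posdef M -> 0 < l ->
  (forall u, l * enorm u ^+ 2 <= bform M u u) ->
  l * enorm (v *m inv_sqrtmx M) ^+ 2 <= enorm v ^+ 2.
Proof.
move=> pM l0 lM; apply: (le_trans (lM _)).
have [[sS _] _] := inv_sqrtmxP pM.
rewrite bform_mulmxl /bform trmx_mul sS !mulmxA.
by rewrite -2!(mulmxA v) inv_sqrtmxK// mulmx1 enorm_sqr.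
Qed.

End PositiveDefinite.

(** * Integrals against a measure with a density *)

Section IntegralTools.
Context d (T : measurableType d) {R : realType}.

Lemma integrable_bounded (mu : {finite_measure set T -> \bar R}) (f : T -> R) (M : R) :
  measurable_fun [set: T] f -> (forall x, `|f x| <= M) ->
  mu.-integrable [set: T] (EFin \o f).
Proof.
move=> mf fM; apply: (@le_integrable _ _ _ _ _ _ _ (EFin \o cst M)) => //.
- exact/measurable_EFinP.
- by move=> x _ /=; rewrite lee_fin (le_trans (fM x))// ler_norm.
- exact: finite_measure_integrable_cst.
Qed.

(** The density agrees almost everywhere with the Radon-Nikodym derivative of [nu], to which the
    change of variables applies. *)
Lemma ge0_integral_density (mu : {sigma_finite_measure set T -> \bar R})
    (nu : {finite_measure set T -> \bar R}) (g : T -> R) :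
  measurable_fun [set: T] g -> (forall x, 0 <= g x) ->
  (forall A, measurable A -> nu A = \int[mu]_(x in A) (g x)%:E)%E ->
  forall f : T -> \bar R, measurable_fun [set: T] f -> (forall x, 0 <= f x)%E ->
  (\int[nu]_x f x = \int[mu]_x (f x * (g x)%:E))%E.
Proof.
move=> mg g0 nug f mf f0.
have dom : nu `<< mu.
  apply/null_content_dominatesP => A mA muA0; rewrite nug//.
  apply: null_set_integral => //; apply: measurable_funTS.
  exact/measurable_EFinP.
have intR := Radon_Nikodym_SigmaFinite.f_integrable dom.
rewrite -(Radon_Nikodym_SigmaFinite.change_of_variables dom)//.
apply: ae_eq_integral => //.
- apply: emeasurable_funM => //; exact: measurable_int intR.
- by apply: emeasurable_funM => //; exact/measurable_EFinP.
- apply: ae_eqe_mul2l.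
  apply: integral_ae_eq => //.
  + exact/measurable_EFinP.
  + by move=> A _ mA; rewrite -Radon_Nikodym_SigmaFinite.f_integral// nug.
Qed.

Lemma integral_density (mu : {sigma_finite_measure set T -> \bar R})
    (nu : {finite_measure set T -> \bar R}) (g : T -> R) :
  measurable_fun [set: T] g -> (forall x, 0 <= g x) ->
  (forall A, measurable A -> nu A = \int[mu]_(x in A) (g x)%:E)%E ->
  forall f : T -> R, measurable_fun [set: T] f ->
  mu.-integrable [set: T] (fun x => (f x * g x)%:E) ->
  nu.-integrable [set: T] (EFin \o f) /\
  \int[nu]_x f x = \int[mu]_x (f x * g x).
Proof.
move=> mg g0 nug f mf intfg.
have D := ge0_integral_density mg g0 nug.
split.
  apply/integrableP; split; first exact/measurable_EFinP.
  rewrite D//; last exact/measurableT_comp/measurable_EFinP.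
  have /integrableP[_] := intfg.
  under eq_integral do rewrite /= normrM (ger0_norm (g0 _)) EFinM.
  by [].
rewrite /Rintegral; congr fine; rewrite integralE [in RHS]integralE.
rewrite D//; last by apply: measurable_funepos; exact/measurable_EFinP.
rewrite D//; last by apply: measurable_funeneg; exact/measurable_EFinP.
congr (_ - _)%E; apply: eq_integral => x _.
  rewrite !funeposE -!EFin_max -EFinM.
  by rewrite maxr_pMl// mul0r.
rewrite !funenegE -!EFinN -!EFin_max -EFinM.
by rewrite maxr_pMl// mul0r mulNr.
Qed.

End IntegralTools.

Lemma measurable_cos {R : realType} : measurable_fun [set: R] (@cos R).
Proof. by apply: continuous_measurable_fun; exact: continuous_cos. Qed.

Lemma measurable_sin {R : realType} : measurable_fun [set: R] (@sin R).
Proof. by apply: continuous_measurable_fun; exact: continuous_sin. Qed.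

(** * The normal law *)

Section Normal.
Context {R : realType}.
Variables (m s : R).
Hypothesis s0 : 0 < s.
Local Notation mu := (@lebesgue_measure R).
Local Notation N := (normal_prob m s).

Let s_neq0 : s != 0. Proof. by rewrite gt_eqF. Qed.

(** Centring at [m] matches the Gaussian exponent; the exponent is a successor because the next
    estimate divides by it. *)
Definition poly_growth (f : R -> R) :=
  exists C k, forall x, `|f x| <= C * (1 + (x - m) ^+ 2) ^+ k.+1.

(** Doubling the variance spends half of the exponent, a factor [e^-z], and
    [e^z = (e^(z / (k + 1)))^(k + 1)] dominates [(1 + z / (k + 1))^(k + 1)], hence the
    polynomial. *)
Lemma normal_pdf_growth k : exists2 C : R, 0 <= C &
  forall x, (1 + (x - m) ^+ 2) ^+ k.+1 * normal_pdf m s x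
            <= C * normal_pdf m (s * Num.sqrt 2) x.
Proof.
have r0 : s * Num.sqrt 2 != 0 by rewrite mulf_neq0// gt_eqF// sqrtr_gt0.
have p0 : 0 < normal_peak (s * Num.sqrt 2) by rewrite normal_peak_gt0.
(* As [(x - m)^2 = 4 s^2 z], this [K] gives [1 + (x - m)^2 <= K (1 + z / (k + 1))]. *)
pose K : R := 1 + 4 * s ^+ 2 * k.+1%:R.
have K0 : 0 <= K by rewrite addr_ge0// mulr_ge0// mulr_ge0// sqr_ge0.
exists (K ^+ k.+1 * normal_peak s / normal_peak (s * Num.sqrt 2)) => [|x].
  by rewrite divr_ge0 ?(ltW p0)// mulr_ge0 ?normal_peak_ge0// exprn_ge0.
rewrite !normal_pdfE// /normal_fun [leRHS]mulrA divfK ?gt_eqF//.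
rewrite mulrCA [leRHS]mulrAC [leRHS]mulrC ler_wpM2l ?normal_peak_ge0//.
set y := (x - m) ^+ 2; have y0 : 0 <= y by exact: sqr_ge0.
have s2 : s ^+ 2 != 0 by rewrite expf_neq0.
pose z := y / (4 * s ^+ 2).
have z0 : 0 <= z by rewrite divr_ge0// mulr_ge0// sqr_ge0.
have -> : - y / (s ^+ 2 *+ 2) = - z - z by rewrite /z; field.
have -> : - y / ((s * Num.sqrt 2) ^+ 2 *+ 2) = - z.
  by rewrite exprMn sqr_sqrtr// /z; field.
rewrite expRD mulrA ler_wpM2r ?expR_ge0//.
rewrite expRN -ler_pdivlMr ?invr_gt0 ?expR_gt0// invrK.
have -> : expR z = expR (z / k.+1%:R) ^+ k.+1.
  by rewrite -expRM_natr divfK// pnatr_eq0.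
rewrite -exprMn ler_pXn2r ?nnegrE; first last.
- by rewrite mulr_ge0 ?expR_ge0.
- by rewrite addr_ge0.
- by [].
apply: (@le_trans _ _ (K * (1 + z / k.+1%:R))); last first.
  by rewrite ler_wpM2l// expR_ge1Dx.
have -> : y = 4 * s ^+ 2 * z by rewrite /z; field.
have k0 : k.+1%:R != 0 :> R by rewrite pnatr_eq0.
have -> : K * (1 + z / k.+1%:R) =
  1 + z / k.+1%:R + 4 * s ^+ 2 * k.+1%:R + 4 * s ^+ 2 * z by rewrite /K; field.
have ks : 0 <= 4 * s ^+ 2 * k.+1%:R by rewrite mulr_ge0// mulr_ge0// sqr_ge0.
have zk : 0 <= z / k.+1%:R by rewrite divr_ge0.
by rewrite lerD2r -addrA lerDl addr_ge0.
Qed.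

Lemma normal_density A : measurable A ->
  (N A = \int[mu]_(x in A) (normal_pdf m s x)%:E)%E.
Proof. by []. Qed.

Lemma poly_growth_integrable_pdf (f : R -> R) : measurable_fun [set: R] f ->
  poly_growth f -> mu.-integrable [set: R] (fun x => (f x * normal_pdf m s x)%:E).
Proof.
move=> mf [C [k fC]]; have [K K0 hK] := normal_pdf_growth k.
apply: (@le_integrable _ (measurableTypeR R) _ mu _ measurableT _
    (fun x => ((C * K) * normal_pdf m (s * Num.sqrt 2) x)%:E)) => //.
- by apply/measurable_EFinP/measurable_funM => //; exact: measurable_normal_pdf.
- move=> x _; rewrite lee_fin normrM (ger0_norm (normal_pdf_ge0 _ _ _)).
  apply: (@le_trans _ _ (C * (1 + (x - m) ^+ 2) ^+ k.+1 * normal_pdf m s x)).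
    by rewrite ler_wpM2r ?normal_pdf_ge0.
  have C0 : 0 <= C.
    have := le_trans (normr_ge0 _) (fC m).
    by rewrite subrr expr0n addr0 expr1n mulr1.
  rewrite -mulrA ger0_norm; last by rewrite !mulr_ge0 ?normal_pdf_ge0.
  by rewrite -mulrA ler_wpM2l.
- under eq_fun do rewrite EFinM.
  by apply: integrableZl => //; exact: integrable_normal_pdf.
Qed.

Lemma normal_integrable (f : R -> R) : measurable_fun [set: R] f ->
  poly_growth f -> N.-integrable [set: R] (EFin \o f).
Proof.
move=> mf gf; have [] := @integral_density _ (measurableTypeR R) R mu N _
  (measurable_normal_pdf m s) (normal_pdf_ge0 m s) normal_density f mf (poly_growth_integrable_pdf mf gf).
by [].
Qed.

Lemma normal_integralE (f : R -> R) : measurable_fun [set: R] f ->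
  poly_growth f -> \int[N]_x f x = \int[mu]_x (f x * normal_pdf m s x).
Proof.
move=> mf gf; have [] := @integral_density _ (measurableTypeR R) R mu N _
  (measurable_normal_pdf m s) (normal_pdf_ge0 m s) normal_density f mf (poly_growth_integrable_pdf mf gf).
by [].
Qed.

Lemma normal_pdf_is_derive (x : R) :
  is_derive x 1 (normal_pdf m s) (- ((x - m) / s ^+ 2) * normal_pdf m s x).
Proof.
rewrite normal_pdfE//.
have -> : normal_fun m s x = expR (- (x - m) ^+ 2 / (s ^+ 2 *+ 2)) by [].
rewrite /normal_fun.
pose q := fun y : R => - (y - m) ^+ 2 / (s ^+ 2 *+ 2).
have dq : is_derive x 1 q (- ((x - m) / s ^+ 2)).
  rewrite /q; apply: is_derive_eq.
  by rewrite /GRing.scale/=; field.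
have h := is_deriveZ (normal_peak s) (is_derive1_comp (is_derive_expR (q x)) dq).
apply: (is_derive_eq h); rewrite /GRing.scale/= /q; ring.
Qed.

(* Integrability of [h'] and [h] against the density makes the boundary terms of
   the integration by parts vanish along [[-n, n]]. *)
Lemma normal_stein (h h' : R -> R) :
  (forall x : R, is_derive x 1 h (h' x)) -> continuous h' ->
  poly_growth h -> poly_growth h' ->
  \int[N]_x ((x - m) * h x) = s ^+ 2 * \int[N]_x h' x.
Proof.
move=> dh ch' gh gh'.
have ch : continuous h.
  by move=> x; apply/differentiable_continuous/derivable1_diffP; case: (dh x).
have mh : measurable_fun [set: R] h by exact: continuous_measurable_fun.
have mh' : measurable_fun [set: R] h' by exact: continuous_measurable_fun.
have cx : continuous (fun x : R => x - m).
  by move=> x; apply: cvgB => //; exact: cvg_cst.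
have mxh : measurable_fun [set: R] (fun x => (x - m) * h x).
  by apply: continuous_measurable_fun => x; apply: cvgM; [exact: cx|exact: ch].
have gxh : poly_growth (fun x => (x - m) * h x).
  have [C [k hC]] := gh; exists C, k.+1 => x; rewrite normrM.
  rewrite [leRHS](_ : _ = (1 + (x - m) ^+ 2) * (C * (1 + (x - m) ^+ 2) ^+ k.+1)); last by rewrite exprS mulrCA.
  apply: ler_pM => //; rewrite -real_normK ?num_real//.
  by have := normr_ge0 (x - m); nra.
rewrite normal_integralE// normal_integralE//.
(* [phi] is the derivative of [h * normal_pdf]; the claim is that its integral vanishes. *)
pose phi x := (h' x - (x - m) / s ^+ 2 * h x) * normal_pdf m s x.
have i1 := poly_growth_integrable_pdf mh' gh'.
have i2 := poly_growth_integrable_pdf mxh gxh.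
have i3 := integrableZl measurableT (s ^- 2) i2.
have phiE x : (phi x)%:E = ((h' x * normal_pdf m s x)%:E -
    (s ^- 2)%:E * ((x - m) * h x * normal_pdf m s x)%:E)%E.
  by rewrite -EFinM -EFinB; congr EFin; rewrite /phi; field.
have iphi : mu.-integrable [set: measurableTypeR R] (EFin \o phi).
  have -> : EFin \o phi = (fun x : measurableTypeR R => ((h' x * normal_pdf m s x)%:E -
    (s ^- 2)%:E * ((x - m) * h x * normal_pdf m s x)%:E)%E).
    by apply/funext => x; exact: phiE.
  exact: integrableB.
suff : \int[mu]_x phi x = 0.
  rewrite /Rintegral (eq_integral (fun x : measurableTypeR R => ((h' x * normal_pdf m s x)%:E -
    (s ^- 2)%:E * ((x - m) * h x * normal_pdf m s x)%:E)%E)); last first.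
    by move=> x _; exact: phiE.
  rewrite integralB// integralZl// fineB//; last 2 first.
  - exact: integrable_fin_num.
  - by rewrite -integralZl//; exact: integrable_fin_num.
  rewrite fineM//; last exact: integrable_fin_num.
  by move/eqP; rewrite subr_eq0 => /eqP ->; rewrite mulrA divff ?mul1r// expf_neq0.
pose F x := h x * normal_pdf m s x.
have dF (x : R) : is_derive x 1 F (phi x).
  have d1 := dh x; have d2 := normal_pdf_is_derive x.
  apply: is_derive_eq; rewrite /GRing.scale/= /phi; ring.
have cpdf : continuous (normal_pdf m s) by exact: continuous_normal_pdf.
have cphi : continuous phi.
  move=> x; apply: cvgM; last exact: cpdf.
  apply: cvgB; first exact: ch'.
  by apply: cvgM; [apply: cvgM; [exact: cx|exact: cvg_cst]|exact: ch].
have cF : continuous F.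
  by move=> x; apply: cvgM; [exact: ch|exact: cpdf].
(* Applying the growth lemma with one power more than [h] requires leaves a decay of order
   [1 / (1 + (x - m)^2)] for the boundary terms. *)
have [K K0 FK] : exists2 K, 0 <= K & forall x, `|F x| <= K / (1 + (x - m) ^+ 2).
  have [C [k hC]] := gh; have [K K0 hK] := normal_pdf_growth k.+1.
  have r0 : s * Num.sqrt 2 != 0 by rewrite mulf_neq0// gt_eqF// sqrtr_gt0.
  have C0 : 0 <= C.
    have := le_trans (normr_ge0 _) (hC m).
    by rewrite subrr expr0n addr0 expr1n mulr1.
  exists (C * (K * normal_peak (s * Num.sqrt 2))) => [|x].
    by rewrite !mulr_ge0 ?normal_peak_ge0.
  have x2 : 0 < 1 + (x - m) ^+ 2 by rewrite ltr_pwDl ?sqr_ge0.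
  rewrite ler_pdivlMr// /F normrM (ger0_norm (normal_pdf_ge0 _ _ _)).
  apply: (@le_trans _ _ (C * (1 + (x - m) ^+ 2) ^+ k.+1 * normal_pdf m s x *
                         (1 + (x - m) ^+ 2))).
    by rewrite ler_wpM2r ?(ltW x2)// ler_wpM2r ?normal_pdf_ge0.
  have -> : C * (1 + (x - m) ^+ 2) ^+ k.+1 * normal_pdf m s x * (1 + (x - m) ^+ 2)
      = C * ((1 + (x - m) ^+ 2) ^+ k.+2 * normal_pdf m s x).
    by rewrite [X in _ = _ * (X * _)]exprS; ring.
  rewrite ler_wpM2l// (le_trans (hK x))// ler_wpM2l//.
  exact: normal_pdf_ub.
have ftc n : \int[mu]_(x in `[m - n.+1%:R, m + n.+1%:R]) phi x =
    F (m + n.+1%:R) - F (m - n.+1%:R).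
  rewrite /Rintegral (@continuous_FTC2 _ phi F)//.
  - by rewrite ltrD2l gtrN// ltr0n.
  - exact: continuous_subspaceT.
  - split.
    + by move=> x _; case: (dF x).
    + by apply: cvg_at_right_filter; exact: cF.
    + by apply: cvg_at_left_filter; exact: cF.
  - by move=> x _; rewrite derive1E; case: (dF x).
have lim1 : \int[mu]_(x in `[m - n.+1%:R, m + n.+1%:R]) phi x @[n --> \oo] -->
    \int[mu]_x phi x.
  pose f_ n : R -> \bar R := (EFin \o phi) \_ `[m - n.+1%:R, m + n.+1%:R].
  have mphi : measurable_fun [set: R] (EFin \o phi).
    exact: measurable_int iphi.
  have mf n : measurable_fun [set: R] (f_ n).
    apply/(measurable_restrictT _ _).1 => //.
    exact: measurable_funTS.
  have fphi : {ae mu, forall x : R, [set: R] x -> f_ n x @[n --> \oo] --> (EFin \o phi) x}.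
    apply: aeW => x _; apply: cvg_near_cst; near=> n.
    rewrite /f_ patchE mem_set//= in_itv/= -ler_distlC.
    apply: (@le_trans _ _ n%:R); last by rewrite ler_nat.
    near: n; exact: nbhs_infty_ger.
  have fle : {ae mu, forall (x : R) n, [set: R] x -> (`|f_ n x| <= (abse \o (EFin \o phi)) x)%E}.
    apply: aeW => x n _; rewrite /f_ patchE; case: ifPn => // _.
    by rewrite (_ : point = 0%E)// abse0; exact: abse_ge0.
  have [_ _ /=] := @dominated_convergence _ (measurableTypeR R) R mu _ measurableT
    f_ _ _ mf mphi fphi (integrable_abse iphi) fle.
  have -> : (\int[mu]_x (phi x)%:E = (\int[mu]_x phi x)%:E)%E.
    by rewrite /Rintegral fineK//; exact: integrable_fin_num.
  move=> /fine_cvg.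
  apply: cvg_trans; apply: near_eq_cvg; apply: nearW => n.
  by rewrite /= /Rintegral integral_mkcond.
have lim0 : F (m + n.+1%:R) - F (m - n.+1%:R) @[n --> \oo] --> 0.
  apply: (@norm_cvg0 _ R).
  have h0 : 2 * K * harmonic n @[n --> \oo] --> 0.
    by rewrite -(mulr0 (2 * K)); apply: cvgMl_tmp; exact: cvg_harmonic.
  apply: (squeeze_cvgr _ (cvg_cst 0) h0); apply: nearW => n.
  rewrite normr_ge0/= (le_trans (ler_normB _ _))//.
  have b y : `|y - m| = n.+1%:R -> `|F y| <= K * harmonic n.
    move=> yn; apply: (le_trans (FK y)); rewrite ler_wpM2l// lef_pV2 ?posrE ?ltr0n//; last first.
      by rewrite ltr_pwDl ?sqr_ge0.
    rewrite -(real_normK (num_real (y - m))) yn.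
    have : 1 <= n.+1%:R :> R by rewrite ler1n.
    by nra.
  rewrite -mulrA mulr_natl mulr2n lerD// b//.
  - by rewrite addrAC subrr add0r normr_nat.
  - by rewrite addrAC subrr add0r normrN normr_nat.
apply: cvg_unique lim1 _ => //.
rewrite /=; under eq_fun do rewrite ftc.
exact: lim0.
Unshelve. all: by end_near. Qed.

Lemma bounded_poly_growth (f : R -> R) C : (forall x, `|f x| <= C) -> poly_growth f.
Proof.
move=> fC; exists C, 0%N => x; apply: (le_trans (fC x)).
rewrite expr1 ler_peMr ?lerDl ?sqr_ge0//.
exact: le_trans (normr_ge0 _) (fC m).
Qed.

Lemma is_derive_affine (c u x : R) :
  is_derive x 1 (fun x : R => c + u * (x - m)) u.
Proof.
apply: is_derive_eq; rewrite /GRing.scale/=; ring.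
Qed.

Lemma continuous_affine (c u : R) : continuous (fun x : R => c + u * (x - m)).
Proof.
move=> x; apply: cvgD; first exact: cvg_cst.
by apply: cvgMl_tmp; apply: cvgB => //; exact: cvg_cst.
Qed.

Lemma measurable_affine (c u : R) : measurable_fun [set: R] (fun x : R => c + u * (x - m)).
Proof. by apply: continuous_measurable_fun; exact: continuous_affine. Qed.

Let chf (c u : R) : R := \int[N]_x cos (c + u * (x - m)).

(** Differentiation under the integral gives minus the mean of [(x - m) sin (c + u (x - m))];
    Stein's identity with [h] this sine brings the cosine back and yields a linear differential
    equation in [u]. *)
Let chf_derive (c u : R) : is_derive u (1 : R) (chf c) (- (s ^+ 2 * u) * chf c u).
Proof.
pose f (v x : R) : R := cos (c + v * (x - m)).
have mf (v : R) : measurable_fun [set: R] (f v).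
  by apply: (measurableT_comp measurable_cos); exact: measurable_affine.
have df (v x : R) : is_derive v 1 (f ^~ x) (- sin (c + v * (x - m)) * (x - m)).
  have h1 : is_derive v 1 (fun v : R => c + v * (x - m)) (x - m).
    by apply: is_derive_eq; rewrite /GRing.scale/=; ring.
  exact: (is_derive1_comp (is_derive_cos _) h1).
have d1f (v x : R) : partial1of2 f v x = - sin (c + v * (x - m)) * (x - m).
  by rewrite partial1of2E; case: (df v x).
have Iu : `]u - 1, u + 1[%classic u by rewrite /= in_itv/= ltrBlDr ltrDl ltr01.
have intf (v : R) : `]u - 1, u + 1[%classic v -> N.-integrable [set: R] (EFin \o f v).
  by move=> _; exact: (@integrable_bounded _ _ _ N _ 1 (mf v) (fun x => cos_max _)).
have derf (v x : R) : `]u - 1, u + 1[%classic v -> [set: R] x -> derivable (f ^~ x) v 1.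
  by move=> _ _; case: (df v x).
pose G (x : R) := `|x - m|.
have iG : N.-integrable [set: R] (EFin \o G).
  apply: normal_integrable.
    by apply: continuous_measurable_fun => x; apply: cvg_norm; apply: cvgB => //; exact: cvg_cst.
  exists 1, 0%N => x; rewrite mul1r expr1 /G normr_id.
  by rewrite -(real_normK (num_real (x - m))); nra.
have Gub (v x : R) : `]u - 1, u + 1[%classic v -> [set: R] x -> `|partial1of2 f v x| <= G x.
  by move=> _ _; rewrite d1f normrM normrN ler_piMl// sin_max.
have D := derivable_under_integral measurableT Iu intf derf (fun x => normr_ge0 _) iG Gub.
have E := differentiation_under_integral measurableT Iu intf derf (fun x => normr_ge0 _) iG Gub.
apply: DeriveDef => //; rewrite -derive1E [LHS]E.
have dh (x : R) : is_derive x 1 (fun x : R => sin (c + u * (x - m)))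
    (u * cos (c + u * (x - m))).
  have := is_derive1_comp (is_derive_sin _) (is_derive_affine c u x).
  by rewrite mulrC.
have ch' : continuous (fun x : R => u * cos (c + u * (x - m))).
  move=> x; apply: cvgMl_tmp.
  by apply: (continuous_comp (@continuous_affine c u x)); exact: continuous_cos.
have gh : poly_growth (fun x : R => sin (c + u * (x - m))).
  by apply: (@bounded_poly_growth _ (1)) => x; exact: sin_max.
have gh' : poly_growth (fun x : R => u * cos (c + u * (x - m))).
  by apply: (@bounded_poly_growth _ (`|u|)) => x; rewrite normrM ler_piMr// cos_max.
have St := normal_stein dh ch' gh gh'.
have -> : \int[N]_y partial1of2 f u y = \int[N]_y (-1 * ((y - m) * sin (c + u * (y - m)))).
  by apply: eq_Rintegral => y _; rewrite d1f; ring.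
rewrite RintegralZl//; last first.
  apply: normal_integrable.
    apply: measurable_funM; first exact/measurable_funB.
    by apply: (measurableT_comp measurable_sin); exact: measurable_affine.
  exists 1, 0%N => x; rewrite mul1r expr1 normrM.
  rewrite (le_trans (ler_piMr (normr_ge0 _) (sin_max _)))//.
  by rewrite -(real_normK (num_real (x - m))); have := normr_ge0 (x - m); nra.
rewrite St RintegralZl//; last by apply: intf.
by rewrite /chf; ring.
Qed.

(** The solution of that equation: the product with [expR (s^2 u^2 / 2)] has zero derivative and
    equals [cos c] at [u = 0]. *)
Lemma normal_cos c u :
  \int[N]_x cos (c + u * (x - m)) = cos c * expR (- (s ^+ 2 * u ^+ 2 / 2)).
Proof.
pose psi u := chf c u * expR (s ^+ 2 * u ^+ 2 / 2).
have dpsi (v : R) : is_derive v 1 psi 0.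
  have h1 : is_derive v 1 (fun v : R => s ^+ 2 * v ^+ 2 / 2) (s ^+ 2 * v).
    by apply: is_derive_eq; rewrite /GRing.scale/=; field.
  have h2 := is_derive1_comp (is_derive_expR _) h1.
  have h3 := chf_derive c v.
  apply: (is_derive_eq (is_deriveM h3 h2)); rewrite /GRing.scale/=; ring.
have E := is_derive_0_is_cst u 0 dpsi.
have psi0 : psi 0 = cos c.
  rewrite /psi expr0n mulr0 mul0r expR0 mulr1 /chf.
  under eq_Rintegral do rewrite mul0r addr0.
  by rewrite Rintegral_cst//= probability_setT mulr1.
by rewrite -psi0 -E /psi -mulrA -expRD subrr expR0 mulr1.
Qed.

Lemma normal_sin c u :
  \int[N]_x sin (c + u * (x - m)) = sin c * expR (- (s ^+ 2 * u ^+ 2 / 2)).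
Proof.
have h y : sin y = cos (y - pi / 2) :> R.
  by rewrite cosB cos_pihalf sin_pihalf mulr0 mulr1 add0r.
rewrite (h c) -normal_cos; apply: eq_Rintegral => x _; rewrite h.
by congr cos; ring.
Qed.

Lemma normal_pow_growth k : poly_growth (fun x => ((x - m) / s) ^+ k).
Proof.
exists (s^-1 ^+ k), k => x; rewrite exprMn normrM mulrC ger0_norm; last first.
  by rewrite exprn_ge0// invr_ge0 ltW.
rewrite ler_wpM2l ?exprn_ge0 ?invr_ge0 ?(ltW s0)// normrX.
have h : `|x - m| <= 1 + (x - m) ^+ 2.
  by rewrite -(real_normK (num_real (x - m))); have := normr_ge0 (x - m); nra.
have h1 : 1 <= 1 + (x - m) ^+ 2 by rewrite lerDl sqr_ge0.
apply: (@le_trans _ _ ((1 + (x - m) ^+ 2) ^+ k)).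
  by rewrite lerXn2r ?nnegrE// (le_trans _ h1).
by rewrite ler_weXn2l.
Qed.

Lemma normal_pow_continuous k : continuous (fun x : R => ((x - m) / s) ^+ k).
Proof.
move=> x; apply: (@continuous_comp _ _ _ (fun y : R => (y - m) / s)
  (fun y : R => y ^+ k)); last exact: exprn_continuous.
by apply: cvgMr_tmp; apply: cvgB => //; exact: cvg_cst.
Qed.

Definition normal_moment k := \int[N]_x ((x - m) / s) ^+ k.

Lemma normal_pow_integrable k :
  N.-integrable [set: R] (EFin \o (fun x => ((x - m) / s) ^+ k)).
Proof.
apply: normal_integrable; last exact: normal_pow_growth.
by apply: continuous_measurable_fun; exact: normal_pow_continuous.
Qed.

Lemma normal_moment0 : normal_moment 0 = 1.
Proof.
rewrite /normal_moment; under eq_Rintegral do rewrite expr0.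
by rewrite Rintegral_cst//= probability_setT mulr1.
Qed.

Lemma normal_moment1 : normal_moment 1 = 0.
Proof.
have d1 (x : R) : is_derive x 1 (cst (1 : R)) 0 by exact: is_derive_cst.
have := @normal_stein (cst 1) (cst 0) d1 (fun x => cvg_cst _)
  (@bounded_poly_growth _ 1 _) (@bounded_poly_growth _ 1 _).
rewrite /= Rintegral_cst//= mul0r mulr0 => h.
rewrite /normal_moment; transitivity (\int[N]_x (s^-1 * ((x - m) * 1))).
  by apply: eq_Rintegral => x _; rewrite mulr1 expr1 mulrC.
rewrite RintegralZl//; last first.
  have := integrableZl measurableT s (normal_pow_integrable 1).
  apply: eq_integrable => // x _ /=; rewrite -EFinM; congr EFin.
  by rewrite expr1 mulr1; field.
by rewrite h ?mulr0// => x; rewrite ?normr1// normr0.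
Qed.

(** Stein's identity for the power [k + 1] of the standardized variable. *)
Lemma normal_momentSS k : normal_moment k.+2 = k.+1%:R * normal_moment k.
Proof.
have dh (x : R) : is_derive x 1 (fun x : R => ((x - m) / s) ^+ k.+1)
    (k.+1%:R / s * ((x - m) / s) ^+ k).
  have h1 : is_derive x 1 (fun x : R => (x - m) / s) (s^-1).
    by apply: is_derive_eq; rewrite /GRing.scale/=; field.
  have h2 := is_deriveX k.+1 h1.
  rewrite (_ : (fun x : R => _) = (fun x : R => (x - m) / s) ^+ k.+1); last first.
    by apply/funext => y; rewrite exprfctE.
  apply: (is_derive_eq h2).
  by rewrite /GRing.scale/=; field.
have ch' : continuous (fun x : R => k.+1%:R / s * ((x - m) / s) ^+ k).
  by move=> x; apply: cvgMl_tmp; exact: normal_pow_continuous.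
have gh' : poly_growth (fun x : R => k.+1%:R / s * ((x - m) / s) ^+ k).
  have [C [j hC]] := normal_pow_growth k.
  exists (`|k.+1%:R / s| * C), j => x.
  by rewrite normrM -mulrA ler_wpM2l.
have := normal_stein dh ch' (normal_pow_growth k.+1) gh'.
rewrite RintegralZl//; last exact: normal_pow_integrable.
rewrite mulrA => h; apply: (mulfI s_neq0).
rewrite -[LHS]RintegralZl//; last exact: normal_pow_integrable.
transitivity (\int[N]_x ((x - m) * ((x - m) / s) ^+ k.+1)).
  by apply: eq_Rintegral => x _; rewrite [in LHS]exprS; field.
by rewrite h /normal_moment; field.
Qed.

Lemma normal_moment2 : normal_moment 2 = 1.
Proof. by rewrite normal_momentSS normal_moment0 mulr1. Qed.

Lemma normal_moment3 : normal_moment 3 = 0.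
Proof. by rewrite normal_momentSS normal_moment1 mulr0. Qed.

Lemma normal_moment4 : normal_moment 4 = 3.
Proof. by rewrite normal_momentSS normal_moment2 mulr1. Qed.

Lemma normal_moment6 : normal_moment 6 = 15.
Proof. by rewrite normal_momentSS normal_moment4 -natrM. Qed.

End Normal.

(** * Elementary Taylor bounds for sine, cosine and exponential *)

Section TrigonometricBounds.
Context {R : realType}.

Lemma sin_le_norm (x : R) : `|sin x| <= `|x|.
Proof.
wlog x0 : x / 0 <= x.
  by move=> h; have [/h //|/ltW x0] := leP 0 x; rewrite -normrN -sinN -(normrN x) h// oppr_ge0.
have [|c _] := @MVT_segment R sin cos 0 x x0 (fun y _ => is_derive_sin y).
  by apply: continuous_subspaceT; exact: continuous_sin.
rewrite sin0 !subr0 => ->; rewrite normrM ler_piMl//; exact: cos_max.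
Qed.

Lemma one_sub_cosE (x : R) : 1 - cos x = 2 * sin (x / 2) ^+ 2.
Proof.
have -> : cos x = cos ((x / 2) + (x / 2)) by congr cos; field.
rewrite cosD -!expr2; have := cos2Dsin2 (x / 2) => h.
have -> : cos (x / 2) ^+ 2 = 1 - sin (x / 2) ^+ 2 by apply/(canRL (addrK _)).
ring.
Qed.

(** By oddness take [x >= 0]; in the mean value theorem the derivative [cos c - 1] is
    [- 2 sin(c / 2)^2], at most [x^2 / 2] in absolute value. *)
Lemma sin_sub_le (x : R) : `|sin x - x| <= `|x| ^+ 3 / 2.
Proof.
wlog x0 : x / 0 <= x.
  move=> h; have [/h //|/ltW x0] := leP 0 x.
  by have := h (- x); rewrite oppr_ge0 sinN -opprD !normrN; apply.
have d (y : R) : is_derive y 1 (fun x : R => sin x - x) (cos y - 1) by exact: is_deriveB.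
have cf : {within `[0, x], continuous (fun x : R => sin x - x)}.
  by apply: continuous_subspaceT => y; apply: cvgB; [exact: continuous_sin|exact: cvg_id].
have [c] := MVT_segment x0 (fun y _ => d y) cf.
rewrite in_itv/= sin0 !subr0 => /andP[c0 cx] ->.
rewrite normrM exprSr mulrAC ler_wpM2r// distrC one_sub_cosE normrM normrX ger0_norm//.
have : `|sin (c / 2)| ^+ 2 <= `|c / 2| ^+ 2 by rewrite lerXn2r ?nnegrE// sin_le_norm.
rewrite normrM (ger0_norm c0) (ger0_norm x0) (ger0_norm (_ : 0 <= 2^-1))// ?invr_ge0//.
have : c ^+ 2 <= x ^+ 2 by rewrite lerXn2r ?nnegrE.
rewrite exprMn; lra.
Qed.

(** For [|x| <= 2] the cubic bound is already below the square; beyond, [2 |x| <= x^2]. *)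
Lemma sin_sub_le_sqr (x : R) : `|sin x - x| <= `|x| ^+ 2.
Proof.
have [x2|x2] := leP `|x| 2.
  apply: (le_trans (sin_sub_le x)); rewrite exprSr -mulrA ler_piMr ?exprn_ge0//.
  lra.
apply: (le_trans (ler_normB _ _)).
have := sin_le_norm x; nra.
Qed.

(** Since [1 - cos x = 2 sin(x / 2)^2], the difference is [- 2 (sin(x / 2)^2 - (x / 2)^2)], which
    factors. *)
Lemma cos_sub_le (x : R) : `|cos x - (1 - x ^+ 2 / 2)| <= `|x| ^+ 3 / 2.
Proof.
have -> : cos x - (1 - x ^+ 2 / 2) = - 2 * (sin (x / 2) - x / 2) * (sin (x / 2) + x / 2).
  have := one_sub_cosE x => h.
  have -> : cos x = 1 - 2 * sin (x / 2) ^+ 2 by rewrite -[in RHS]h; ring.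
  by field.
rewrite !normrM normrN (ger0_norm (_ : (0 : R) <= 2))//.
have h1 := sin_sub_le_sqr (x / 2).
have h2 : `|sin (x / 2) + x / 2| <= `|x|.
  rewrite (le_trans (ler_normD _ _))// (le_trans (lerD (sin_le_norm _) (lexx _)))//.
  by rewrite normrM normfV normr_nat -splitr.
apply: (@le_trans _ _ (2 * `|x / 2| ^+ 2 * `|x|)).
  by apply: ler_pM => //; rewrite ler_wpM2l.
rewrite normrM normfV normr_nat le_eqVlt; apply/orP; left.
by apply/eqP; field.
Qed.

(** From [1 - y <= e^-y <= 1 / (1 + y) <= 1 - y + y^2]. *)
Lemma expRN_sub_le (y : R) : 0 <= y -> `|expR (- y) - (1 - y)| <= y ^+ 2.
Proof.
move=> y0; rewrite ger0_norm; last by rewrite subr_ge0 expR_ge1Dx.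
rewrite lerBlDr expRN invf_ple ?posrE ?expR_gt0//; last by nra.
apply: le_trans (expR_ge1Dx y); rewrite invf_ple ?posrE; [|nra|lra].
rewrite -[leLHS]div1r ler_pdivrMr; nra.
Qed.

End TrigonometricBounds.

(** * Quadratic functions of a normal variable *)

Section NormalQuadratic.
Context {R : realType}.
Variables (m s : R).
Hypothesis s0 : 0 < s.
Local Notation N := (normal_prob m s).

Lemma normal_poly n (c : nat -> R) :
  N.-integrable [set: R] (EFin \o (fun x => \sum_(k < n) c k * ((x - m) / s) ^+ k)) /\
  \int[N]_x (\sum_(k < n) c k * ((x - m) / s) ^+ k) = \sum_(k < n) c k * normal_moment m s k.
Proof.
elim: n => [|n [IH1 IH2]].
  under eq_fun do rewrite big_ord0; rewrite big_ord0.

  split; first exact: (finite_measure_integrable_cst _ 0).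
  by rewrite Rintegral_cst// mul0r.
have i1 : N.-integrable [set: R] (EFin \o (fun x => c n * ((x - m) / s) ^+ n)).
  have := integrableZl measurableT (c n) (normal_pow_integrable m s0 n).
  by apply: eq_integrable => // x _ /=; rewrite EFinM.
under eq_fun do rewrite big_ord_recr/=; rewrite big_ord_recr/=.

split.
  have := integrableD measurableT IH1 i1.
  by apply: eq_integrable => // x _ /=; rewrite EFinD.
rewrite RintegralD// IH2; congr (_ + _).
by rewrite RintegralZl//; exact: normal_pow_integrable.
Qed.

Variables (a b : R).

(** A combination of the first two Hermite polynomials of the standardized variable; they are
    centred and orthogonal, with squared norms 1 and 2, whence the variance [a^2 + 2 b^2]. *)
Definition quad_form (x : R) : R := a * ((x - m) / s) + b * (((x - m) / s) ^+ 2 - 1).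

Lemma continuous_quad_form : continuous quad_form.
Proof.
have -> : quad_form = fun x => a * ((x - m) / s) ^+ 1 + b * (((x - m) / s) ^+ 2 - 1).
  by apply/funext => x; rewrite expr1.
move=> x; apply: cvgD; first by apply: cvgMl_tmp; exact: normal_pow_continuous.
by apply: cvgMl_tmp; apply: cvgB; [exact: normal_pow_continuous|exact: cvg_cst].
Qed.

Lemma measurable_quad_form : measurable_fun [set: R] quad_form.
Proof. by apply: continuous_measurable_fun; exact: continuous_quad_form. Qed.

Lemma quad_form_integrable : N.-integrable [set: R] (EFin \o quad_form).
Proof.
have [h _] := normal_poly 3 (nth 0 [:: - b; a; b]).
by apply: eq_integrable h => // x _ /=; rewrite !big_ord_recr big_ord0/= /quad_form; congr EFin; ring.
Qed.

Lemma quad_form_mean : \int[N]_x quad_form x = 0.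
Proof.
have [_ h] := normal_poly 3 (nth 0 [:: - b; a; b]).
transitivity (\int[N]_x (\sum_(k < 3) [:: - b; a; b]`_k * ((x - m) / s) ^+ k)).
  by apply: eq_Rintegral => x _; rewrite !big_ord_recr big_ord0/= /quad_form; ring.
rewrite h !big_ord_recr big_ord0/= normal_moment0 (normal_moment1 _ s0) (normal_moment2 _ s0).
ring.
Qed.

Lemma quad_form_sqr_integrable : N.-integrable [set: R] (EFin \o (fun x => quad_form x ^+ 2)).
Proof.
have [h _] := normal_poly 5 (nth 0 [:: b ^+ 2; - 2 * a * b; a ^+ 2 - 2 * b ^+ 2; 2 * a * b; b ^+ 2]).
by apply: eq_integrable h => // x _ /=; rewrite !big_ord_recr big_ord0/= /quad_form; congr EFin; ring.
Qed.

Lemma quad_form_variance : \int[N]_x quad_form x ^+ 2 = a ^+ 2 + 2 * b ^+ 2.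
Proof.
pose c := [:: b ^+ 2; - 2 * a * b; a ^+ 2 - 2 * b ^+ 2; 2 * a * b; b ^+ 2].
have [_ h] := normal_poly 5 (nth 0 c).
transitivity (\int[N]_x (\sum_(k < 5) c`_k * ((x - m) / s) ^+ k)).
  by apply: eq_Rintegral => x _; rewrite !big_ord_recr big_ord0/= /quad_form; ring.
rewrite h !big_ord_recr big_ord0/= normal_moment0 (normal_moment1 _ s0) (normal_moment2 _ s0)
  (normal_moment3 _ s0) (normal_moment4 _ s0).
ring.
Qed.

(** Envelope for [|quad_form|^3] up to the factor [(|a| + |b|)^3]. From the moments 1, 3, 15 of
    orders 2, 4, 6 its mean is 1 + 3 + 9 + 15 = 28; the factor 1/2 of the Taylor bounds makes the 14
    below. *)
Let env x : R := (1 + ((x - m) / s) ^+ 2) ^+ 3.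

Let envP : N.-integrable [set: R] (EFin \o env) /\ \int[N]_x env x = 28.
Proof.
pose c : seq R := [:: 1; 0; 3; 0; 3; 0; 1].
have envE x : env x = \sum_(k < 7) c`_k * ((x - m) / s) ^+ k.
  by rewrite !big_ord_recr big_ord0/= /env; ring.
have [h1 h2] := normal_poly 7 (nth 0 c); split.
  by apply: eq_integrable h1 => // x _ /=; rewrite envE.
transitivity (\int[N]_x (\sum_(k < 7) c`_k * ((x - m) / s) ^+ k)).
  by apply: eq_Rintegral => x _.
rewrite h2 !big_ord_recr big_ord0/= normal_moment0 (normal_moment1 _ s0) (normal_moment2 _ s0)
  (normal_moment4 _ s0) (normal_moment6 _ s0).
ring.
Qed.

Let r : R := `|a| + `|b|.

Let quad_form_cube x : `|quad_form x| ^+ 3 / 2 <= r ^+ 3 / 2 * env x.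
Proof.
rewrite [leRHS]mulrAC ler_wpM2r ?invr_ge0// /env -exprMn lerXn2r ?nnegrE//.
  by rewrite mulr_ge0 ?addr_ge0// sqr_ge0.
rewrite /quad_form /r; set y := (x - m) / s.
rewrite (le_trans (ler_normD _ _))// (normrM a) (normrM b) [leRHS]mulrDl.
apply: lerD; rewrite ler_wpM2l//.
  by rewrite -(real_normK (num_real y)); have := normr_ge0 y; nra.
by rewrite (le_trans (ler_normB _ _))// normr1 addrC ger0_norm// sqr_ge0.
Qed.

Let approx (f g : R -> R) : measurable_fun [set: R] f -> (forall x, `|f x| <= 1) ->
  N.-integrable [set: R] (EFin \o g) ->
  (forall x, `|f x - g x| <= `|quad_form x| ^+ 3 / 2) ->
  `|\int[N]_x f x - \int[N]_x g x| <= 14 * r ^+ 3.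
Proof.
move=> mf f1 ig fg; have [ie e28] := envP.
have jf : N.-integrable [set: R] (EFin \o f) by exact: (@integrable_bounded _ _ _ N f 1).
have ifg : N.-integrable [set: R] (EFin \o (fun x => f x - g x)).
  by have := integrableB measurableT jf ig; apply: eq_integrable.
rewrite -RintegralB//; apply: (le_trans (le_normr_Rintegral _ _)) => //.
have ir : N.-integrable [set: R] (EFin \o (fun x => r ^+ 3 / 2 * env x)).
  have := integrableZl measurableT (r ^+ 3 / 2) ie.
  by apply: eq_integrable => // x _ /=; rewrite EFinM.
apply: (@le_trans _ _ (\int[N]_x (r ^+ 3 / 2 * env x))).
  apply: le_Rintegral => //.
    have := integrable_abse ifg; apply: eq_integrable => //.
  by move=> x _; exact: le_trans (fg x) (quad_form_cube x).
by rewrite RintegralZl// e28 le_eqVlt; apply/orP; left; apply/eqP; field.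
Qed.

(** The second-order expansion of the cosine has mean [1 - v / 2], with [v] the variance; replacing
    it by the exponential costs [(v / 2)^2 <= r^4]. *)
Lemma quad_form_cos :
  `|\int[N]_x cos (quad_form x) - expR (- ((a ^+ 2 + 2 * b ^+ 2) / 2))|
    <= 14 * r ^+ 3 + r ^+ 4.
Proof.
set v := a ^+ 2 + 2 * b ^+ 2.
have v0 : 0 <= v by rewrite addr_ge0 ?sqr_ge0// mulr_ge0 ?sqr_ge0.
have i1 : N.-integrable [set: R] (EFin \o (fun x => 1 - quad_form x ^+ 2 / 2)).
  have [h _] := normal_poly 1 (fun=> 1).
  have h2 := integrableZl measurableT (2^-1) quad_form_sqr_integrable.
  have := integrableB measurableT h h2; apply: eq_integrable => // x _ /=.
  by rewrite big_ord_recr big_ord0/= -EFinD; congr EFin; ring.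
have e1 : \int[N]_x (1 - quad_form x ^+ 2 / 2) = 1 - v / 2.
  have h2 := integrableZl measurableT (2^-1) quad_form_sqr_integrable.
  rewrite RintegralB//; last 2 first.
  - exact: (finite_measure_integrable_cst _ 1).
  - by apply: eq_integrable h2 => // x _ /=; rewrite -EFinM mulrC.
  rewrite Rintegral_cst//= probability_setT mulr1; congr (_ - _).
  rewrite /v -quad_form_variance [RHS]mulrC -RintegralZl//; last exact: quad_form_sqr_integrable.
  by apply: eq_Rintegral => x _; rewrite mulrC.
have h := approx (measurableT_comp measurable_cos measurable_quad_form)
  (fun x => cos_max _) i1 (fun x => cos_sub_le _).
have h2 : `|expR (- (v / 2)) - (1 - v / 2)| <= r ^+ 4.
  apply: (le_trans (expRN_sub_le _)); first by rewrite divr_ge0.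
  have -> : r ^+ 4 = (r ^+ 2) ^+ 2 by rewrite -exprM.
  rewrite lerXn2r ?nnegrE ?divr_ge0 ?sqr_ge0// /v /r.
  rewrite -(real_normK (num_real a)) -(real_normK (num_real b)).
  by have := normr_ge0 a; have := normr_ge0 b; nra.
rewrite e1 in h.
have -> : \int[N]_x cos (quad_form x) - expR (- (v / 2)) =
  (\int[N]_x cos (quad_form x) - (1 - v / 2)) - (expR (- (v / 2)) - (1 - v / 2)) by ring.
by rewrite (le_trans (ler_normB _ _))// lerD.
Qed.

(** The mean of the linear term is zero. The summand [r ^+ 4] only aligns the bound with the one for
    the cosine, as [tprod_cos] takes one error for both. *)
Lemma quad_form_sin : `|\int[N]_x sin (quad_form x)| <= 14 * r ^+ 3 + r ^+ 4.
Proof.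
have := approx (measurableT_comp measurable_sin measurable_quad_form)
  (fun x => sin_max _) quad_form_integrable (fun x => sin_sub_le _).
by rewrite quad_form_mean subr0 => /le_trans; apply; rewrite lerDl exprn_ge0// addr_ge0.
Qed.

End NormalQuadratic.

Section ProbabilityIntegrals.
Context d (T : measurableType d) {R : realType}.

Lemma EFin_Rintegral (mu : {measure set T -> \bar R}) (f : T -> R) :
  mu.-integrable [set: T] (EFin \o f) ->
  (\int[mu]_x (f x)%:E = (\int[mu]_x f x)%:E)%E.
Proof. by move=> h; rewrite /Rintegral fineK//; exact: integrable_fin_num. Qed.

Lemma Rintegral_prob_cst (P : probability T R) (c : R) : \int[P]_x c = c.
Proof. by rewrite Rintegral_cst//= probability_setT mulr1. Qed.

End ProbabilityIntegrals.

(** * Products of probabilities on the line *)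

Section ProductProbability.
Context {R : realType}.
Local Notation RR := (measurableTypeR R).

(** The type annotation lets the product measure be used where a probability is expected. *)
Definition prod_prob d1 d2 (T1 : measurableType d1) (T2 : measurableType d2)
  (P1 : probability T1 R) (P2 : probability T2 R) : probability (T1 * T2)%type R :=
  (P1 \x P2)%E.

Fixpoint tprod (mu : nat -> probability RR R) n : probability (n.-tuple R) R :=
  match n with
  | 0 => \d_([tuple] : 0.-tuple R)
  | n'.+1 => distribution (mu 0%N \x tprod (mu \o S) n')%E (@cons_pair R n')
  end.

Lemma std_normal_tprod d : std_normal d = tprod (fun=> normal_prob (0 : R) 1) d.
Proof. by elim: d => //= d ->. Qed.

Definition rect n (U : nat -> set R) : set (n.-tuple R) :=
  [set v | forall i : 'I_n, U i (tnth v i)].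

Lemma measurable_rect n (U : nat -> set R) : (forall i, measurable (U i)) ->
  measurable (rect (n := n) U).
Proof.
move=> mU; rewrite (_ : rect _ = \bigcap_(i in [set: 'I_n]) ((@tnth n R)^~ i @^-1` U i)).
  apply: fin_bigcap_measurable => // i _; rewrite -[X in measurable X]setTI.
  exact: measurable_tnth.
by apply/seteqP; split => [v h i _|v h i]; exact: h.
Qed.

Lemma cons_pair_rect n (U : nat -> set R) :
  @cons_pair R n @^-1` rect U = U 0%N `*` rect (U \o S).
Proof.
apply/seteqP; split => [[x v] /= h|[x v] /= [h1 h2]].
  split; first by have := h ord0; rewrite tnth0.
  by move=> i; have := h (lift ord0 i); rewrite tnthS.
move=> i; case: (unliftP ord0 i) => [j ->|->]; last by rewrite tnth0.
by rewrite tnthS; exact: h2.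
Qed.

Lemma tprod_rect (mu : nat -> probability RR R) n (U : nat -> set R) : (forall i, measurable (U i)) ->
  (tprod mu n (rect U) = \prod_(i < n) mu i (U i))%E.
Proof.
elim: n mu U => [|n IH] mu U mU.
  rewrite big_ord0 /= diracE mem_set//.
  by move=> [].
have mU' i : measurable ((U \o S) i) by exact: mU.
rewrite /= /distribution /pushforward cons_pair_rect product_measure1E; last 2 first.
- exact: mU.
- exact: measurable_rect.
rewrite big_ord_recl; congr (_ * _)%E; exact: (IH (mu \o S) (U \o S) mU').
Qed.

(** A pi-system that generates the Borel sets of tuples and contains the whole space. Open rays are
    chosen because their indicators are limits of continuous ramps, which [chf_unique] exploits. *)
Definition ray_rects n : set (set (n.-tuple R)) :=
  [set A | exists2 U : nat -> set R,
     (forall i, U i = setT \/ exists x, U i = `]x, +oo[%classic) & A = rect U].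

Lemma ray_rects_measurable n : @ray_rects n `<=` measurable.
Proof.
move=> _ [U hU ->]; apply: measurable_rect => i.
by case: (hU i) => [->|[x ->]].
Qed.

Lemma ray_rects_generate n : measurable `<=` <<s @ray_rects n >>.
Proof.
apply: smallest_sub; first exact: smallest_sigma_algebra.
apply: (big_ind (fun F => F `<=` <<s @ray_rects n >>)) => //.
  by move=> F G FG GG; rewrite subUset.
move=> i _ _ [A mA <-].
have : measurable_fun [set: g_sigma_algebraType (@ray_rects n)] ((@tnth n R)^~ i).
  apply: (measurability _ (RGenOInfty.measurableE R)) => _ [_ [a ->] <-].
  apply: sub_sigma_algebra; exists (fun j => if j == i :> nat then `]a, +oo[%classic else setT).
    by move=> j; case: ifP => _; [right; exists a|left].
  apply/seteqP; split => [v [_ h] j|v h]; last by split => //; have := h i; rewrite eqxx.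
  by case: ifPn => // /eqP/val_inj ->.
by move=> /(_ measurableT A mA).
Qed.

Lemma ray_rects_unique n (m1 m2 : {finite_measure set (n.-tuple R) -> \bar R}) :
  (forall A, @ray_rects n A -> m1 A = m2 A) -> forall A, measurable A -> m1 A = m2 A.
Proof.
move=> h A mA.
apply: (@g_sigma_algebra_measure_unique _ _ _ (@ray_rects n) _ (fun=> setT)) => //.
- exact: ray_rects_measurable.
- move=> _; exists (fun=> setT); first by left.
  by apply/seteqP.
- by rewrite bigcup_const//; exists 0%N.
- move=> _ _ [U hU ->] [V hV ->]; exists (fun i => U i `&` V i); last first.
    apply/seteqP; split => [v [h1 h2] i|v h1]; first by split; [exact: h1|exact: h2].
    by split => i; have [] := h1 i.
  move=> i; case: (hU i) => [->|[x ->]]; first by rewrite setTI; exact: hV.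
  right; case: (hV i) => [->|[y ->]]; first by exists x; rewrite setIT.
  exists (Num.max x y); apply/seteqP; split => z /=; rewrite !in_itv/= !andbT gt_max.
    by move=> [-> ->].
  by move=> /andP[].
- by move=> k; exact: fin_num_fun_lty.
- exact: ray_rects_generate.
Qed.

Lemma tprod_unique (mu : nat -> probability RR R) n (m : {finite_measure set (n.-tuple R) -> \bar R}) :
  (forall U, (forall i, measurable (U i)) -> (m (rect U) = \prod_(i < n) mu i (U i))%E) ->
  forall A, measurable A -> m A = tprod mu n A.
Proof.
move=> h; apply: ray_rects_unique => _ [U hU ->].
have mU i : measurable (U i) by case: (hU i) => [->|[x ->]].
by rewrite h//; apply/esym; exact: tprod_rect.
Qed.

Lemma measurable_tuple_cons n (f : n.+1.-tuple R -> R) :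
  measurable_fun [set: n.+1.-tuple R] f ->
  measurable_fun [set: RR * n.-tuple R] (f \o @cons_pair R n).
Proof. by move=> mf; apply: measurableT_comp => //; exact: measurable_cons_pair. Qed.

Lemma ge0_integral_tprodS (mu : nat -> probability RR R) n (f : n.+1.-tuple R -> R) :
  measurable_fun [set: n.+1.-tuple R] f -> (forall y, 0 <= f y) ->
  (\int[tprod mu n.+1]_y (f y)%:E =
   \int[mu 0%N]_x \int[tprod (mu \o S) n]_y (f (cons_pair (x, y)))%:E)%E.
Proof.
move=> mf f0; rewrite ge0_integral_distribution//; last exact/measurable_EFinP.
rewrite fubini_tonelli1//.
  by apply/measurable_EFinP; exact: measurable_tuple_cons.
by move=> x; rewrite lee_fin.
Qed.

Lemma integral_tprodS (mu : nat -> probability RR R) n (f : n.+1.-tuple R -> R) (M : R) :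
  measurable_fun [set: n.+1.-tuple R] f -> (forall y, `|f y| <= M) ->
  \int[tprod mu n.+1]_y f y =
   \int[mu 0%N]_x \int[tprod (mu \o S) n]_y f (cons_pair (x, y)).
Proof.
move=> mf fM; rewrite {1}/Rintegral; congr fine.
have mc := measurable_tuple_cons mf.
have ic : (mu 0%N \x tprod (mu \o S) n)%E.-integrable [set: RR * n.-tuple R]
    (EFin \o (f \o @cons_pair R n)).
  exact: (@integrable_bounded _ _ _ (prod_prob (mu 0%N) (tprod (mu \o S) n)) _ M mc (fun x => fM _)).
rewrite integral_distribution//; last exact/measurable_EFinP.
rewrite -integral12_prod_meas1//; apply: eq_integral => x _.
rewrite /fubini_F /Rintegral fineK//.
apply: integrable_fin_num => //.
apply: (@integrable_bounded _ _ _ (tprod (mu \o S) n) _ M) => //.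
by apply: measurableT_comp mc _; exact: measurable_pair1.
Qed.

Definition coord_sum n (Z : nat -> R -> R) (y : n.-tuple R) : R :=
  \sum_(i < n) Z i (tnth y i).

Lemma measurable_coord_sum n (Z : nat -> R -> R) : (forall i, measurable_fun [set: R] (Z i)) ->
  measurable_fun [set: n.-tuple R] (coord_sum (n := n) Z).
Proof.
move=> mZ; apply: measurable_sum => i.
by apply: (measurableT_comp (mZ i)); exact: measurable_tnth.
Qed.

Lemma coord_sum_cons n (Z : nat -> R -> R) x (y : n.-tuple R) :
  coord_sum Z (cons_pair (x, y)) = Z 0%N x + coord_sum (Z \o S) y.
Proof.
by rewrite /coord_sum big_ord_recl tnth0; congr (_ + _); apply: eq_bigr => i _; rewrite tnthS.
Qed.

(** The constant [c] carries the induction: once the other coordinates are integrated out, it has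
    become [c + Z 0 x]. The cross terms vanish because the summands are centred. *)
Lemma tprod_sqr (mu : nat -> probability RR R) n (Z : nat -> R -> R) (v : nat -> R) (c : R) :
  (forall i, measurable_fun [set: R] (Z i)) ->
  (forall i, (mu i).-integrable [set: RR] (EFin \o Z i)) ->
  (forall i, (mu i).-integrable [set: RR] (EFin \o (fun x => Z i x ^+ 2))) ->
  (forall i, \int[mu i]_x Z i x = 0) -> (forall i, \int[mu i]_x (Z i x ^+ 2) = v i) ->
  (\int[tprod mu n]_y ((c + coord_sum Z y) ^+ 2)%:E = (c ^+ 2 + \sum_(i < n) v i)%:E)%E.
Proof.
elim: n mu Z v c => [|n IH] mu Z v c mZ iZ iZ2 Z0 Zv.
  under eq_integral do rewrite /coord_sum big_ord0 addr0; rewrite big_ord0 addr0.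
  by rewrite integral_cst//= diracE mem_set// mule1.
rewrite ge0_integral_tprodS; last 2 first.
- apply: measurable_funX; apply: measurable_funD => //; exact: measurable_coord_sum.
- by move=> y; exact: sqr_ge0.
under eq_integral => x _.
  under eq_integral do rewrite coord_sum_cons addrA.
  rewrite (IH (mu \o S) (Z \o S) (v \o S) (c + Z 0%N x)
    (fun i => mZ _) (fun i => iZ _) (fun i => iZ2 _) (fun i => Z0 _) (fun i => Zv _)).
  over.
rewrite big_ord_recl /=.
set V := \sum_(i < n) _.
have i1 := integrableZl measurableT (2 * c) (iZ 0%N).
have i2 : (mu 0%N).-integrable [set: RR] (EFin \o cst (c ^+ 2 + V)).
  exact: finite_measure_integrable_cst.
transitivity (\int[mu 0%N]_x ((Z 0%N x ^+ 2)%:E + ((2 * c)%:E * (Z 0%N x)%:E + (c ^+ 2 + V)%:E)))%E.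
  by apply: eq_integral => x _; rewrite -EFinM -!EFinD; congr EFin; ring.
rewrite integralD//; [|exact: iZ2|exact: integrableD].
rewrite integralD// integralZl//; last exact: iZ.
have e1 : (\int[mu 0%N]_x (Z 0%N x)%:E = 0)%E.
  by rewrite EFin_Rintegral ?Z0//; exact: iZ.
have e2 : (\int[mu 0%N]_x (Z 0%N x ^+ 2)%:E = (v 0%N)%:E)%E.
  by rewrite (@EFin_Rintegral _ RR _ _ (fun x => Z 0%N x ^+ 2)) ?Zv//; exact: iZ2.
rewrite e1 e2 mule0 add0e integral_cst//= probability_setT mule1 -EFinD.
by congr EFin; ring.
Qed.

(* The coordinates are replaced one at a time: conditionally on the others,
   [E cos (c + Z)] is [cos c E cos Z - sin c E sin Z]. *)
Lemma tprod_cos (mu : nat -> probability RR R) n (Z : nat -> R -> R) (v e : nat -> R) (c : R) :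
  (forall i, measurable_fun [set: R] (Z i)) -> (forall i, 0 <= v i) ->
  (forall i, `|\int[mu i]_x cos (Z i x) - expR (- (v i / 2))| <= e i) ->
  (forall i, `|\int[mu i]_x sin (Z i x)| <= e i) ->
  `|\int[tprod mu n]_y cos (c + coord_sum Z y)
    - cos c * expR (- ((\sum_(i < n) v i) / 2))| <= 2 * \sum_(i < n) e i.
Proof.
elim: n mu Z v e c => [|n IH] mu Z v e c mZ v0 Zc Zs.
  rewrite !big_ord0 mul0r oppr0 expR0 mulr1 mulr0.
  under eq_Rintegral do rewrite /coord_sum big_ord0 addr0.
  by rewrite Rintegral_prob_cst subrr normr0.
have mcs k (W : nat -> R -> R) d : (forall i, measurable_fun [set: R] (W i)) ->
    measurable_fun [set: k.-tuple R] (fun y => cos (d + coord_sum W y)).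
  move=> mW; apply: (measurableT_comp measurable_cos).
  by apply: measurable_funD => //; exact: measurable_coord_sum.
rewrite (@integral_tprodS _ _ _ 1)//; [|exact: mcs|by move=> y; exact: cos_max].
rewrite !big_ord_recl /=.
set V := \sum_(i < n) v _; set E := \sum_(i < n) e _.
have V0 : 0 <= V by apply: sumr_ge0.
have eV1 : `|expR (- (V / 2))| <= 1.
  by rewrite ger0_norm ?expR_ge0// expR_le1 oppr_le0 divr_ge0.
pose h x := \int[tprod (mu \o S) n]_y cos (c + coord_sum Z (cons_pair (x, y))).
pose g x := cos (c + Z 0%N x) * expR (- (V / 2)).
have hg x : `|h x - g x| <= 2 * E.
  have := IH (mu \o S) (Z \o S) (v \o S) (e \o S) (c + Z 0%N x)
    (fun i => mZ _) (fun i => v0 _) (fun i => Zc _) (fun i => Zs _).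
  rewrite (_ : \int[_]_y _ = h x)//; apply: eq_Rintegral => y _.
  by rewrite coord_sum_cons addrA.
have icos (f : R -> R) : measurable_fun [set: R] f ->
    (mu 0%N).-integrable [set: RR] (EFin \o (fun x => cos (f x))).
  move=> mf; apply: (@integrable_bounded _ RR _ (mu 0%N) _ 1); last by move=> x; exact: cos_max.
  exact: (measurableT_comp measurable_cos).
have isin (f : R -> R) : measurable_fun [set: R] f ->
    (mu 0%N).-integrable [set: RR] (EFin \o (fun x => sin (f x))).
  move=> mf; apply: (@integrable_bounded _ RR _ (mu 0%N) _ 1); last by move=> x; exact: sin_max.
  exact: (measurableT_comp measurable_sin).
have ig : (mu 0%N).-integrable [set: RR] (EFin \o g).
  have := integrableZl measurableT (expR (- (V / 2))) (icos _ (measurable_funD (measurable_cst c) (mZ 0%N))).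
  by apply: eq_integrable => // x _ /=; rewrite /g -EFinM mulrC.
have ih : (mu 0%N).-integrable [set: RR] (EFin \o h).
  apply: (@integrable_bounded _ RR _ (mu 0%N) _ 1); last first.
    move=> x; apply: (le_trans (le_normr_Rintegral _ _)) => //.
      apply: (@integrable_bounded _ _ _ (tprod (mu \o S) n) _ 1); last by move=> y; exact: cos_max.
      apply: (measurableT_comp (measurable_tuple_cons (mcs _ _ _ mZ))).
      exact: measurable_pair1.
    rewrite -[leRHS](_ : \int[tprod (mu \o S) n]_y 1 = 1); last first.
      by rewrite Rintegral_cst//= probability_setT mulr1.
    apply: le_Rintegral => //.
    - apply: (@integrable_bounded _ _ _ (tprod (mu \o S) n) _ 1).
        apply: measurableT_comp => //.
        apply: (measurableT_comp (measurable_tuple_cons (mcs _ _ _ mZ))).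
        exact: measurable_pair1.
      by move=> y; rewrite normr_id cos_max.
    - exact: finite_measure_integrable_cst.
    - by move=> y _; exact: cos_max.
  (* The inner integral [h] is measurable as a Fubini section integral. *)
  have ic : (mu 0%N \x tprod (mu \o S) n)%E.-integrable [set: RR * n.-tuple R]
      (EFin \o ((fun y => cos (c + coord_sum Z y)) \o @cons_pair R n)).
    apply: (@integrable_bounded _ _ _ (prod_prob (mu 0%N) (tprod (mu \o S) n)) _ 1); last first.
      by move=> y; exact: cos_max.
    exact: (measurable_tuple_cons (mcs _ _ _ mZ)).
  apply/measurable_EFinP.
  have /measurable_int mF := integrable_fubini_F ic.
  apply: (eq_measurable_fun _ _ mF) => x _.
  rewrite /fubini_F /h /Rintegral /= fineK//; apply: integrable_fin_num => //.
  apply: (@integrable_bounded _ _ _ (tprod (mu \o S) n) _ 1); last by move=> y; exact: cos_max.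
  apply: (measurableT_comp (measurable_tuple_cons (mcs _ _ _ mZ))).
  exact: measurable_pair1.
have gE : \int[mu 0%N]_x g x =
    (cos c * \int[mu 0%N]_x cos (Z 0%N x) - sin c * \int[mu 0%N]_x sin (Z 0%N x))
    * expR (- (V / 2)).
  have j1 := icos _ (mZ 0%N); have j2 := isin _ (mZ 0%N).
  rewrite -!RintegralZl// -RintegralB//; last 2 first.
  - exact: (integrableZl measurableT (cos c) j1).
  - exact: (integrableZl measurableT (sin c) j2).
  rewrite -RintegralZr//; last first.
    exact: (integrableB measurableT (integrableZl measurableT (cos c) j1)
              (integrableZl measurableT (sin c) j2)).
  by apply: eq_Rintegral => x _; rewrite /g cosD.
have D1 : `|\int[mu 0%N]_x h x - \int[mu 0%N]_x g x| <= 2 * E.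
  have ihg : (mu 0%N).-integrable [set: RR] (EFin \o (fun x => h x - g x)).
    exact: (integrableB measurableT ih ig).
  rewrite -RintegralB//; apply: (le_trans (le_normr_Rintegral _ _)) => //.
  rewrite -[leRHS](_ : \int[mu 0%N]_y (2 * E) = 2 * E); last first.
    by rewrite Rintegral_cst//= probability_setT mulr1.
  apply: le_Rintegral => //.
  - exact: (integrable_abse ihg).
  - exact: finite_measure_integrable_cst.
have D2 : `|\int[mu 0%N]_x g x - cos c * expR (- (v 0%N / 2)) * expR (- (V / 2))| <= 2 * e 0%N.
  rewrite gE -mulrBl normrM.
  apply: (@le_trans _ _ ((2 * e 0%N) * 1)); last by rewrite mulr1.
  apply: ler_pM => //.
  have -> : cos c * \int[mu 0%N]_x cos (Z 0%N x) - sin c * \int[mu 0%N]_x sin (Z 0%N x)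
     - cos c * expR (- (v 0%N / 2)) =
     cos c * (\int[mu 0%N]_x cos (Z 0%N x) - expR (- (v 0%N / 2)))
     - sin c * \int[mu 0%N]_x sin (Z 0%N x) by ring.
  rewrite (le_trans (ler_normB _ _))// mulr_natl mulr2n !normrM; apply: lerD.
    by rewrite (le_trans _ (Zc 0%N))// ler_piMl// cos_max.
  by rewrite (le_trans _ (Zs 0%N))// ler_piMl// sin_max.
have -> : - ((v 0%N + V) / 2) = - (v 0%N / 2) - V / 2 by field.
rewrite expRD mulrA mulrDr [leRHS]addrC -(subrKA (\int[mu 0%N]_x g x)).
by rewrite (le_trans (ler_normD _ _))// lerD.
Qed.

End ProductProbability.

(** * Levy's continuity theorem *)

Section Bernstein.
Context {R : realType}.

(* Expectation of [f] under the binomial law with parameters [m] and [y]. *)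
Fixpoint binom_mean m (f : nat -> R) (y : R) : R :=
  if m is m'.+1 then y * binom_mean m' (f \o S) y + (1 - y) * binom_mean m' f y else f 0%N.

Lemma binom_mean_le m (f g : nat -> R) y : 0 <= y <= 1 ->
  (forall k, f k <= g k) -> binom_mean m f y <= binom_mean m g y.
Proof.
move=> /andP[y0 y1]; elim: m f g => [|m IH] f g fg /=; first exact: fg.
by apply: lerD; rewrite ler_wpM2l ?subr_ge0//; apply: IH => k; exact: fg.
Qed.

(** Second moment of the binomial law about an arbitrary point [c]; the point must be free because a
    success shifts it to [c - 1] in the recursion. *)
Lemma binom_mean_sqr m (a b c y : R) :
  binom_mean m (fun k => a + b * (k%:R - c) ^+ 2) y
  = a + b * ((m%:R * y - c) ^+ 2 + m%:R * (y * (1 - y))).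
Proof.
elim: m c => [|m IH] c /=; first by ring.
have -> : binom_mean m ((fun k => a + b * (k%:R - c) ^+ 2) \o S) y =
          binom_mean m (fun k => a + b * (k%:R - (c - 1)) ^+ 2) y.
  congr (binom_mean m _ y); apply/funext => k /=.
  by rewrite -natr1; congr (_ + _ * _ ^+ 2); ring.
by rewrite !IH -natr1; ring.
Qed.

(** The proportion [k / m] has variance [y (1 - y) / m <= 1 / m], so a quadratic modulus around [y]
    averages to [K / m]. *)
Lemma binom_mean_dist m (f : nat -> R) (a e K y : R) : 0 <= K -> 0 <= y <= 1 -> (0 < m)%N ->
  (forall k, `|f k - a| <= e + K * (k%:R / m%:R - y) ^+ 2) ->
  `|binom_mean m f y - a| <= e + K / m%:R.
Proof.
move=> K0 y01 m0 h; have m0' : 0 < m%:R :> R by rewrite ltr0n.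
(* The sign [s] is taken to be -1 and 1, for the lower and the upper bound. *)
have E (s : R) : binom_mean m (fun k => (a + s * e) + s * K * (k%:R / m%:R - y) ^+ 2) y =
   a + s * (e + K * (y * (1 - y)) / m%:R).
  rewrite (_ : (fun k => _) = fun k => (a + s * e) + s * K / m%:R ^+ 2 * (k%:R - m%:R * y) ^+ 2).
    by rewrite binom_mean_sqr; field; rewrite gt_eqF.
  by apply/funext => k; field; rewrite gt_eqF.
have b : K * (y * (1 - y)) / m%:R <= K / m%:R.
  rewrite ler_wpM2r ?invr_ge0 ?ler0n// ler_piMr//.
  by move/andP: y01 => [? ?]; nra.
have {}b : e + K * (y * (1 - y)) / m%:R <= e + K / m%:R by rewrite lerD2l.
rewrite ler_distl; apply/andP; split.
  apply: (@le_trans _ _ (a + (- 1) * (e + K * (y * (1 - y)) / m%:R))).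
    by rewrite mulN1r lerD2l lerN2.
  rewrite -E; apply: binom_mean_le => // k.
  have := h k; rewrite ler_distl => /andP[+ _].
  by apply: le_trans; rewrite le_eqVlt; apply/orP; left; apply/eqP; ring.
apply: (@le_trans _ _ (a + 1 * (e + K * (y * (1 - y)) / m%:R))); last by rewrite mul1r lerD2l.
rewrite -E; apply: binom_mean_le => // k.
by have := h k; rewrite ler_distl => /andP[_]; rewrite !mul1r addrA.
Qed.

(** The mean of [g] at independent binomial proportions. Points are lists, so that the recursion
    removes one variable at a time. *)
Fixpoint bernstein m (g : seq R -> R) (ys : seq R) : R :=
  if ys is y :: ys' then
    binom_mean m (fun k => bernstein m (fun s => g (k%:R / m%:R :: s)) ys') y
  else g [::].

(** Each variable contributes one [K / m]; while it is averaged, the quadratic terms of the others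
    are part of [e]. *)
Lemma bernstein_dist m (g : seq R -> R) (ys : seq R) (a e K : R) : 0 <= K -> (0 < m)%N ->
  all (fun y => 0 <= y <= 1) ys ->
  (forall s, size s = size ys ->
     `|g s - a| <= e + K * \sum_(j < size ys) (s`_j - ys`_j) ^+ 2) ->
  `|bernstein m g ys - a| <= e + K * (size ys)%:R / m%:R.
Proof.
move=> K0 m0; elim: ys g e => [|y ys IH] g e /=.
  by move=> _ /(_ [::] erefl); rewrite big_ord0 !mulr0 mul0r.
move=> /andP[y01 ays] h.
have -> : e + K * (size ys).+1%:R / m%:R = (e + K * (size ys)%:R / m%:R) + K / m%:R.
  by rewrite -natr1; ring.
apply: binom_mean_dist => // k.
rewrite addrAC; apply: IH => // s ss.
have := h (k%:R / m%:R :: s); rewrite /= ss => /(_ erefl).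
by rewrite big_ord_recl /= mulrDr addrA.
Qed.

Lemma bernstein_bounded m (g : seq R -> R) (ys : seq R) (M : R) : (0 < m)%N ->
  all (fun y => 0 <= y <= 1) ys -> (forall s, `|g s| <= M) -> `|bernstein m g ys| <= M.
Proof.
move=> m0 ays gM; rewrite -[bernstein _ _ _]subr0 -[M]addr0.
have -> : 0 = 0 * (size ys)%:R / m%:R :> R by rewrite !mul0r.
by apply: bernstein_dist => // s _; rewrite !mul0r subr0 addr0.
Qed.

End Bernstein.

(** * Approximation by trigonometric polynomials *)

Section TrigonometricPolynomials.
Context {R : realType} {d : nat}.

(** Arbitrary phases include the sines, and the formula for a product of cosines then keeps products
    inside the class. *)
Inductive trig_poly : ('rV[R]_d -> R) -> Prop :=
| trig_poly_cos a c u : trig_poly (fun x => a * cos (c + dotr u x))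
| trig_polyD f g : trig_poly f -> trig_poly g -> trig_poly (fun x => f x + g x).

Lemma trig_poly_cst a : trig_poly (fun=> a).
Proof.
rewrite (_ : (fun=> a) = fun x => a * cos (0 + dotr 0 x)); first exact: trig_poly_cos.
by apply/funext => x; rewrite /dotr mul0mx mxE addr0 cos0 mulr1.
Qed.

Lemma trig_polyM f g : trig_poly f -> trig_poly g -> trig_poly (fun x => f x * g x).
Proof.
elim=> {f} [a c u|f1 f2 _ IH1 _ IH2] tg; last first.
  rewrite (_ : (fun x => _) = (fun x => f1 x * g x + f2 x * g x)); last first.
    by apply/funext => x; rewrite mulrDl.
  by apply: trig_polyD; [exact: IH1|exact: IH2].
elim: tg => {g} [b e v|g1 g2 _ IH1 _ IH2]; last first.
  rewrite (_ : (fun x => _) = (fun x => a * cos (c + dotr u x) * g1 x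
                                      + a * cos (c + dotr u x) * g2 x)); last first.
    by apply/funext => x; rewrite mulrDr.
  exact: trig_polyD.
rewrite (_ : (fun x => _) = (fun x => a * b / 2 * cos ((c + e) + dotr (u + v) x)
     + a * b / 2 * cos ((c - e) + dotr (u - v) x))).
  by apply: trig_polyD; exact: trig_poly_cos.
apply/funext => x; rewrite dotrDl dotrBl.
have -> : c + e + (dotr u x + dotr v x) = (c + dotr u x) + (e + dotr v x) by ring.
have -> : c - e + (dotr u x - dotr v x) = (c + dotr u x) - (e + dotr v x) by ring.
by set p := c + _; set q := e + _; rewrite cosD cosB; field.
Qed.

(** The recursion of [binom_mean] only multiplies by [y] and [1 - y] and adds, so closure under sums
    and products is enough. *)
Lemma trig_poly_binom_mean m (H : nat -> 'rV[R]_d -> R) y : trig_poly y ->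
  (forall k, trig_poly (H k)) -> trig_poly (fun x => binom_mean m (H^~ x) (y x)).
Proof.
move=> ty; elim: m H => [|m IH] H tH /=; first exact: tH.
apply: trig_polyD; apply: trig_polyM => //.
- by apply: (IH (H \o S)) => k; exact: tH.
- apply: trig_polyD; first exact: trig_poly_cst.
  rewrite (_ : (fun x => _) = (fun x => -1 * y x)); last by apply/funext => x; rewrite mulN1r.
  by apply: trig_polyM => //; exact: trig_poly_cst.
- exact: IH.
Qed.

Lemma trig_poly_bernstein m g (Y : seq ('rV[R]_d -> R)) : (forall y, List.In y Y -> trig_poly y) ->
  trig_poly (fun x => bernstein m g [seq y x | y <- Y]).
Proof.
elim: Y g => [|y Y IH] g tY /=; first exact: trig_poly_cst.
apply: (@trig_poly_binom_mean m (fun k x => bernstein m (fun s => g (k%:R / m%:R :: s))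
   [seq y x | y <- Y]) y); first by apply: tY; left.
by move=> k; apply: IH => z zY; apply: tY; right.
Qed.

(* Boundedness takes care of the far points, so only [y] needs to range over a compact. *)
Lemma continuous_quadratic_modulus (G : 'rV[R]_d -> R) (C : set 'rV[R]_d) (M e : R) :
  continuous G -> (forall x, `|G x| <= M) -> compact C -> 0 < e ->
  exists2 K, 0 <= K & forall y, C y -> forall y',
    `|G y' - G y| <= e + K * \sum_j (y' 0 j - y 0 j) ^+ 2.
Proof.
move=> cG GM /compact_near_coveringP cC e0.
pose P (K : R) (y : 'rV[R]_d) := forall y', `|G y' - G y| <= e + K * \sum_j (y' 0 j - y 0 j) ^+ 2.
have : \forall K \near +oo, C `<=` P K.
  apply: cC => y0 Cy0.
  have /cvgrPdist_le/(_ (e / 2) (divr_gt0 e0 (ltr0n _ 2)))/nbhs_ballP[dl /= dl0 hd] := cG y0.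
  exists (ball y0 (dl / 2), [set K | 2 * M / (dl / 2) ^+ 2 < K]) => /=.
    split; first by apply: nbhsx_ballx; exact: divr_gt0.
    by exists (2 * M / (dl / 2) ^+ 2); split => //; exact: num_real.
  move=> [y K] /= [y0y hK] y'.
  have M0 : 0 <= M by exact: le_trans (normr_ge0 _) (GM y0).
  have d2 : 0 < (dl / 2) ^+ 2 by rewrite exprn_gt0// divr_gt0.
  have K0 : 0 <= K by rewrite (le_trans _ (ltW hK))// divr_ge0 ?mulr_ge0// ltW.
  have S0 : 0 <= \sum_j (y' 0 j - y 0 j) ^+ 2 by apply: sumr_ge0 => j _; exact: sqr_ge0.
  have [yy|] := pselect (forall j, `|y' 0 j - y 0 j| < dl / 2).
    have b1 : ball y0 dl y'.
      split; first exact: dl0.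
      move=> i j; rewrite ord1 /ball/=.
      have := y0y.2 0 j; rewrite /ball/= => h1; have h2 := yy j.
      rewrite -(subrKA (y 0 j)) (le_lt_trans (ler_normD _ _))// [ltRHS]splitr ltrD//.
      by rewrite distrC.
    have b2 : ball y0 dl y.
      by apply: (le_ball _ y0y); lra.
    have h1 := hd _ b1; have h2 := hd _ b2.
    apply: (@le_trans _ _ e); last by rewrite lerDl mulr_ge0.
    rewrite -(subrKA (G y0)) (le_trans (ler_normD _ _))// [leRHS]splitr lerD//.
    by rewrite distrC.
  move=> /existsNP[j /negP]; rewrite -leNgt => hj.
  apply: (@le_trans _ _ (2 * M)).
    by rewrite (le_trans (ler_normB _ _))// mulr_natl mulr2n lerD.
  apply: (@le_trans _ _ (K * (dl / 2) ^+ 2)).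
    by rewrite -ler_pdivrMr// ltW.
  rewrite (le_trans _ (_ : K * \sum_j (y' 0 j - y 0 j) ^+ 2 <= _))//; last first.
    by rewrite lerDr ltW.
  rewrite ler_wpM2l// (bigD1 j)//= -(real_normK (num_real (y' 0 j - y 0 j))).
  apply: (@le_trans _ _ (`|y' 0 j - y 0 j| ^+ 2)).
    by rewrite lerXn2r ?nnegrE// ltW// divr_gt0.
  by rewrite lerDl sumr_ge0// => k _; exact: sqr_ge0.
move=> [K0 [_ hK]]; exists (`|K0| + 1); first by rewrite addr_ge0.
move=> y Cy; apply: (hK (`|K0| + 1)) => //.
by rewrite (le_lt_trans (ler_norm _))// ltrDl.
Qed.

Lemma continuous_map_row (s : R -> R) : continuous s ->
  continuous (fun y : 'rV[R]_d => map_mx s y).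
Proof.
move=> cs y U [I hI sIU]; exists (fun i j => s @^-1` I i j).
  by move=> i j; apply: cs; have := hI i j; rewrite mxE.
by move=> z hz; apply: sIU => i j; rewrite mxE; exact: hz.
Qed.

(* Bernstein polynomials, in the variables [(1 + sin (x_j / (2 L))) / 2], of [g]
   composed with the inverse of this change of variables. *)
Lemma trig_poly_dense (g : 'rV[R]_d -> R) (M L e : R) :
  continuous g -> (forall x, `|g x| <= M) -> 0 < L -> 0 < e ->
  exists T, [/\ trig_poly T, (forall x : 'rV[R]_d, `|T x| <= M) &
    (forall x : 'rV[R]_d, (forall j, `|x 0 j| <= L) -> `|T x - g x| <= e)].
Proof.
move=> cg gM L0 e0.
(* For [|x_j| <= L] the angle [x_j / (2 L)] is at most 1/2 in absolute value, so the sines that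
   matter stay in [[-b, b]], strictly inside []-1, 1[]. *)
pose b : R := sin (1 / 2).
have b1 : b < 1.
  have c0 : 0 < cos (1 / 2 : R).
    apply: cos_gt0_pihalf; have := @pihalf_ge1 R; rewrite mul1r => h.
    by apply/andP; split; lra.
  have := cos2Dsin2 (1 / 2 : R); rewrite -/b => h.
  by rewrite ltNge; apply/negP => b1; nra.
have b0 : 0 <= b.
  apply: sin_ge0_pi; have := @pi_ge2 R => h.
  by rewrite mul1r invr_ge0 ler0n/= (le_trans _ h)// (@le_trans _ _ 1) ?invf_le1 ?ler1n.
(* Truncation to [[-b, b]] keeps the argument of [asin] where it is continuous, and so makes the
   inverse change of variables continuous on the whole line, without changing it on the image of
   [[-L, L]]. *)
pose clamp (z : R) := Num.max (- b) (Num.min b (2 * z - 1)).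
have clamp_in z : - 1 < clamp z < 1.
  rewrite /clamp lt_max gt_max gt_min b1 ltrN2 b1/= andbT.
  by rewrite (le_lt_trans _ ltr01)// oppr_le0.
pose s (z : R) : R := 2 * L * asin (clamp z).
have cs : continuous s.
  move=> z; apply: cvgMl_tmp.
  have c1 : {for z, continuous clamp}.
    apply: continuous_max; first exact: cvg_cst.
    apply: continuous_min; first exact: cvg_cst.
    by apply: cvgB; [apply: cvgMl_tmp; exact: cvg_id|exact: cvg_cst].
  by apply: (continuous_comp c1); exact: continuous_asin.
pose G (y : 'rV[R]_d) := g (map_mx s y).
have cG : continuous G.
  by move=> y; apply: continuous_comp; [exact: continuous_map_row|exact: cg].
pose C : set 'rV[R]_d := [set y | forall j, `[0, 1]%classic (y 0 j)].
have cC : compact C.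
  by apply: (@rV_compact _ _ (fun=> `[(0 : R), 1]%classic)) => j; exact: segment_compact.
have [|K K0 hK] := @continuous_quadratic_modulus G C M (e / 2) cG (fun y => gM _) cC.
  by rewrite divr_gt0.
have [m m0 hm] : exists2 m, (0 < m)%N & K * d%:R / m%:R <= e / 2.
  exists (Num.bound (2 * K * d%:R / e)).+1 => //.
  have := archi_boundP (_ : 0 <= 2 * K * d%:R / e).
  rewrite divr_ge0 ?mulr_ge0 ?(ltW e0)// => /(_ isT) /ltW h.
  rewrite ler_pdivrMr ?ltr0n// mulrAC ler_pdivlMr// mulrC mulrA -ler_pdivrMl//.
  by rewrite [leLHS]mulrC (le_trans h)// ler_nat.
pose yy (j : 'I_d) (x : 'rV[R]_d) : R := (1 + sin (x 0 j / (2 * L))) / 2.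
have yy01 j x : 0 <= yy j x <= 1.
  have := sin_geN1 (x 0 j / (2 * L)); have := sin_le1 (x 0 j / (2 * L)).
  by rewrite /yy => h1 h2; apply/andP; split; lra.
have tyy j : trig_poly (yy j).
  rewrite (_ : yy j = fun x => 2^-1 + 2^-1 * cos (- (pi / 2) + dotr ((2 * L)^-1 *: delta_mx 0 j) x)).
    by apply: trig_polyD; [exact: trig_poly_cst|exact: trig_poly_cos].
  apply/funext => x; rewrite dotrZl /dotr -rowE 2!mxE (addrC (- _)) cosB cos_pihalf sin_pihalf.
  by rewrite mulr0 add0r mulr1 /yy mulrDl mul1r; congr (_ + _); rewrite mulrC; congr (_ * sin _); rewrite mulrC.
pose Y := [seq yy j | j <- enum 'I_d].
pose gs (l : seq R) := G (\row_j l`_j).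
pose T x := bernstein m gs [seq y x | y <- Y].
have sY x : size [seq y x | y <- Y] = d by rewrite size_map /Y size_map size_enum_ord.
have aY x : all (fun y => 0 <= y <= 1) [seq y x | y <- Y].
  by rewrite all_map all_map; apply/allP => j _; exact: yy01.
have nY x (j : 'I_d) : [seq y x | y <- Y]`_j = yy j x.
  rewrite /Y -map_comp (nth_map j) ?size_enum_ord//=.
  by rewrite nth_ord_enum.
exists T; split.
- apply: trig_poly_bernstein => y /List.in_map_iff[j [<- _]]; exact: tyy.
- by move=> x; apply: bernstein_bounded => // l; exact: gM.
- move=> x xL; have Cy : C (\row_j yy j x).
    by move=> j; rewrite mxE /= in_itv/=; exact: yy01.
  (* On the cube the truncation is inactive and [asin] undoes the sine. *)
  have <- : G (\row_j yy j x) = g x.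
    rewrite /G; congr g; apply/rowP => j; rewrite !mxE /s /clamp.
    have -> : 2 * yy j x - 1 = sin (x 0 j / (2 * L)) by rewrite /yy; field.
    have xl : `|x 0 j / (2 * L)| <= 1 / 2.
      rewrite normf_div (gtr0_norm (_ : 0 < 2 * L)) ?mulr_gt0//.
      by rewrite ler_pdivrMr ?mulr_gt0// (le_trans (xL j))//; lra.
    have h2 : (2^-1 : R) <= pi / 2.
      by rewrite (le_trans _ (pihalf_ge1 _))// invf_le1 ?ler1n.
    have ix : x 0 j / (2 * L) \in `[(- (pi / 2)), pi / 2].
      by move: xl; rewrite in_itv/= ler_norml mul1r => /andP[? ?]; lra.
    have mono : `|sin (x 0 j / (2 * L))| <= b.
      have ib : (1 / 2 : R) \in `[(- (pi / 2)), pi / 2].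
        by rewrite in_itv/= mul1r; lra.
      have ibN : (- (1 / 2) : R) \in `[(- (pi / 2)), pi / 2].
        by rewrite in_itv/= mul1r; lra.
      rewrite ler_norml /b -sinN !leNgt !ltr_sin// -!leNgt.
      by move: xl; rewrite ler_norml.
    move: (mono); rewrite ler_norml => /andP[m1 m2].
    rewrite (min_r m2) (max_r m1) sinK//.
    by field; rewrite gt_eqF.
  apply: (@le_trans _ _ (e / 2 + K * d%:R / m%:R)); last by rewrite [leRHS]splitr lerD2l.
  have -> : K * d%:R / m%:R = K * (size [seq y x | y <- Y])%:R / m%:R by rewrite sY.
  apply: bernstein_dist => // l sl.
  rewrite sY in sl; rewrite sY.
  have := hK _ Cy (\row_j l`_j); rewrite /gs.
  congr (_ <= _ + _ * _); apply: eq_bigr => j _.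
  by rewrite !mxE nY.
Qed.

End TrigonometricPolynomials.

Lemma cvg_prodr (R : realType) (T : Type) (F : set_system T) {FF : Filter F}
    (I : Type) (r : seq I) (f : I -> T -> R) (a : I -> R) :
  (forall i, f i x @[x --> F] --> a i) ->
  \prod_(i <- r) f i x @[x --> F] --> \prod_(i <- r) a i.
Proof.
move=> h; elim: r => [|i r IH].
  rewrite big_nil; under eq_fun do rewrite big_nil; exact: cvg_cst.
rewrite big_cons; under eq_fun do rewrite big_cons.
exact: cvgM.
Qed.

Lemma continuous_prodr (R : realType) (T : topologicalType)
    (I : Type) (r : seq I) (f : I -> T -> R) :
  (forall i, continuous (f i)) -> continuous (fun x => \prod_(i <- r) f i x).
Proof. by move=> h x; apply: cvg_prodr => i; exact: h. Qed.

(** * Convergence and uniqueness from real characteristic functions *)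

Section LevyContinuity.
Context {R : realType}.

Section Integrals.
Context {dO : measure_display} {Om : measurableType dO} (P : probability Om R).

Lemma Rintegral_dist_le (f1 f2 : Om -> R) (M e : R) (A : set Om) : 0 <= e ->
  measurable_fun [set: Om] f1 -> measurable_fun [set: Om] f2 ->
  (forall x, `|f1 x| <= M) -> (forall x, `|f2 x| <= M) -> measurable A ->
  (forall x, ~ A x -> `|f1 x - f2 x| <= e) ->
  `|\int[P]_x f1 x - \int[P]_x f2 x| <= e + 2 * M * fine (P A).
Proof.
move=> e0 m1 m2 b1 b2 mA h.
have i1 : P.-integrable [set: Om] (EFin \o f1) by exact: (@integrable_bounded _ _ _ P f1 M).
have i2 : P.-integrable [set: Om] (EFin \o f2) by exact: (@integrable_bounded _ _ _ P f2 M).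
have i3 : P.-integrable [set: Om] (EFin \o (fun x => f1 x - f2 x)).
  exact: (integrableB measurableT i1 i2).
have iA : P.-integrable [set: Om] (EFin \o (\1_A : Om -> R)).
  apply: (@integrable_bounded _ _ _ P _ 1); first exact: measurable_indic.
  by move=> x; rewrite indicE; case: (_ \in _); rewrite ?normr1// normr0.
have i4 : P.-integrable [set: Om] (EFin \o (fun x => 2 * M * \1_A x)).
  exact: (integrableZl measurableT (2 * M) iA).
rewrite -RintegralB//; apply: (le_trans (le_normr_Rintegral _ _)) => //.
have -> : e + 2 * M * fine (P A) = \int[P]_x (e + 2 * M * \1_A x).
  rewrite RintegralD//; last exact: finite_measure_integrable_cst.
  rewrite Rintegral_prob_cst RintegralZl//; congr (_ + _ * _).
  by rewrite /Rintegral integral_indic// setIT.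
apply: le_Rintegral => //.
- exact: (integrable_abse i3).
- exact: (integrableD measurableT (finite_measure_integrable_cst P e measurableT) i4).
- move=> x _; have [Ax|Ax] := pselect (A x).
    rewrite indicE mem_set// mulr1 (le_trans (ler_normB _ _))//.
    by rewrite (le_trans (lerD (b1 x) (b2 x)))// mulr_natl mulr2n lerDr.
  by rewrite indicE memNset// mulr0 addr0 h.
Qed.

Lemma Rintegral_bounded_cvg (f_ : nat -> Om -> R) (f : Om -> R) (M : R) :
  (forall n, measurable_fun [set: Om] (f_ n)) -> (forall n x, `|f_ n x| <= M) ->
  (forall x, f_ n x @[n --> \oo] --> f x) ->
  \int[P]_x f_ n x @[n --> \oo] --> \int[P]_x f x.
Proof.
move=> mf fM ff.
have mlim : measurable_fun [set: Om] f by apply: (measurable_fun_cvg mf) => x _; exact: ff.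
have iM : P.-integrable [set: Om] (EFin \o cst M) by exact: finite_measure_integrable_cst.
have [||fint _ h] := @dominated_convergence _ Om R P _ measurableT (fun n => EFin \o f_ n) (EFin \o f)
  (EFin \o cst M) (fun n => (measurable_EFinP _ _).2 (mf n)) ((measurable_EFinP _ _).2 mlim) _ iM _.
- by apply: aeW => x _; apply: cvg_EFin; [exact: nearW|exact: ff].
- by apply: aeW => x n _; rewrite /= lee_fin.
move: h; rewrite /= EFin_Rintegral// => /fine_cvg.
by [].
Qed.

Context {d : nat} (Z : Om -> 'rV[R]_d).
Hypothesis mZ : forall j, measurable_fun [set: Om] (fun w => Z w 0 j).

Lemma trig_poly_measurable T : trig_poly T -> measurable_fun [set: Om] (T \o Z).
Proof.
elim=> [a c u|f g _ mf _ mg]; last exact: measurable_funD.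
apply: measurable_funM => //; apply: (measurableT_comp measurable_cos).
apply: measurable_funD => //.
under eq_fun do rewrite dotrE.
by apply: measurable_sum => j; exact: measurable_funM.
Qed.

Lemma trig_poly_bounded (T : 'rV[R]_d -> R) : trig_poly T -> exists M, forall x, `|T x| <= M.
Proof.
elim=> [a c u|f g _ [M1 h1] _ [M2 h2]].
  by exists `|a| => x; rewrite normrM ler_piMr// cos_max.
by exists (M1 + M2) => x; rewrite (le_trans (ler_normD _ _))// lerD.
Qed.

(** Only the coordinates of [Z] are assumed measurable; [g \o Z] is the pointwise limit of
    trigonometric polynomials that approximate [g] on growing cubes. *)
Lemma measurable_continuous_rV (g : 'rV[R]_d -> R) (M : R) : continuous g ->
  (forall x, `|g x| <= M) -> measurable_fun [set: Om] (g \o Z).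
Proof.
move=> cg gM.
have /choice[T hT] : forall k : nat, exists T, [/\ trig_poly T, (forall x : 'rV[R]_d, `|T x| <= M) &
    (forall x : 'rV[R]_d, (forall j, `|x 0 j| <= k.+1%:R) -> `|T x - g x| <= harmonic k)].
  by move=> k; apply: trig_poly_dense => //; exact: harmonic_gt0.
apply: (measurable_fun_cvg (fun k => trig_poly_measurable (let: And3 t _ _ := hT k in t))).
move=> w _; apply/cvgrPdist_le => e e0.
have /cvgrPdist_le/(_ e e0) hh := @cvg_harmonic R.
have : \forall k \near \oo, forall j : 'I_d, `|Z w 0 j| <= k.+1%:R.
  apply: filter_forall => j; near=> k.
  rewrite (@le_trans _ _ k%:R) ?ler_nat//; near: k; exact: nbhs_infty_ger.
move: hh; apply: filterS2 => k; rewrite sub0r normrN => h1 h2.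
have [_ _ h3] := hT k; rewrite distrC (le_trans (h3 _ h2))//.
by rewrite (le_trans (ler_norm _)).
Unshelve. all: by end_near. Qed.

Lemma measurable_exceed (L : R) : measurable [set w | exists j, L < `|Z w 0 j|].
Proof.
rewrite (_ : [set w | _] = \bigcup_(j in [set: 'I_d]) [set w | L < `|Z w 0 j|]).
  apply: fin_bigcup_measurable => // j _.
  have mf : measurable_fun [set: Om] (fun w => `|Z w 0 j|) by exact: measurableT_comp.
  have := mf measurableT `]L, +oo[%classic (measurable_itv _); rewrite setTI.
  by congr (measurable _); apply/seteqP; split => w /=; rewrite in_itv/= andbT.
by apply/seteqP; split => [w [j h]|w [j _ h]]; exists j.
Qed.

End Integrals.

Section Convergence.
Context {d : nat} {dO : measure_display} {Om : measurableType dO}.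
Context {dO' : measure_display} {Om' : measurableType dO'}.
Variables (P : nat -> probability Om R) (Z : nat -> Om -> 'rV[R]_d).
Variables (Q : probability Om' R) (Z' : Om' -> 'rV[R]_d).
Hypothesis mZ : forall n j, measurable_fun [set: Om] (fun w => Z n w 0 j).
Hypothesis mZ' : forall j, measurable_fun [set: Om'] (fun w => Z' w 0 j).
Hypothesis tightP : forall e : R, 0 < e -> exists2 L : R, 0 < L &
  \forall n \near \oo, fine (P n [set w | exists j, L < `|Z n w 0 j|]) <= e.
Hypothesis tightQ : forall e : R, 0 < e -> exists2 L : R, 0 < L &
  fine (Q [set w | exists j, L < `|Z' w 0 j|]) <= e.
Hypothesis chf_cvg : forall c u,
  \int[P n]_w cos (c + dotr u (Z n w)) @[n --> \oo] --> \int[Q]_w cos (c + dotr u (Z' w)).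

Let trig_poly_cvg T : trig_poly T ->
  \int[P n]_w T (Z n w) @[n --> \oo] --> \int[Q]_w T (Z' w).
Proof.
elim=> [a c u|f g tf cf tg cg].
  rewrite RintegralZl//; last first.
    have [M hM] := @trig_poly_bounded d _ (trig_poly_cos 1 c u).
    apply: (@integrable_bounded _ _ _ Q _ M); last by move=> x; have := hM (Z' x); rewrite mul1r.
    by have := trig_poly_measurable mZ' (trig_poly_cos 1 c u); apply: eq_measurable_fun => x _; rewrite /= mul1r.
  under eq_fun => n.
    rewrite RintegralZl//; last first.
      have [M hM] := @trig_poly_bounded d _ (trig_poly_cos 1 c u).
      apply: (@integrable_bounded _ _ _ (P n) _ M); last by move=> x; have := hM (Z n x); rewrite mul1r.
      by have := trig_poly_measurable (mZ n) (trig_poly_cos 1 c u); apply: eq_measurable_fun => x _; rewrite /= mul1r.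
    over.
  by apply: cvgMl_tmp; exact: chf_cvg.
have [M1 h1] := trig_poly_bounded tf; have [M2 h2] := trig_poly_bounded tg.
rewrite RintegralD//; last 2 first.
- exact: (integrable_bounded _ (trig_poly_measurable mZ' tf) (fun x => h1 _)).
- exact: (integrable_bounded _ (trig_poly_measurable mZ' tg) (fun x => h2 _)).
under eq_fun => n.
  rewrite RintegralD//; last 2 first.
  - exact: (integrable_bounded _ (trig_poly_measurable (mZ n) tf) (fun x => h1 _)).
  - exact: (integrable_bounded _ (trig_poly_measurable (mZ n) tg) (fun x => h2 _)).
  over.
exact: cvgD.
Qed.

Theorem levy_continuity (g : 'rV[R]_d -> R) (M : R) : continuous g -> (forall x, `|g x| <= M) ->
  \int[P n]_w g (Z n w) @[n --> \oo] --> \int[Q]_w g (Z' w).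
Proof.
move=> cg gM; apply/cvgrPdist_le => e e0.
have M0 : 0 <= M by exact: le_trans (normr_ge0 _) (gM 0).
(* The two replacements of [g] by [T] cost [e' + 2 * M * e'] each and the convergence for [T] costs
   [e'], in all [(3 + 4 * M) * e']. *)
pose e' := e / (3 + 4 * M).
have D0 : 0 < 3 + 4 * M by rewrite ltr_pwDl// mulr_ge0.
have e'0 : 0 < e' by rewrite divr_gt0.
have [L1 L10 h1] := tightP e'0; have [L2 L20 h2] := tightQ e'0.
pose L := Num.max L1 L2.
have L0 : 0 < L by rewrite lt_max L10.
have [T [tT TM hT]] := trig_poly_dense cg gM L0 e'0.
have /cvgrPdist_le/(_ e' e'0) h3 := trig_poly_cvg tT.
have dist (dW : measure_display) (W : measurableType dW) (S : probability W R)
    (V : W -> 'rV[R]_d) L' : (forall j, measurable_fun [set: W] (fun w => V w 0 j)) -> L' <= L ->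
    fine (S [set w | exists j, L' < `|V w 0 j|]) <= e' ->
    `|\int[S]_w T (V w) - \int[S]_w g (V w)| <= e' + 2 * M * e'.
  move=> mV LL hS.
  apply: le_trans (Rintegral_dist_le S (ltW e'0) (trig_poly_measurable mV tT)
    (measurable_continuous_rV mV cg gM) (fun x => TM _) (fun x => gM _)
    (measurable_exceed mV L') _) _; last by rewrite lerD2l ler_wpM2l// mulr_ge0.
  move=> w hw; apply: hT => j; rewrite leNgt; apply/negP => hj.
  by apply: hw; exists j; exact: le_lt_trans LL hj.
have dQ := dist _ _ Q Z' L2 mZ' _ h2.
move: h1 h3; apply: filterS2 => n hP hn.
have dP := dist _ _ (P n) (Z n) L1 (mZ n) _ hP.
have -> : e = (e' + 2 * M * e') + e' + (e' + 2 * M * e').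
  by rewrite /e'; field; rewrite gt_eqF.
have -> : \int[Q]_w g (Z' w) - \int[P n]_w g (Z n w) =
  (\int[Q]_w g (Z' w) - \int[Q]_w T (Z' w)) + (\int[Q]_w T (Z' w) - \int[P n]_w T (Z n w))
  + (\int[P n]_w T (Z n w) - \int[P n]_w g (Z n w)) by ring.
rewrite (le_trans (ler_normD _ _))// lerD//; last by apply: dP; rewrite le_max lexx.
rewrite (le_trans (ler_normD _ _))// lerD// distrC; apply: dQ.
by rewrite le_max lexx orbT.
Qed.

End Convergence.

(** The exceedance events decrease to the empty set: a given outcome leaves them once the level
    passes the sum of its absolute coordinates. *)
Lemma tight_single (d : nat) (dO : measure_display) (Om : measurableType dO)
    (P : probability Om R) (Z : Om -> 'rV[R]_d) :
  (forall j, measurable_fun [set: Om] (fun w => Z w 0 j)) ->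
  forall e : R, 0 < e -> exists2 L : R, 0 < L & fine (P [set w | exists j, L < `|Z w 0 j|]) <= e.
Proof.
move=> mZ e e0.
pose F (n : nat) := [set w | exists j, n.+1%:R < `|Z w 0 j|].
have mF n : measurable (F n) by exact: measurable_exceed.
have : P (F n) @[n --> \oo] --> P (\bigcap_n F n).
  apply: nonincreasing_cvg_mu => //.
  - by rewrite (le_lt_trans (probability_le1 P (mF 0%N)))// ltry.
  - exact: bigcapT_measurable.
  - move=> n m nm; apply/subsetPset => w [j hj]; exists j.
    by rewrite (le_lt_trans _ hj)// ler_nat ltnS.
rewrite (_ : \bigcap_n F n = set0) ?measure0; last first.
  apply/seteqP; split => // w hw.
  pose B := \sum_j `|Z w 0 j|.
  have B0 : 0 <= B by apply: sumr_ge0.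
  have [j] := hw (Num.bound B) I.
  rewrite ltNge => /negP; apply.
  apply: (@le_trans _ _ B); first by rewrite /B (bigD1 j)//= lerDl sumr_ge0.
  by rewrite (le_trans (ltW (archi_boundP B0)))// ler_nat.
move=> /fine_cvg /cvgrPdist_le /(_ e e0) [n _ /(_ n (leqnn n))] /=.
rewrite sub0r normrN => h; exists n.+1%:R => //.
by rewrite (le_trans (ler_norm _)).
Qed.

Section Uniqueness.
Context {n : nat} {dO : measure_display} {Om : measurableType dO}.
Context {dO' : measure_display} {Om' : measurableType dO'}.
Variables (P : probability Om R) (Z : Om -> n.-tuple R).
Variables (Q : probability Om' R) (Z' : Om' -> n.-tuple R).
Hypothesis mZ : measurable_fun [set: Om] Z.
Hypothesis mZ' : measurable_fun [set: Om'] Z'.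
Hypothesis chf_eq : forall c u,
  \int[P]_w cos (c + dotr u (row_of_tuple (Z w))) =
  \int[Q]_w cos (c + dotr u (row_of_tuple (Z' w))).

Let mrow (dW : measure_display) (W : measurableType dW) (V : W -> n.-tuple R) :
  measurable_fun [set: W] V ->
  forall j, measurable_fun [set: W] (fun w => row_of_tuple (V w) 0 j).
Proof.
move=> mV j; under eq_fun do rewrite mxE.
exact: (measurableT_comp (measurable_tnth j) mV).
Qed.

Let eq_continuous (g : 'rV[R]_n -> R) (M : R) : continuous g -> (forall x, `|g x| <= M) ->
  \int[P]_w g (row_of_tuple (Z w)) = \int[Q]_w g (row_of_tuple (Z' w)).
Proof.
move=> cg gM.
have tP (e : R) : 0 < e -> exists2 L : R, 0 < L &
    \forall n \near \oo, fine (P [set w | exists j, L < `|row_of_tuple (Z w) 0 j|]) <= e.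
  by move=> e0; have [L L0 h] := tight_single P (mrow mZ) e0; exists L => //; exact: nearW.
have := @levy_continuity n _ _ _ _ (fun=> P) (fun=> @row_of_tuple R n \o Z) Q
  (@row_of_tuple R n \o Z') (fun=> mrow mZ) (mrow mZ') tP (tight_single Q (mrow mZ')) _ g M cg gM.
have hc c u : \int[P]_w cos (c + dotr u (row_of_tuple (Z w))) @[_ --> \oo] -->
    \int[Q]_w cos (c + dotr u (row_of_tuple (Z' w))).
  by rewrite -chf_eq; exact: cvg_cst.
by move=> /(_ hc) /(cvg_lim (@Rhausdorff R)); rewrite lim_cst//; exact: Rhausdorff.
Qed.

(** Levy's theorem for constant sequences equates the integrals of bounded continuous functions;
    products of ramps then converge to indicators of products of rays, and these sets determine the
    law. *)
Lemma chf_unique (A : set (n.-tuple R)) : measurable A -> P (Z @^-1` A) = Q (Z' @^-1` A).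
Proof.
move=> mA.
pose ZZ : {mfun Om >-> n.-tuple R} := mfun_Sub (mem_set mZ).
pose ZZ' : {mfun Om' >-> n.-tuple R} := mfun_Sub (mem_set mZ').
suff h : forall A, @ray_rects R n A -> distribution P ZZ A = distribution Q ZZ' A.
  exact: (ray_rects_unique h mA).
move=> _ [U hU ->].
have /choice[a ha] : forall i, exists o : option R,
    U i = if o is Some x then `]x, +oo[%classic else setT.
  by move=> i; case: (hU i) => [->|[x ->]]; [exists None|exists (Some x)].
(* A ramp from 0 at the endpoint to 1 at distance [1 / k]: at each fixed point it is eventually
   equal to the indicator of the open ray. *)
pose r (k i : nat) (x : R) : R :=
  if a i is Some b then Num.max 0 (Num.min 1 (k%:R * (x - b))) else 1.
have r01 k i x : 0 <= r k i x <= 1.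
  rewrite /r; case: (a i) => [b|]; last by rewrite ler01 lexx.
  by rewrite le_max lexx/= ge_max ler01 ge_min lexx.
have cr k i : continuous (r k i).
  rewrite /r; case: (a i) => [b|] x; last exact: cvg_cst.
  apply: (@continuous_max R R (cst 0) (fun y => Num.min 1 (k%:R * (y - b))) x).
    exact: cvg_cst.
  apply: (@continuous_min R R (cst 1) (fun y => k%:R * (y - b)) x); first exact: cvg_cst.
  by apply: cvgMl_tmp; apply: cvgB => //; exact: cvg_cst.
pose g k (v : 'rV[R]_n) : R := \prod_(i < n) r k i (v 0 i).
have cg k : continuous (g k).
  apply: continuous_prodr => i v.
  by apply: (continuous_comp (@coord_continuous R 1 n 0 i v)); exact: cr.
have g1 k v : `|g k v| <= 1.
  rewrite ger0_norm; last by apply: prodr_ge0 => i _; case/andP: (r01 k i (v 0 i)).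
  by apply: prodr_ile1 => i _; exact: r01.
have glim (t : n.-tuple R) : g k (row_of_tuple t) @[k --> \oo] --> (\1_(rect U) t : R).
  have ri (i : 'I_n) : \forall k \near \oo, r k i (tnth t i) = \1_(U i) (tnth t i).
    rewrite /r ha; case: (a i) => [b|]; last by apply: nearW => k; rewrite indicE mem_set.
    have [xb|xb] := ltP b (tnth t i).
      near=> k; rewrite indicE mem_set/= ?in_itv/= ?xb//.
      rewrite min_l ?max_r// -ler_pdivrMr ?subr_gt0// mul1r.
      near: k; exact: nbhs_infty_ger.
    apply: nearW => k; rewrite indicE memNset/=; last by rewrite in_itv/= andbT ltNge xb.
    have h : k%:R * (tnth t i - b) <= 0 by rewrite mulr_ge0_le0// subr_le0.
    by rewrite (min_r (le_trans h ler01)) max_l.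
  have : \forall k \near \oo, forall i : 'I_n, r k i (tnth t i) = \1_(U i) (tnth t i).
    exact: filter_forall.
  move=> hr; apply: cvg_near_cst; apply: filterS hr => k hk.
  rewrite /g; under eq_bigr do rewrite mxE hk.
  rewrite indicE; have [tU|tU] := pselect (rect U t).
    rewrite mem_set//= big1// => i _; rewrite indicE mem_set//; exact: tU.
  rewrite memNset//; move/existsNP : tU => [i tUi].
  by rewrite (bigD1 i)//= indicE memNset// mul0r.
have mrect : measurable (rect (n := n) U).
  by apply: measurable_rect => i; rewrite ha; case: (a i).
have ilim (dW : measure_display) (W : measurableType dW) (S : probability W R) (V : W -> n.-tuple R) :
    measurable_fun [set: W] V ->
    \int[S]_w g k (row_of_tuple (V w)) @[k --> \oo] --> fine (S (V @^-1` rect U)).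
  move=> mV.
  have mVU : measurable (V @^-1` rect U) by have := mV measurableT _ mrect; rewrite setTI.
  rewrite (_ : fine _ = \int[S]_w (\1_(rect U) (V w) : R)); last first.
    rewrite /Rintegral; have := integral_indic S measurableT mVU; rewrite setIT => <-.
    by congr fine; apply: eq_integral.
  apply: (@Rintegral_bounded_cvg _ _ S _ _ 1) => // k.
  exact: (measurable_continuous_rV (mrow mV) (cg k) (g1 k)).
have h1 := ilim _ _ P Z mZ; have h2 := ilim _ _ Q Z' mZ'.
have e : (fun k => \int[P]_w g k (row_of_tuple (Z w))) = (fun k => \int[Q]_w g k (row_of_tuple (Z' w))).
  by apply/funext => k; exact: (eq_continuous (cg k) (g1 k)).
rewrite e in h1.
have h : fine (P (Z @^-1` rect U)) = fine (Q (Z' @^-1` rect U)).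
  exact: (cvg_unique (@Rhausdorff R) h1 h2).
rewrite /distribution /pushforward.
have m1 : measurable (Z @^-1` rect U).
  by rewrite -[X in measurable X]setTI; exact: mZ.
have m2 : measurable (Z' @^-1` rect U).
  by rewrite -[X in measurable X]setTI; exact: mZ'.
rewrite -[LHS]fineK; last exact: fin_num_measure m1.
by rewrite -[RHS]fineK; [congr EFin|exact: fin_num_measure m2].
Unshelve. all: by end_near. Qed.

End Uniqueness.
End LevyContinuity.

Lemma young_sqr (R : realFieldType) (a x y : R) : 0 < a ->
  2 * x * y <= a * x ^+ 2 + a^-1 * y ^+ 2.
Proof.
move=> a0; have := mulr_ge0 (ltW (_ : 0 < a^-1)) (sqr_ge0 (a * x - y)).
rewrite invr_gt0 => /(_ a0).
have -> : a^-1 * (a * x - y) ^+ 2 = a * x ^+ 2 + a^-1 * y ^+ 2 - 2 * x * y.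
  by field; rewrite gt_eqF.
by rewrite subr_ge0.
Qed.

(** * The law of the observations *)

Section MeanSquareLimits.
Context {d : measure_display} {T : measurableType d} {R : realType}.
Local Open Scope ereal_scope.

(** Stated with an extended integral so that both limits in [is_wiener_integral], for Lebesgue
    measure and for [P], are instances. *)
Definition cvg_L2 (mu : {measure set T -> \bar R}) (D : set T) (f_ : nat -> T -> R) (f : T -> R) :=
  \int[mu]_(x in D) ((f x - f_ k x) ^+ 2)%:E @[k --> \oo] --> 0.

Lemma ge0_integral_le_lin (mu : {measure set T -> \bar R}) D (f g h : T -> R) (a b : R) :
  measurable D -> measurable_fun D f -> measurable_fun D g -> measurable_fun D h ->
  (0 <= a)%R -> (0 <= b)%R ->
  (forall x, 0 <= f x)%R -> (forall x, 0 <= g x)%R -> (forall x, 0 <= h x)%R ->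
  (forall x, f x <= a * g x + b * h x)%R ->
  \int[mu]_(x in D) (f x)%:E <=
  a%:E * \int[mu]_(x in D) (g x)%:E + b%:E * \int[mu]_(x in D) (h x)%:E.
Proof.
move=> mD mf mg mh a0 b0 f0 g0 h0 fgh.
apply: (@le_trans _ _ (\int[mu]_(x in D) ((a * g x)%:E + (b * h x)%:E))).
  apply: ge0_le_integral => //.
  - by move=> x _; rewrite lee_fin.
  - exact/measurable_EFinP.
  - by apply: emeasurable_funD; apply/measurable_EFinP; exact: measurable_funM.
  - by move=> x _; rewrite -EFinD lee_fin.
rewrite ge0_integralD//; first last.
- by apply/measurable_EFinP; exact: measurable_funM.
- by move=> x _; rewrite lee_fin mulr_ge0.
- by apply/measurable_EFinP; exact: measurable_funM.
- by move=> x _; rewrite lee_fin mulr_ge0.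
under eq_integral do rewrite EFinM.
rewrite ge0_integralZl//; last 2 first.
- exact/measurable_EFinP.
- by move=> x _; rewrite lee_fin.
under [in X in _ + X <= _]eq_integral do rewrite EFinM.
rewrite ge0_integralZl//; first exact/measurable_EFinP.
by move=> x _; rewrite lee_fin.
Qed.

Lemma cvg_L2D (mu : {measure set T -> \bar R}) D (f_ g_ : nat -> T -> R) (f g : T -> R) :
  measurable D ->
  (forall k, measurable_fun D (f_ k)) -> (forall k, measurable_fun D (g_ k)) ->
  measurable_fun D f -> measurable_fun D g ->
  cvg_L2 mu D f_ f -> cvg_L2 mu D g_ g ->
  cvg_L2 mu D (fun k x => f_ k x + g_ k x)%R (fun x => f x + g x)%R.
Proof.
move=> mD mf_ mg_ mf mg cf cg.
have h : 2%:E * \int[mu]_(x in D) ((f x - f_ k x) ^+ 2)%:E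
       + 2%:E * \int[mu]_(x in D) ((g x - g_ k x) ^+ 2)%:E @[k --> \oo] --> 0.
  rewrite -[X in _ --> X](adde0 0) -[in X in _ --> X + _](mule0 2%:E) -[in X in _ --> _ + X](mule0 2%:E).
  by apply: cvgeD => //; apply: cvgeZl.
apply: (squeeze_cvge _ (cvg_cst 0) h); apply: nearW => k; apply/andP; split.
  by apply: integral_ge0 => x _; rewrite lee_fin sqr_ge0.
have m1 : measurable_fun D (fun x => ((f x - f_ k x) ^+ 2)%R).
  by apply: measurable_funX; exact: measurable_funB.
have m2 : measurable_fun D (fun x => ((g x - g_ k x) ^+ 2)%R).
  by apply: measurable_funX; exact: measurable_funB.
apply: ge0_integral_le_lin => //.
- by apply: measurable_funX; apply: measurable_funB; exact: measurable_funD.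
- by move=> x; exact: sqr_ge0.
- by move=> x; exact: sqr_ge0.
- by move=> x; exact: sqr_ge0.
- by move=> x; have := sqr_ge0 ((f x - f_ k x) - (g x - g_ k x))%R; nra.
Qed.

Lemma cvg_L2Z (mu : {measure set T -> \bar R}) D (f_ : nat -> T -> R) (f : T -> R) (a : R) :
  measurable D -> (forall k, measurable_fun D (f_ k)) -> measurable_fun D f ->
  cvg_L2 mu D f_ f -> cvg_L2 mu D (fun k x => a * f_ k x)%R (fun x => a * f x)%R.
Proof.
move=> mD mf_ mf cf; rewrite /cvg_L2.
under eq_fun => k.
  rewrite (eq_integral (fun x => (a ^+ 2)%:E * ((f x - f_ k x) ^+ 2)%:E)); last first.
    by move=> x _; rewrite -EFinM; congr EFin; rewrite -mulrBr exprMn.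
  rewrite ge0_integralZl ?lee_fin ?sqr_ge0//; last 2 first.
  - by apply/measurable_EFinP; apply: measurable_funX; exact: measurable_funB.
  - by move=> x _; rewrite lee_fin sqr_ge0.
  over.
by rewrite -(mule0 (a ^+ 2)%:E); apply: cvgeZl.
Qed.

Lemma cvg_L2_cst (mu : {measure set T -> \bar R}) D (f : T -> R) : cvg_L2 mu D (fun=> f) f.
Proof.
rewrite /cvg_L2; under eq_fun => k.
  rewrite integral0_eq; last by move=> x _; rewrite subrr expr0n.
  over.
exact: cvg_cst.
Qed.

Lemma cvg_L2_sum (mu : {measure set T -> \bar R}) D n (f_ : nat -> nat -> T -> R) (f : nat -> T -> R) :
  measurable D -> (forall i k, (i < n)%N -> measurable_fun D (f_ i k)) ->
  (forall i, (i < n)%N -> measurable_fun D (f i)) ->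
  (forall i, (i < n)%N -> cvg_L2 mu D (f_ i) (f i)) ->
  cvg_L2 mu D (fun k x => \sum_(i < n) f_ i k x)%R (fun x => \sum_(i < n) f i x)%R.
Proof.
move=> mD; elim: n => [|n IH] mf_ mf cf.
  rewrite (_ : (fun (k : nat) (x : T) => _) = fun k => (fun=> 0%R)); last first.
    by apply/funext => k; apply/funext => x; rewrite big_ord0.
  rewrite (_ : (fun x : T => _) = fun=> 0%R); last first.
    by apply/funext => x; rewrite big_ord0.
  exact: cvg_L2_cst.
rewrite (_ : (fun k x => _) = (fun k x => \sum_(i < n) f_ i k x + f_ n k x)%R); last first.
  by apply/funext => k; apply/funext => x; rewrite big_ord_recr.
rewrite (_ : (fun x => _) = (fun x => \sum_(i < n) f i x + f n x)%R); last first.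
  by apply/funext => x; rewrite big_ord_recr.
have ltn i : (i < n -> i < n.+1)%N by move/ltnW.
apply: cvg_L2D => //.
- by move=> k; apply: measurable_sum => i; apply: mf_; apply: ltn.
- by move=> k; apply: mf_.
- by apply: measurable_sum => i; apply: mf; apply: ltn.
- exact: mf.
- by apply: IH => [i k /ltn|i /ltn|i /ltn]; [exact: mf_|exact: mf|exact: cf].
- exact: cf.
Qed.

Lemma cvg_L2_near (mu : {measure set T -> \bar R}) D (f_ : nat -> T -> R) (f : T -> R) (e : R) :
  (0 < e)%R -> cvg_L2 mu D f_ f ->
  \forall k \near \oo, \int[mu]_(x in D) ((f x - f_ k x) ^+ 2)%:E <= e%:E.
Proof.
move=> e0 /fine_cvgP[fin /cvgrPdist_le/(_ e e0)]; move: fin; apply: filterS2 => k fk.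
rewrite sub0r normrN /= => h; rewrite -(fineK fk) lee_fin.
exact: le_trans (ler_norm _) h.
Qed.

(** The cosine is 1-Lipschitz, and [|D| <= e / 2 + (e / 2)^-1 D^2] passes from the mean of [|D|] to
    the mean square. *)
Lemma cvg_L2_cos (P : probability T R) (f_ : nat -> T -> R) (f : T -> R) :
  (forall k, measurable_fun [set: T] (f_ k)) -> measurable_fun [set: T] f ->
  cvg_L2 P setT f_ f ->
  (\int[P]_x cos (f_ k x))%R @[k --> \oo] --> (\int[P]_x cos (f x))%R.
Proof.
move=> mf_ mf cf; apply/cvgrPdist_le => e e0.
have e2 : (0 < e / 2)%R by rewrite divr_gt0.
have ee : (0 < (e / 2) ^+ 2)%R by rewrite exprn_gt0.
have := cvg_L2_near ee cf; apply: filterS => k hk.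
have ic (g : T -> R) : measurable_fun [set: T] g -> P.-integrable [set: T] (EFin \o (fun x => cos (g x))).
  move=> mg; apply: (@integrable_bounded _ _ _ P _ 1%R); last by move=> x; exact: cos_max.
  exact: (measurableT_comp measurable_cos).
have md : measurable_fun [set: T] (fun x => (f x - f_ k x)%R) by exact: measurable_funB.
rewrite -RintegralB//; [|exact: ic|exact: ic].
have ib : P.-integrable [set: T] (EFin \o (fun x => cos (f x) - cos (f_ k x))%R).
  exact: (integrableB measurableT (ic _ mf) (ic _ (mf_ k))).
rewrite (le_trans (le_normr_Rintegral _ _))//.
rewrite -lee_fin -EFin_Rintegral; last exact: (integrable_abse ib).
apply: (@le_trans _ _ ((e / 2)%:E * \int[P]_x 1%:E
    + (e / 2)^-1%:E * \int[P]_x ((f x - f_ k x) ^+ 2)%:E)).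
  apply: ge0_integral_le_lin => //.
  - apply: measurableT_comp => //.
    by apply: measurable_funB; exact: (measurableT_comp measurable_cos).
  - exact: measurable_funX.
  - exact: ltW.
  - by rewrite invr_ge0 ltW.
  - by move=> x; exact: sqr_ge0.
  - move=> x; rewrite mulr1.
    have -> : (cos (f x) - cos (f_ k x) =
       - (2 * sin ((f x + f_ k x) / 2) * sin ((f x - f_ k x) / 2)))%R.
      set p := ((f x + f_ k x) / 2)%R; set q := ((f x - f_ k x) / 2)%R.
      have -> : f x = (p + q)%R by rewrite /p /q; field.
      have -> : f_ k x = (p - q)%R by rewrite /p /q; field.
      by rewrite cosD cosB; ring.
    rewrite normrN !normrM (ger0_norm (_ : (0 <= 2)%R))//.
    set D := (f x - f_ k x)%R.
    have s1 := sin_max ((f x + f_ k x) / 2)%R; have s2 := sin_le_norm (D / 2)%R.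
    rewrite normrM normfV normr_nat in s2.
    apply: (@le_trans _ _ `|D|%R).
      have := normr_ge0 (sin ((f x + f_ k x) / 2))%R; have := normr_ge0 (sin (D / 2))%R.
      by have := normr_ge0 D; nra.
    rewrite -(real_normK (num_real D)); set y := `|D|%R.
    by have := young_sqr 1 y e2; rewrite expr1n !mulr1; have := normr_ge0 D; rewrite -/y; lra.
rewrite integral_cst//= probability_setT !mule1.
apply: (@le_trans _ _ ((e / 2)%:E + (e / 2)^-1%:E * ((e / 2) ^+ 2)%:E)).
  by rewrite leeD2l// lee_wpmul2l// lee_fin invr_ge0 ltW.
rewrite -EFinM -EFinD lee_fin.
have -> : ((e / 2)^-1 * (e / 2) ^+ 2 = e / 2)%R by field; rewrite gt_eqF.
by rewrite -splitr.
Qed.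

(* [|s^2 - g^2| <= (1 + 1/a) (g - s)^2 + a g^2] for every [a > 0]. *)
Lemma cvg_L2_sqr (mu : {measure set T -> \bar R}) (D : set T) (f_ : nat -> T -> R) (f : T -> R) :
  measurable D -> (forall k, measurable_fun D (f_ k)) -> measurable_fun D f ->
  (forall k, mu.-integrable D (EFin \o (fun x => f_ k x ^+ 2)%R)) ->
  mu.-integrable D (EFin \o (fun x => f x ^+ 2)%R) ->
  cvg_L2 mu D f_ f ->
  (\int[mu]_(x in D) (f_ k x ^+ 2))%R @[k --> \oo] --> (\int[mu]_(x in D) (f x ^+ 2))%R.
Proof.
move=> mD mf_ mf if_ iF cf; apply/cvgrPdist_le => e e0.
set I := (\int[mu]_(x in D) (f x ^+ 2))%R.
have I0 : (0 <= I)%R by apply: Rintegral_ge0 => x _; exact: sqr_ge0.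
pose a : R := (e / 2 / (I + 1))%R.
have I1 : (0 < I + 1)%R by rewrite ltr_wpDl.
have a0 : (0 < a)%R by rewrite !divr_gt0.
pose b : R := (1 + a^-1)%R.
have b0 : (0 < b)%R by rewrite addr_gt0// invr_gt0.
have eb : (0 < e / 2 / b)%R by rewrite !divr_gt0.
have := cvg_L2_near eb cf; apply: filterS => k hk.
rewrite -RintegralB//.
have ib : mu.-integrable D (EFin \o (fun x => f x ^+ 2 - f_ k x ^+ 2)%R).
  exact: (integrableB mD iF (if_ k)).
rewrite (le_trans (le_normr_Rintegral _ _))//.
rewrite -lee_fin /Rintegral fineK; last first.
  apply: integrable_fin_num => //; exact: (integrable_abse ib).
have m1 : measurable_fun D (fun x => (f x ^+ 2))%R by exact: measurable_funX.
have m2 : measurable_fun D (fun x => ((f x - f_ k x) ^+ 2))%R.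
  by apply: measurable_funX; exact: measurable_funB.
apply: (@le_trans _ _ (a%:E * \int[mu]_(x in D) (f x ^+ 2)%:E
    + b%:E * \int[mu]_(x in D) ((f x - f_ k x) ^+ 2)%:E)).
  apply: ge0_integral_le_lin => //.
  - apply: measurableT_comp => //.
    by apply: measurable_funB => //; exact: measurable_funX.
  - exact: ltW.
  - exact: ltW.
  - by move=> x; exact: sqr_ge0.
  - by move=> x; exact: sqr_ge0.
  - move=> x.
    have h : (2 * `|f x| * `|f x - f_ k x| <= a * f x ^+ 2 + a^-1 * (f x - f_ k x) ^+ 2)%R.
      by rewrite -(real_normK (num_real (f x))) -(real_normK (num_real (f x - f_ k x))) young_sqr.
    have -> : (f x ^+ 2 - f_ k x ^+ 2 = 2 * f x * (f x - f_ k x) - (f x - f_ k x) ^+ 2)%R by ring.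
    rewrite (le_trans (ler_normB _ _))// (ger0_norm (sqr_ge0 _)) !normrM (ger0_norm (_ : (0 <= 2)%R))//.
    by rewrite /b; move: h; lra.
apply: (@le_trans _ _ (a%:E * I%:E + b%:E * (e / 2 / b)%:E)).
  apply: leeD; last by rewrite lee_wpmul2l// lee_fin ltW.
  by rewrite /I /Rintegral fineK//; exact: integrable_fin_num.
rewrite -!EFinM -EFinD lee_fin mulrCA divff ?gt_eqF// mulr1 [leRHS]splitr lerD2r.
rewrite /a mulrAC ler_pdivrMr// ler_wpM2l ?divr_ge0 ?(ltW e0)//.
by rewrite lerDl.
Qed.

End MeanSquareLimits.

Section Steps.
Context {R : realType}.
Implicit Types (u c : nat -> R) (m : nat).

(** Gluing the partitions of consecutive intervals reduces a sum of step integrals to one, so that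
    independence of increments is used once. The free [g] serves both the integral and its
    variance. *)
Lemma step_concat n (t : nat -> R) (m : nat -> nat) (u c : nat -> nat -> R) :
  (forall i, (i < n)%N -> [/\ u i 0%N = t i, u i (m i) = t i.+1 &
     forall j, (j < m i)%N -> u i j <= u i j.+1]) ->
  exists K U (C : nat -> R), [/\ U 0%N = t 0%N, U K = t n, (forall j, (j < K)%N -> U j <= U j.+1) &
    forall g : R -> R -> R -> R,
      \sum_(j < K) g (C j) (U j) (U j.+1) =
      \sum_(i < n) \sum_(j < m i) g (c i j) (u i j) (u i j.+1)].
Proof.
elim: n => [|n IH] h.
  by exists 0%N, (fun=> t 0%N), (fun=> 0); split => // g; rewrite !big_ord0.
have [i hi|K [U [C [U0 UK mU hg]]]] := IH; first by apply: h; exact: ltnW.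
have [u0 um mu] := h n (ltnSn n).
pose V j := if (j <= K)%N then U j else u n (j - K)%N.
have VR j : V (K + j)%N = u n j.
  rewrite /V; case: j => [|j]; first by rewrite addn0 leqnn UK u0.
  by rewrite addKn addnS ltnNge leq_addr.
have VL j : (j <= K)%N -> V j = U j by rewrite /V => ->.
exists (K + m n)%N, V, (fun j => if (j < K)%N then C j else c n (j - K)%N); split.
- by rewrite VL.
- by rewrite VR.
- move=> j jK; case: (ltnP j K) => hj.
    by rewrite !VL//; [exact: mU|exact: ltnW].
  by rewrite -(subnKC hj) -addnS !VR; apply: mu; rewrite ltn_subLR.
- move=> g; rewrite big_split_ord/= big_ord_recr/= -hg; congr (_ + _).
    by apply: eq_bigr => j _; rewrite ltn_ord !VL// ltnW.
  by apply: eq_bigr => j _; rewrite ltnNge leq_addr/= addKn -addnS !VR.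
Qed.

Lemma step_mono m u : (forall j, (j < m)%N -> u j <= u j.+1) ->
  forall i j, (i <= j <= m)%N -> u i <= u j.
Proof.
move=> mu i j /andP[]; elim: j => [|j IH]; first by rewrite leqn0 => /eqP->.
rewrite leq_eqVlt => /orP[/eqP->//|ij jm].
by apply: le_trans (mu _ jm); apply: IH => //; exact: ltnW.
Qed.

Lemma step_fun_right m u c s : (forall j, (j < m)%N -> u j <= u j.+1) ->
  u m < s -> step_fun m u c s = 0.
Proof.
move=> mu us; rewrite /step_fun big1// => j _.
rewrite indicE memNset ?mulr0//= in_itv/= => /andP[_].
by apply/negP; rewrite -ltNge (le_lt_trans _ us)// (step_mono mu)// leqnn andbT.
Qed.

(** The half-open intervals are disjoint, so there are no cross terms; with the next integral
    formula this is the isometry for step functions. *)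
Lemma step_fun_sqr m u c s : (forall j, (j < m)%N -> u j <= u j.+1) ->
  step_fun m u c s ^+ 2 = \sum_(j < m) c j ^+ 2 * \1_(`]u j, u j.+1]) s.
Proof.
elim: m => [|m IH] mu; first by rewrite /step_fun !big_ord0 expr0n.
have mu' j : (j < m)%N -> u j <= u j.+1 by move=> jm; apply: mu; exact: ltnW.
rewrite big_ord_recr/= -IH// /step_fun big_ord_recr/= -/(step_fun m u c s).
have [|us] := boolP (s \in `]u m, u m.+1]%classic); last first.
  by rewrite indicE (negbTE us) !mulr0 !addr0.
move=> us; rewrite indicE us !mulr1; move: us; rewrite inE/= in_itv/= => /andP[us _].
by rewrite (step_fun_right _ mu')// !add0r expr0n add0r.
Qed.

Lemma measurable_step_fun m u c (D : set R) : measurable_fun D (step_fun m u c).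
Proof.
by apply: measurable_sum => j; exact: measurable_funM.
Qed.

Lemma step_fun_sqr_integral m u c : (forall j, (j < m)%N -> u j <= u j.+1) ->
  (\int[lebesgue_measure]_(s in `[u 0%N, u m]) (step_fun m u c s ^+ 2)%:E =
   (\sum_(j < m) c j ^+ 2 * (u j.+1 - u j))%:E)%E.
Proof.
move=> mu; under eq_integral do rewrite step_fun_sqr// -sumEFin.
rewrite ge0_integral_sum//; first last.
- by move=> j s _; rewrite lee_fin mulr_ge0// sqr_ge0.
- by move=> j; apply/measurable_EFinP; apply: measurable_funM => //; exact: measurable_indic.
rewrite -sumEFin; apply: eq_bigr => j _.
under eq_integral do rewrite EFinM.
rewrite ge0_integralZl//; last 2 first.
- by apply/measurable_EFinP; exact: measurable_indic.
- by rewrite lee_fin sqr_ge0.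
rewrite integral_indic// [RHS]EFinM; congr (mule _ _).
rewrite (@setIidl _ _ `[u 0%N, u m]%classic).
  apply: (etrans (lebesgue_measure_itv _)); rewrite /= lte_fin.
  case: ifPn => h; first by rewrite -EFinD.
  have -> : u j.+1 = u j by apply/eqP; rewrite eq_le leNgt h mu.
  by rewrite subrr.
move=> s /=; rewrite !in_itv/= => /andP[h1 h2]; apply/andP; split.
  by rewrite (le_trans _ (ltW h1))// (step_mono mu)// leq0n/= ltnW.
by rewrite (le_trans h2)// (step_mono mu)// leqnn andbT.
Qed.

End Steps.

Lemma eq_law_Rintegral d1 d2 (T1 : measurableType d1) (T2 : measurableType d2) (R : realType)
    (P : probability T1 R) (Z : T1 -> T2) (Q : probability T2 R) (g : T2 -> R) (M : R) :
  measurable_fun [set: T1] Z -> measurable_fun [set: T2] g -> (forall x, `|g x| <= M) ->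
  (forall A, measurable A -> P (Z @^-1` A) = Q A) ->
  \int[P]_w g (Z w) = \int[Q]_y g y.
Proof.
move=> mZ mg gM h; pose ZZ : {mfun T1 >-> T2} := mfun_Sub (mem_set mZ).
rewrite /Rintegral; congr fine.
transitivity (\int[distribution P ZZ]_y (EFin \o g) y)%E.
  rewrite integral_distribution//; first exact/measurable_EFinP.
  apply: (@integrable_bounded _ _ R P (g \o Z) M) => [|w]; last exact: gM.
  exact: (measurableT_comp mg).
by apply: eq_measure_integral => A mA _; exact: h.
Qed.

Lemma Rintegral_dirac d (T : measurableType d) (R : realType) (a : T) (g : T -> R) :
  measurable_fun [set: T] g -> \int[\d_a]_x g x = g a.
Proof.
move=> mg; rewrite /Rintegral integral_dirac//; last exact/measurable_EFinP.
by rewrite diracT mul1e.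
Qed.

Section IncrementsLaw.
Context {R : realType} {dO : measure_display} {Om : measurableType dO}.
Variables (P : probability Om R) (W : R -> Om -> R) (X0 : {mfun Om >-> R}).
Hypotheses (wW : wiener_process P W) (iW : independent_of_process P X0 W).
Local Notation RR := (measurableTypeR R).

Fact measurable_initial : measurable_fun [set: Om] (X0 : Om -> RR).
Proof. exact: (measurable_funPT X0). Qed.

(* [X0] with the Borel structure that the library gives to [normal_prob]. *)
Definition initial : {mfun Om >-> RR} := @mfun_Sub _ _ Om RR _ (mem_set measurable_initial).

Definition increments k (u : nat -> R) (w : Om) : k.+1.-tuple R :=
  cons_pair (X0 w : RR, [tuple W (u i.+1) w - W (u i) w | i < k]).

(** Index 0 is the initial value. Partition points may coincide, and then the increment is zero,
    hence the Dirac mass. *)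
Definition increment_law (u : nat -> R) (i : nat) : probability RR R :=
  if i is j.+1 then
    if u j < u j.+1 then (normal_prob 0 (Num.sqrt (u j.+1 - u j)) : probability RR R)
    else (\d_(0 : RR) : probability RR R)
  else distribution P initial.

Lemma measurable_increments k u : 0 <= u 0%N -> (forall i, (i < k)%N -> u i <= u i.+1) ->
  measurable_fun [set: Om] (increments k u).
Proof.
move=> u0 mu.
have up i : (i <= k)%N -> 0 <= u i.
  by move=> ik; rewrite (le_trans u0)// (step_mono mu)// leq0n.
apply/measurable_fun_tnthP => i; rewrite /increments.
case: (unliftP ord0 i) => [j ->|->].
  rewrite (_ : _ \o _ = fun w => W (u j.+1) w - W (u j) w); last first.
    by apply/funext => w /=; rewrite (tnthS _ _ j) tnth_mktuple.
  by apply: measurable_funB; apply: (wiener_meas wW); apply: up => //; exact: ltnW.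
rewrite (_ : _ \o _ = X0)//.
Qed.

Lemma increments_law k u : 0 <= u 0%N -> (forall i, (i < k)%N -> u i <= u i.+1) ->
  forall A, measurable A -> P (increments k u @^-1` A) = tprod (increment_law u) k.+1 A.
Proof.
move=> u0 mu.
have up i : (i <= k)%N -> 0 <= u i.
  by move=> ik; rewrite (le_trans u0)// (step_mono mu)// leq0n.
have mZ := measurable_increments u0 mu.
pose Z : {mfun Om >-> k.+1.-tuple R} := mfun_Sub (mem_set mZ).
suff h U : (forall i, measurable (U i)) ->
    (distribution P Z (rect U) = \prod_(i < k.+1) increment_law u i (U i))%E.
  by move=> A mA; rewrite -(tprod_unique h mA).
move=> mU; rewrite /distribution /pushforward.
pose E : set Om := \bigcap_(i in [set: 'I_k])
  ((fun w => W (u i.+1) w - W (u i) w) @^-1` U i.+1).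
have -> : Z @^-1` rect U = X0 @^-1` U 0%N `&` E.
  apply/seteqP; split => [w h|w [h0 h] i].
    split; first exact: (h ord0).
    by move=> i _; have := h (lift ord0 i); rewrite /Z/= /increments tnthS tnth_mktuple.
  rewrite /Z/= /increments; case: (unliftP ord0 i) => [j ->|->//].
  by rewrite tnthS tnth_mktuple; exact: h.
(* Independence from [W] concerns events of the sigma-algebra generated by the [W s], so [E] has to
   be measurable for that one. *)
rewrite iW//; last first.
  set G := [set F | _].
  have mW s : 0 <= s -> measurable_fun [set: g_sigma_algebraType G] (W s).
    move=> s0 _ V mV; rewrite setTI; apply: sub_sigma_algebra.
    by exists s => //; exists V.
  have mE : measurable (E : set (g_sigma_algebraType G)).
    apply: fin_bigcap_measurable => // i _; rewrite -[X in measurable X]setTI.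
    have mB : measurable_fun [set: g_sigma_algebraType G] (fun w => W (u i.+1) w - W (u i) w).
      by apply: measurable_funB; apply: mW; apply: up => //; exact: ltnW.
    by apply: mB.
  exact: mE.
rewrite big_ord_recl; congr (_ * _)%E.
rewrite (wiener_indep wW u0 mu); last by move=> i; exact: mU.
apply: eq_bigr => i _ /=; case: ifPn => h.
  by rewrite (wiener_normal wW)//; apply: up; exact: ltnW.
have -> : u i.+1 = u i.
  by apply/eqP; rewrite eq_le leNgt h mu.
under [X in P (X @^-1` _)]eq_fun do rewrite subrr.
rewrite [RHS](_ : _ = ((0 : R) \in U i.+1)%:R%:E); last exact: diracE.
have [h0|h0] := boolP (0 \in U i.+1).
  rewrite (_ : _ @^-1` _ = setT) ?probability_setT//.
  by apply/seteqP; split => // w _ /=; exact: set_mem.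
rewrite (_ : _ @^-1` _ = set0) ?measure0//.
by apply/seteqP; split => // w /= /mem_set; rewrite (negbTE h0).
Qed.

(** For centred normal terms the errors in [tprod_cos] are zero, which makes the estimate an
    identity. *)
Lemma increments_cos k u c e v : 0 <= u 0%N -> (forall i, (i < k)%N -> u i <= u i.+1) ->
  \int[P]_w cos (e + v * X0 w + step_integral W k u c w) =
  (\int[P]_w cos (e + v * X0 w)) * expR (- ((\sum_(j < k) c j ^+ 2 * (u j.+1 - u j)) / 2)).
Proof.
move=> u0 mu.
have mZ := measurable_increments u0 mu.
pose Z : {mfun Om >-> k.+1.-tuple R} := mfun_Sub (mem_set mZ).
pose cc i : R := if i is j.+1 then c j else v.
(* The test keeps [vv] nonnegative for every index, also beyond [k], where [u] need not be
   monotone. *)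
pose vv i : R := if (u i < u i.+1) then c i ^+ 2 * (u i.+1 - u i) else 0.
pose g (y : k.+1.-tuple R) : R := cos (e + coord_sum (fun i x => cc i * x) y).
have mg : measurable_fun [set: k.+1.-tuple R] g.
  apply: (measurableT_comp measurable_cos); apply: measurable_funD => //.
  by apply: measurable_coord_sum => i; exact: measurable_funM.
have gb y : `|g y| <= 1 by exact: cos_max.
have -> : \int[P]_w cos (e + v * X0 w + step_integral W k u c w) = \int[P]_w g (Z w).
  apply: eq_Rintegral => w _; rewrite /g /Z/= /increments coord_sum_cons -addrA.
  congr (cos (_ + (_ + _))); apply: eq_bigr => i _.
  by rewrite tnth_mktuple.
have -> : \int[P]_w g (Z w) = \int[tprod (increment_law u) k.+1]_y g y.
  by apply: (eq_law_Rintegral mZ mg gb); exact: increments_law.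
rewrite (integral_tprodS _ mg gb).
have h x : \int[tprod (increment_law u \o S) k]_y g (cons_pair (x, y)) =
    cos (e + v * x) * expR (- ((\sum_(j < k) vv j) / 2)).
  apply/eqP; rewrite -subr_eq0 -normr_le0.
  apply: (@le_trans _ _ (2 * \sum_(i < k) 0)); last by rewrite big1// mulr0.
  have := @tprod_cos R (increment_law u \o S) k (fun i x => c i * x) vv (fun=> 0) (e + v * x).
  rewrite (_ : \int[_]_y _ = \int[tprod (increment_law u \o S) k]_y g (cons_pair (x, y))); last first.
    by apply: eq_Rintegral => y _; rewrite /g coord_sum_cons addrA.
  apply.
  - by move=> i; exact: measurable_funM.
  - by move=> i; rewrite /vv; case: ifPn => // h; rewrite mulr_ge0 ?sqr_ge0// subr_ge0 ltW.
  - move=> i; rewrite /vv /=; case: ifPn => h.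
      have s0 : 0 < Num.sqrt (u i.+1 - u i) by rewrite sqrtr_gt0 subr_gt0.
      have := normal_cos 0 s0 0 (c i); rewrite sqr_sqrtr ?subr_ge0 ?(ltW h)//.
      under eq_Rintegral do rewrite add0r subr0.
      by move=> ->; rewrite cos0 mul1r [_ * c i ^+ 2]mulrC subrr normr0.
    rewrite Rintegral_dirac; last by apply: (measurableT_comp measurable_cos); exact: measurable_funM.
    by rewrite mulr0 cos0 mul0r oppr0 expR0 subrr normr0.
  - move=> i /=; case: ifPn => h.
      have s0 : 0 < Num.sqrt (u i.+1 - u i) by rewrite sqrtr_gt0 subr_gt0.
      have := normal_sin 0 s0 0 (c i); under eq_Rintegral do rewrite add0r subr0.
      by move=> ->; rewrite sin0 mul0r normr0.
    rewrite Rintegral_dirac; last by apply: (measurableT_comp measurable_sin); exact: measurable_funM.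
    by rewrite mulr0 sin0 normr0.
under eq_Rintegral do rewrite h.
have mc : measurable_fun [set: RR] (fun x : RR => cos (e + v * x)).
  apply: (measurableT_comp measurable_cos); exact: measurable_funD.
rewrite RintegralZr//; last exact: (@integrable_bounded _ _ R _ _ 1 mc (fun x => cos_max _)).
congr (_ * expR (- (_ / 2))).
  by rewrite -(@eq_law_Rintegral _ _ Om RR R P X0 _ _ 1 measurable_initial mc (fun x => cos_max _)).
apply: eq_bigr => j _; rewrite /vv; case: ifPn => // h'.
have -> : u j.+1 = u j by apply/eqP; rewrite eq_le leNgt h' mu.
by rewrite subrr mulr0.
Qed.

End IncrementsLaw.

Section WienerIntegrals.
Context {R : realType} {dO : measure_display} {Om : measurableType dO}.
Variables (P : probability Om R) (W : R -> Om -> R) (X0 : {mfun Om >-> R}).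
Hypotheses (wW : wiener_process P W) (iW : independent_of_process P X0 W).

Lemma measurable_step_integral m u c : 0 <= u 0%N ->
  (forall j, (j < m)%N -> u j <= u j.+1) ->
  measurable_fun [set: Om] (step_integral W m u c).
Proof.
move=> u0 mu; apply: measurable_sum => j; apply: measurable_funM => //.
by apply: measurable_funB; apply: (wiener_meas wW);
  rewrite (le_trans u0)// (step_mono mu)//= ltnW.
Qed.

(** The identity for step integrals passes to the limit: on the left through mean-square
    convergence, on the right because the squared norms of the step functions converge to that of
    [g]. *)
Lemma wiener_integrals_cos n (t : nat -> R) (g : R -> R) (I : nat -> Om -> R) (a : nat -> R) (e v : R) :
  0 <= t 0%N -> (forall i, (i < n)%N -> t i <= t i.+1) ->
  (forall i, (i < n)%N -> measurable_fun [set: Om] (I i)) ->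
  (forall i, (i < n)%N -> measurable_fun `[t i, t i.+1] g) ->
  (forall i, (i < n)%N ->
     lebesgue_measure.-integrable `[t i, t i.+1] (EFin \o (fun s => g s ^+ 2))) ->
  (forall i, (i < n)%N -> is_wiener_integral P W (t i) (t i.+1) g (I i)) ->
  \int[P]_w cos (e + v * X0 w + \sum_(i < n) a i * I i w) =
  (\int[P]_w cos (e + v * X0 w)) *
  expR (- ((\sum_(i < n) a i ^+ 2 * \int[lebesgue_measure]_(s in `[t i, t i.+1]) (g s ^+ 2)) / 2)).
Proof.
move=> t0 mt mI mg ig wI.
have tp i : (i <= n)%N -> 0 <= t i.
  by move=> ik; rewrite (le_trans t0)// (step_mono mt).
have /choice[m /choice[u /choice[c h]]] i : exists (m : nat -> nat) (u c : nat -> nat -> R), (i < n)%N ->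
    [/\ forall k, [/\ u k 0%N = t i, u k (m k) = t i.+1 &
          forall j, (j < m k)%N -> u k j <= u k j.+1],
        cvg_L2 lebesgue_measure `[t i, t i.+1] (fun k => step_fun (m k) (u k) (c k)) g &
        cvg_L2 P setT (fun k => step_integral W (m k) (u k) (c k)) (I i)].
  have [i_lt|] := boolP (i < n)%N; last by exists (fun=> 0%N), (fun _ _ => 0), (fun _ _ => 0).
  by have [m [u [c hc]]] := wI i i_lt; exists m, u, c.
pose S i k := step_integral W (m i k) (u i k) (c i k).
have mS i k : (i < n)%N -> measurable_fun [set: Om] (S i k).
  move=> i_lt; have [/(_ k)[u0 _ mu] _ _] := h i i_lt.
  by apply: measurable_step_integral => //; rewrite u0 tp// ltnW.
have mX : measurable_fun [set: Om] (fun w => e + v * X0 w).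
  by apply: measurable_funD => //; exact: measurable_funM.
have c1 : \int[P]_w cos (e + v * X0 w + \sum_(i < n) a i * S i k w) @[k --> \oo] -->
    \int[P]_w cos (e + v * X0 w + \sum_(i < n) a i * I i w).
  apply: (@cvg_L2_cos _ Om R P (fun k w => e + v * X0 w + \sum_(i < n) a i * S i k w)).
  - move=> k; apply: measurable_funD => //; apply: measurable_sum => i; apply: measurable_funM => //.
    exact: mS.
  - by apply: measurable_funD => //; apply: measurable_sum => i; apply: measurable_funM => //; exact: mI.
  apply: cvg_L2D => //.
  - move=> k; apply: measurable_sum => i; apply: measurable_funM => //; exact: mS.
  - by apply: measurable_sum => i; apply: measurable_funM => //; exact: mI.
  - exact: cvg_L2_cst.
  apply: (@cvg_L2_sum _ Om R P setT n (fun i k w => a i * S i k w) (fun i w => a i * I i w)) => //.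
  - by move=> i k i_lt; apply: measurable_funM => //; exact: mS.
  - by move=> i i_lt; apply: measurable_funM => //; exact: mI.
  - move=> i i_lt; apply: cvg_L2Z => //; [by move=> k; exact: mS|exact: mI|].
    by have [_ _] := h i i_lt.
have c2 i : (i < n)%N -> \sum_(j < m i k) c i k j ^+ 2 * (u i k j.+1 - u i k j) @[k --> \oo] -->
    \int[lebesgue_measure]_(s in `[t i, t i.+1]) (g s ^+ 2).
  move=> i_lt; have [hu hL _] := h i i_lt.
  have hi k : (\int[lebesgue_measure]_(s in `[t i, t i.+1])
      (step_fun (m i k) (u i k) (c i k) s ^+ 2)%:E =
      (\sum_(j < m i k) c i k j ^+ 2 * (u i k j.+1 - u i k j))%:E)%E.
    by have [<- <- mu] := hu k; exact: step_fun_sqr_integral.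
  rewrite (_ : (fun k => _) = fun k =>
    \int[lebesgue_measure]_(s in `[t i, t i.+1]) (step_fun (m i k) (u i k) (c i k) s ^+ 2)); last first.
    by apply/funext => k; rewrite /Rintegral hi.
  apply: (@cvg_L2_sqr _ _ R lebesgue_measure `[t i, t i.+1]
     (fun k => step_fun (m i k) (u i k) (c i k)) g) => //.
  - move=> k; exact: measurable_step_fun.
  - exact: mg.
  - move=> k; apply/integrableP; split.
      by apply/measurable_EFinP; apply: measurable_funX; exact: measurable_step_fun.
    rewrite [X in (X < _)%E](_ : _ =
        (\sum_(j < m i k) c i k j ^+ 2 * (u i k j.+1 - u i k j))%:E) ?ltry// -hi.
    by apply: eq_integral => s _ /=; rewrite ger0_norm// sqr_ge0.
  - exact: ig.
apply: (cvg_unique _ c1) => //.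
have -> : (fun k => \int[P]_w cos (e + v * X0 w + \sum_(i < n) a i * S i k w)) =
  (fun k => (\int[P]_w cos (e + v * X0 w)) *
    expR (- ((\sum_(i < n) a i ^+ 2 * \sum_(j < m i k) c i k j ^+ 2 * (u i k j.+1 - u i k j)) / 2))).
  apply/funext => k.
  (* With the scalars [a i] absorbed in the steps, the linear combination is a single step
     integral. *)
  have [i i_lt|K [U [C [U0 UK mU hU]]]] := @step_concat R n t (m ^~ k) (u ^~ k) (fun i j => a i * c i k j).
    by have [/(_ k)] := h i i_lt.
  transitivity (\int[P]_w cos (e + v * X0 w + step_integral W K U C w)).
    apply: eq_Rintegral => w _; congr (cos (_ + _)).
    rewrite /step_integral (hU (fun x y z => x * (W z w - W y w))); apply: eq_bigr => i _.
    by rewrite mulr_sumr; apply: eq_bigr => j _; rewrite mulrA.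
  rewrite increments_cos ?U0//; congr (_ * expR (- (_ / 2))).
  rewrite (hU (fun x y z => x ^+ 2 * (z - y))); apply: eq_bigr => i _.
  by rewrite mulr_sumr; apply: eq_bigr => j _; rewrite exprMn mulrA.
apply: cvgMl_tmp; apply: continuous_cvg; first exact: continuous_expR.
apply: cvgN; apply: cvgMr_tmp; apply: cvg_sumr => i; apply: cvgMl_tmp; exact: c2.
Qed.

(** Both laws on tuples have the same real characteristic function, so [chf_unique] identifies
    them. *)
Lemma wiener_integrals_law n (t : nat -> R) (b g : R -> R) (X : R -> {mfun Om >-> R})
    (Z : Om -> n.+1.-tuple R) (mu : nat -> probability (measurableTypeR R) R) :
  0 <= t 0%N -> (forall i, (i < n)%N -> t i <= t i.+1) ->
  (forall i, (i < n)%N -> measurable_fun `[t i, t i.+1] g) ->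
  (forall i, (i < n)%N ->
     lebesgue_measure.-integrable `[t i, t i.+1] (EFin \o (fun s => g s ^+ 2))) ->
  solves_sde P W (fun s => X s) b g ->
  measurable_fun [set: Om] Z ->
  (forall w, tnth (Z w) ord0 = X0 w) ->
  (forall w (i : 'I_n), tnth (Z w) (lift ord0 i) = X (t i.+1) w - X (t i) w) ->
  (forall U, measurable U -> mu 0%N U = P (X0 @^-1` U)) ->
  (forall i, (i < n)%N -> 0 < \int[lebesgue_measure]_(s in `[t i, t i.+1]) (g s ^+ 2)) ->
  (forall i, (i < n)%N -> mu i.+1 = normal_prob (\int[lebesgue_measure]_(s in `[t i, t i.+1]) b s)
    (Num.sqrt (\int[lebesgue_measure]_(s in `[t i, t i.+1]) (g s ^+ 2)))) ->
  forall A, measurable A -> P (Z @^-1` A) = tprod mu n.+1 A.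
Proof.
move=> t0 mt mg ig sde mZ Z0 ZS mu0 g0 muS A mA.
have tp i : (i <= n)%N -> 0 <= t i.
  by move=> ik; rewrite (le_trans t0)// (step_mono mt).
pose F i : R := \int[lebesgue_measure]_(s in `[t i, t i.+1]) b s.
pose V i : R := \int[lebesgue_measure]_(s in `[t i, t i.+1]) (g s ^+ 2).
have mid : measurable_fun [set: n.+1.-tuple R] (@idfun (n.+1.-tuple R)) by exact: measurable_id.
apply: (chf_unique (P := P) (Q := tprod mu n.+1) (Z := Z) (Z' := idfun)) => // c u.
pose a i : R := if (i < n)%N then u 0 (inord i.+1) else 0.
have dE (y : n.+1.-tuple R) : dotr u (row_of_tuple y) =
    u 0 ord0 * tnth y ord0 + \sum_(i < n) a i * tnth y (lift ord0 i).
  rewrite dotrE big_ord_recl !mxE; congr (_ + _); apply: eq_bigr => i _.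
  by rewrite mxE /a ltn_ord; congr (u 0 _ * _); apply: val_inj; rewrite /= inordK// ltnS ltn_ord.
(* The drift integrals are deterministic and only shift the phase. *)
pose c' : R := c + \sum_(i < n) a i * F i.
transitivity ((\int[P]_w cos (c' + u 0 ord0 * X0 w)) * expR (- ((\sum_(i < n) a i ^+ 2 * V i) / 2))).
  rewrite -(@wiener_integrals_cos n t g (fun i w => X (t i.+1) w - X (t i) w - F i))//.
  - apply: eq_Rintegral => w _; rewrite dE Z0; congr cos.
    have -> : \sum_(i < n) a i * tnth (Z w) (lift ord0 i) = \sum_(i < n) a i * F i +
        \sum_(i < n) a i * (X (t i.+1) w - X (t i) w - F i).
      by rewrite -big_split/=; apply: eq_bigr => i _; rewrite ZS; ring.
    by rewrite /c'; ring.
  - by move=> i _; apply: measurable_funB => //; exact: measurable_funB.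
  - by move=> i i_lt; apply: sde; [rewrite tp// ltnW|exact: mt].
pose G (y : n.+1.-tuple R) : R := cos (c + dotr u (row_of_tuple y)).
have mG : measurable_fun [set: n.+1.-tuple R] G.
  apply: (measurableT_comp measurable_cos); apply: measurable_funD => //.
  rewrite (_ : (fun y => _) = fun y : n.+1.-tuple R =>
    u 0 ord0 * tnth y ord0 + \sum_(i < n) a i * tnth y (lift ord0 i)); last exact/funext.
  apply: measurable_funD; first by apply: measurable_funM => //; exact: measurable_tnth.
  by apply: measurable_sum => i; apply: measurable_funM => //; exact: measurable_tnth.
rewrite -[RHS]/(\int[tprod mu n.+1]_y G y) (integral_tprodS _ mG (fun y => cos_max _)).
have h x : \int[tprod (mu \o S) n]_y G (cons_pair (x, y)) =
    cos (c' + u 0 ord0 * x) * expR (- ((\sum_(i < n) a i ^+ 2 * V i) / 2)).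
  pose z i (y : R) : R := if (i < n)%N then a i * (y - F i) else 0.
  pose v i : R := if (i < n)%N then a i ^+ 2 * V i else 0.
  have -> : \sum_(i < n) a i ^+ 2 * V i = \sum_(i < n) v i.
    by apply: eq_bigr => i _; rewrite /v ltn_ord.
  have -> : \int[tprod (mu \o S) n]_y G (cons_pair (x, y)) =
      \int[tprod (mu \o S) n]_y cos (c' + u 0 ord0 * x + coord_sum z y).
    apply: eq_Rintegral => y _; rewrite /G dE; congr cos.
    have -> : \sum_(i < n) a i * tnth (cons_pair (x, y)) (lift ord0 i) =
        \sum_(i < n) a i * F i + coord_sum z y.
      by rewrite /coord_sum -big_split/=; apply: eq_bigr => i _; rewrite /z ltn_ord tnthS; ring.
    have -> : tnth (cons_pair (x, y)) ord0 = x by [].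
    by rewrite /c'; ring.
  apply/eqP; rewrite -subr_eq0 -normr_le0.
  apply: (@le_trans _ _ (2 * \sum_(i < n) 0)); last by rewrite big1// mulr0.
  apply: (@tprod_cos R (mu \o S) n z v (fun=> 0)).
  - move=> i; rewrite /z; have [_|_] := boolP (i < n)%N; last exact: measurable_cst.
    by apply: measurable_funM => //; exact: measurable_funB.
  - by move=> i; rewrite /v; case: ifP => // h; rewrite mulr_ge0 ?sqr_ge0// ltW// g0.
  - move=> i; rewrite /z /v /=; have [h|h] := boolP (i < n)%N; last first.
      under eq_Rintegral do rewrite cos0.
      by rewrite Rintegral_prob_cst mul0r oppr0 expR0 subrr normr0.
    have s0 : 0 < Num.sqrt (V i) by rewrite sqrtr_gt0 g0.
    have := normal_cos (F i) s0 0 (a i); rewrite sqr_sqrtr ?(ltW (g0 _ h))//.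
    under eq_Rintegral do rewrite add0r.
    by rewrite muS// => ->; rewrite cos0 mul1r [_ * a i ^+ 2]mulrC subrr normr0.
  - move=> i; rewrite /z /=; have [h|h] := boolP (i < n)%N; last first.
      under eq_Rintegral do rewrite sin0.
      by rewrite Rintegral_prob_cst normr0.
    have s0 : 0 < Num.sqrt (V i) by rewrite sqrtr_gt0 g0.
    have := normal_sin (F i) s0 0 (a i); under eq_Rintegral do rewrite add0r.
    by rewrite muS// => ->; rewrite sin0 mul0r normr0.
under [RHS]eq_Rintegral do rewrite h.
have mc : measurable_fun [set: measurableTypeR R] (fun x : measurableTypeR R => cos (c' + u 0 ord0 * x)).
  by apply: (measurableT_comp measurable_cos); exact: measurable_funD.
rewrite RintegralZr//; last exact: (@integrable_bounded _ _ R _ _ 1 mc (fun x => cos_max _)).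
congr (_ * _).
rewrite -(@eq_law_Rintegral _ _ Om (measurableTypeR R) R P X0 (mu 0%N) _ 1 (measurable_initial X0) mc (fun x => cos_max _))//.
by move=> U mU; rewrite mu0.
Qed.

End WienerIntegrals.

(** * Integrals depending on a parameter *)

Section SegmentCalculus.
Context {R : realType} {k : nat}.
Variable D : set 'rV[R]_k.
Hypotheses (oD : open D) (cD : convex_set D).

Lemma segment_convex a a' (x : R) : D a -> D a' -> 0 <= x <= 1 -> D (a + x *: (a' - a)).
Proof.
move=> Da Da' /andP[x0 x1].
have := cD (Itv01 x0 x1) (mem_set Da') (mem_set Da); move/set_mem.
rewrite -[X in D X -> _]/(x *: a' + (1 - x) *: a).
by rewrite scalerBr scalerBl scale1r addrCA.
Qed.

Lemma derive_dotr (h : 'rV[R]_k -> R) a v : differentiable h a -> 'D_v h a = dotr v (grad h a).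
Proof.
move=> dh; rewrite deriveE// {1}(row_sum_delta v) linear_sum dotrE; apply: eq_bigr => i _.
by rewrite linearZ/= mxE deriveE.
Qed.

Lemma line_derive (h : 'rV[R]_k -> R) a v (x : R) : differentiable h (a + x *: v) ->
  is_derive x 1 (fun y : R => h (a + y *: v)) ('D_v h (a + x *: v)).
Proof.
move=> dh; have e : (fun y : R => y^-1 *: (((fun y : R => h (a + y *: v)) \o shift x) (y *: 1) - h (a + x *: v))) =
    (fun y : R => y^-1 *: ((h \o shift (a + x *: v)) (y *: v) - h (a + x *: v))).
  apply/funext => y; congr (_ *: (h _ - _)) => /=.
  by rewrite scalerDl addrCA /GRing.scale/= mulr1.
apply: DeriveDef; last by rewrite /derive e.
rewrite /derivable e; exact: (@diff_derivable _ _ _ h _ v dh).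
Qed.

Lemma segment_MVT (h : 'rV[R]_k -> R) a a' : (forall c, D c -> differentiable h c) ->
  D a -> D a' -> exists2 x : R, 0 <= x <= 1 &
  h a' - h a = dotr (a' - a) (grad h (a + x *: (a' - a))).
Proof.
move=> dh Da Da'.
have dx (x : R) : 0 <= x <= 1 -> is_derive x 1 (fun y : R => h (a + y *: (a' - a))) ('D_(a' - a) h (a + x *: (a' - a))).
  by move=> x01; apply: line_derive; apply: dh; exact: segment_convex.
have [||c c01] := @MVT_segment R (fun y : R => h (a + y *: (a' - a)))
  (fun x => 'D_(a' - a) h (a + x *: (a' - a))) 0 1 ler01.
- by move=> x; rewrite in_itv/= => /andP[x0 x1]; apply: dx; rewrite !ltW.
- apply: derivable_within_continuous => x; rewrite in_itv/= => x01.
  by have [] := dx x x01.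
rewrite in_itv/= in c01; rewrite subr0 mulr1 scale1r scale0r addr0 [a + (_ - _)]addrC subrK => e.
exists c => //; rewrite e derive_dotr//; apply: dh; exact: segment_convex.
Qed.

(** The gradient at the intermediate point differs from that at [a] by at most [gamma], because the
    segment stays within [eta] of [a]. *)
Lemma segment_taylor (h : 'rV[R]_k -> R) (a a' : 'rV[R]_k) (eta gamma : R) :
  (forall c, D c -> differentiable h c) ->
  (forall c, D c -> enorm (c - a) <= eta -> enorm (grad h c - grad h a) <= gamma) ->
  D a -> D a' -> enorm (a' - a) <= eta ->
  `|h a' - h a - dotr (a' - a) (grad h a)| <= gamma * enorm (a' - a).
Proof.
move=> dh uh Da Da' aa'.
have [x x01 ->] := segment_MVT dh Da Da'; rewrite -dotrBr.
rewrite (le_trans (norm_dotr_le _ _))// mulrC ler_wpM2r ?enorm_ge0//.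
apply: uh; first exact: segment_convex.
rewrite addrAC subrr add0r enormZ; case/andP: x01 => x0 x1.
by rewrite ger0_norm// (le_trans _ aa')// ler_piMl// enorm_ge0.
Qed.

Lemma near_line (a v : 'rV[R]_k) : D a -> \forall x \near (0 : R), D (a + x *: v).
Proof.
move=> Da; have c : a + x *: v @[x --> (0 : R)] --> a.
  rewrite -[X in _ --> X]addr0 -[in X in _ --> X](scale0r v).
  by apply: cvgD; [exact: cvg_cst|apply: cvgZr_tmp; exact: cvg_id].
by apply: c; exact: oD.
Qed.

End SegmentCalculus.

Lemma Rintegral_sum d (T : measurableType d) (R : realType) (mu : {measure set T -> \bar R})
    (D : set T) n (h : 'I_n -> T -> R) : measurable D ->
  (forall i, mu.-integrable D (EFin \o h i)) ->
  \int[mu]_(x in D) (\sum_(i < n) h i x) = \sum_(i < n) \int[mu]_(x in D) h i x.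
Proof.
move=> mD ih; rewrite /Rintegral; under eq_integral do rewrite -sumEFin.
by rewrite integral_sum// -sum_fine// => i _; exact: (integrable_fin_num mD (ih i)).
Qed.

Section IntervalIntegrals.
Context {R : realType} (t0 t1 : R).
Hypothesis t01 : t0 <= t1.
Local Notation mu := lebesgue_measure.

Lemma integrable_itv_bounded (h : R -> R) (C : R) : measurable_fun `[t0, t1] h ->
  (forall s, s \in `[t0, t1] -> `|h s| <= C) ->
  mu.-integrable `[t0, t1] (EFin \o h).
Proof.
move=> mh hC; apply: measurable_bounded_integrable => //.
  by rewrite /= lebesgue_measure_itv/=; case: ifP => // _; rewrite -EFinD ltry.
by exists C; split; [exact: num_real|move=> x Cx s st; apply: le_trans (ltW Cx); exact: hC].
Qed.

Lemma Rintegral_itv_cst (C : R) : \int[mu]_(s in `[t0, t1]) C = C * (t1 - t0).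
Proof.
rewrite Rintegral_cst//= lebesgue_measure_itv/= lte_fin; case: ifPn => // h.
have -> : t1 = t0 by apply/eqP; rewrite eq_le t01 leNgt h.
by rewrite subrr.
Qed.

Lemma integrable_itv_cst (C : R) : mu.-integrable `[t0, t1] (EFin \o (fun=> C)).
Proof. by apply: (@integrable_itv_bounded _ `|C|). Qed.

Lemma Rintegral_itv_ge (h : R -> R) (C : R) : mu.-integrable `[t0, t1] (EFin \o h) ->
  (forall s, s \in `[t0, t1] -> C <= h s) -> C * (t1 - t0) <= \int[mu]_(s in `[t0, t1]) h s.
Proof.
by move=> ih hC; rewrite -Rintegral_itv_cst; apply: le_Rintegral => //; exact: integrable_itv_cst.
Qed.

Lemma Rintegral_itv_le (h : R -> R) (C : R) : mu.-integrable `[t0, t1] (EFin \o h) ->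
  (forall s, s \in `[t0, t1] -> h s <= C) -> \int[mu]_(s in `[t0, t1]) h s <= C * (t1 - t0).
Proof.
by move=> ih hC; rewrite -Rintegral_itv_cst; apply: le_Rintegral => //; exact: integrable_itv_cst.
Qed.

Lemma Rintegral_itv_norm_le (h : R -> R) (C : R) : mu.-integrable `[t0, t1] (EFin \o h) ->
  (forall s, s \in `[t0, t1] -> `|h s| <= C) -> `|\int[mu]_(s in `[t0, t1]) h s| <= C * (t1 - t0).
Proof.
move=> ih hC; apply: (le_trans (le_normr_Rintegral _ ih)) => //.
by apply: Rintegral_itv_le => //; exact: (integrable_abse ih).
Qed.

End IntervalIntegrals.

Section ParametricIntegral.
Context {R : realType} {k : nat}.
Variables (D : set 'rV[R]_k) (g : 'rV[R]_k -> R -> R) (C t0 t1 : R).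
Hypotheses (oD : open D) (cD : convex_set D) (t01 : t0 <= t1).
Local Notation mu := lebesgue_measure.
Hypothesis dg : forall s, s \in `[t0, t1] -> forall a, D a -> differentiable (g ^~ s) a.
Hypothesis ig : forall a, D a -> mu.-integrable `[t0, t1] (EFin \o g a).
Hypothesis gC : forall a s, D a -> s \in `[t0, t1] -> enorm (grad (g ^~ s) a) <= C.

Definition equicontinuous_grad (eta gamma : R) := forall a a', D a -> D a' ->
  enorm (a - a') <= eta -> forall s, s \in `[t0, t1] ->
  enorm (grad (g ^~ s) a - grad (g ^~ s) a') <= gamma.

Hypothesis ug : forall gamma, 0 < gamma -> exists2 eta, 0 < eta & equicontinuous_grad eta gamma.

Let H (a : 'rV[R]_k) : R := \int[mu]_(s in `[t0, t1]) g a s.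
Let dgrad (v a : 'rV[R]_k) (s : R) : R := dotr v (grad (g ^~ s) a).

Let dgrad_le v a s : D a -> s \in `[t0, t1] -> `|dgrad v a s| <= C * enorm v.
Proof.
move=> Da st; rewrite /dgrad (le_trans (norm_dotr_le _ _))// mulrC ler_wpM2r ?enorm_ge0//.
exact: gC.
Qed.

(** The directional derivative is the limit in [s] of difference quotients of measurable functions;
    the offset [N] keeps the displaced points in the open set [D]. *)
Let measurable_dgrad v a : D a -> measurable_fun `[t0, t1] (dgrad v a).
Proof.
move=> Da.
have [N _ hN] : exists2 N, True & forall n, (N <= n)%N -> D (a + n.+1%:R^-1 *: v).
  have := @cvg_harmonic R _ (near_line oD v Da).
  by move=> [N _ hN]; exists N => // n /hN.
pose q n s := (N + n).+1%:R * (g (a + (N + n).+1%:R^-1 *: v) s - g a s).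
apply: (@measurable_fun_cvg _ _ _ _ q).
  move=> n; apply: measurable_funM => //; apply: measurable_funB.
    by apply/measurable_EFinP; apply: measurable_int (ig _); apply: hN; exact: leq_addr.
  by apply/measurable_EFinP; exact: measurable_int (ig Da).
move=> s st; rewrite /dgrad -derive_dotr; last exact: dg.
have := @diff_derivable _ _ _ (g ^~ s) a v (dg st Da); rewrite /derivable => cd.
have h0 : (N + n).+1%:R^-1 @[n --> \oo] --> (0 : R)^'.
  move=> A hA; have [M _ hM] := @cvg_harmonic R _ hA.
  exists M => // n Mn /=; apply: (hM (N + n)%N); last by rewrite invr_eq0 pnatr_eq0.
  by rewrite /= (leq_trans Mn)// leq_addl.
have := cvg_comp _ _ h0 cd; apply: cvg_trans; apply: near_eq_cvg; apply: nearW => n /=.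
by rewrite invrK /q/= [_ + a]addrC.
Qed.

Let integrable_dgrad v a : D a -> mu.-integrable `[t0, t1] (EFin \o dgrad v a).
Proof.
move=> Da; apply: (@integrable_itv_bounded _ _ _ _ (C * enorm v)).
  exact: measurable_dgrad.
by move=> s st; exact: dgrad_le.
Qed.

Let taylor eta gamma v a : equicontinuous_grad eta gamma -> D a -> D (a + v) -> enorm v <= eta ->
  `|H (a + v) - H a - \int[mu]_(s in `[t0, t1]) dgrad v a s| <= gamma * (t1 - t0) * enorm v.
Proof.
move=> ue Da Dav ve.
have i1 : mu.-integrable `[t0, t1] (EFin \o (fun s => g (a + v) s - g a s)).
  exact: (integrableB _ (ig Dav) (ig Da)).
rewrite -RintegralB//; [|exact: ig|exact: ig].
rewrite -RintegralB//; last exact: integrable_dgrad.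
rewrite mulrAC; apply: Rintegral_itv_norm_le => //.
  exact: (integrableB _ i1 (integrable_dgrad v Da)).
move=> s st; rewrite /dgrad.
have -> : dotr v (grad (g ^~ s) a) = dotr (a + v - a) (grad (g ^~ s) a).
  by rewrite addrAC subrr add0r.
have e : a + v - a = v by rewrite addrAC subrr add0r.
rewrite -[in enorm v]e; apply: (@segment_taylor _ _ _ cD _ _ _ eta) => //; last by rewrite e.
  by move=> c Dc; exact: dg.
by move=> c Dc ca; exact: ue.
Qed.

(** The Taylor remainder is uniform in [s], so its integral is still negligible with respect to the
    increment. *)
Lemma derive_Rintegral v a : D a -> is_derive a v H (\int[mu]_(s in `[t0, t1]) dgrad v a s).
Proof.
move=> Da; set l := \int[mu]_(s in `[t0, t1]) _.
have c : (fun x : R => x^-1 *: ((H \o shift a) (x *: v) - H a)) x @[x --> 0^'] --> l.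
  apply/cvgrPdist_le => e e0.
  pose z : R := (t1 - t0) * enorm v + 1.
  have z0 : 0 < z by rewrite ltr_wpDl// mulr_ge0 ?enorm_ge0// subr_ge0.
  have [eta eta0 ue] := ug (divr_gt0 e0 z0).
  near=> x.
  have x0 : x != 0 by near: x; exact: nbhs_dnbhs_neq.
  have Dx : D (a + x *: v) by near: x; apply: nbhs_dnbhs; exact: near_line.
  have xe : enorm (x *: v) <= eta.
    rewrite enormZ; apply: (@le_trans _ _ (eta / (enorm v + 1) * enorm v)).
      rewrite ler_wpM2r ?enorm_ge0//; near: x; apply: dnbhs0_le.
      by rewrite divr_gt0// ltr_wpDl// enorm_ge0.
    rewrite mulrAC ler_pdivrMr ?ltr_wpDl ?enorm_ge0// ler_wpM2l ?(ltW eta0)//.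
    by rewrite lerDl.
  have := taylor ue Da Dx xe.
  have -> : \int[mu]_(s in `[t0, t1]) dgrad (x *: v) a s = x * l.
    rewrite -RintegralZl//; last exact: integrable_dgrad.
    by apply: eq_Rintegral => s _; rewrite /dgrad dotrZl.
  rewrite enormZ => h.
  rewrite -(ler_pM2l (_ : 0 < `|x|)) ?normr_gt0// -normrM mulrBr /GRing.scale/= mulrA divff// mul1r.
  rewrite distrC (addrC (x *: v)); apply: le_trans h _.
  rewrite mulrCA ler_wpM2l// -mulrA mulrAC ler_pdivrMr// ler_wpM2l ?(ltW e0)//.
  by rewrite /z lerDl.
apply: DeriveDef; first by rewrite /derivable; apply/cvg_ex; exists l.
exact/cvg_lim.
Unshelve. all: by end_near. Qed.

Lemma dotr_grad_Rintegral v a : D a ->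
  dotr v (grad H a) = \int[mu]_(s in `[t0, t1]) dgrad v a s.
Proof.
move=> Da; rewrite dotrE.
have e i : v 0 i * grad H a 0 i = \int[mu]_(s in `[t0, t1]) (v 0 i * grad (g ^~ s) a 0 i).
  rewrite [grad H a 0 i]mxE (@derive_val _ _ _ _ _ _ _ (derive_Rintegral (delta_mx 0 i) Da)).
  rewrite -RintegralZl//; last exact: integrable_dgrad.
  apply: eq_Rintegral => s _; rewrite /dgrad dotrE (bigD1 i)//= big1 ?addr0.
    by rewrite mxE !eqxx mul1r.
  by move=> j ji; rewrite mxE eqxx (negbTE ji) mul0r.
under eq_bigr do rewrite e.
under [RHS]eq_Rintegral do rewrite /dgrad dotrE.
rewrite Rintegral_sum// => i.
rewrite (_ : (fun s => _) = dgrad (v 0 i *: delta_mx 0 i) a); first exact: integrable_dgrad.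
apply/funext => s; rewrite /dgrad dotrZl dotrE (bigD1 i)//= big1 ?addr0.
  by rewrite [delta_mx 0 i 0 i]mxE !eqxx mul1r.
by move=> j ji; rewrite mxE eqxx (negbTE ji) mul0r.
Qed.

Lemma dotr_grad_le v a : D a -> `|dotr v (grad H a)| <= C * (t1 - t0) * enorm v.
Proof.
move=> Da; rewrite dotr_grad_Rintegral// mulrAC; apply: Rintegral_itv_norm_le => //.
  exact: integrable_dgrad.
by move=> s st; exact: dgrad_le.
Qed.

Lemma dotr_grad_dist_le eta gamma v a a' : equicontinuous_grad eta gamma ->
  D a -> D a' -> enorm (a - a') <= eta ->
  `|dotr v (grad H a) - dotr v (grad H a')| <= gamma * (t1 - t0) * enorm v.
Proof.
move=> ue Da Da' aa'; rewrite !dotr_grad_Rintegral// -RintegralB//; try exact: integrable_dgrad.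
rewrite mulrAC; apply: Rintegral_itv_norm_le => //.
  exact: (integrableB _ (integrable_dgrad v Da) (integrable_dgrad v Da')).
move=> s st; rewrite /dgrad -dotrBr (le_trans (norm_dotr_le _ _))// mulrC ler_wpM2r ?enorm_ge0//.
exact: ue.
Qed.

Lemma Rintegral_taylor eta gamma a a' : equicontinuous_grad eta gamma ->
  D a -> D a' -> enorm (a' - a) <= eta ->
  `|H a' - H a - dotr (a' - a) (grad H a)| <= gamma * (t1 - t0) * enorm (a' - a).
Proof.
move=> ue Da Da' aa'; rewrite dotr_grad_Rintegral//.
have e : a' = a + (a' - a) by rewrite addrC subrK.
by rewrite {1}e; apply: (taylor ue) => //; rewrite -e.
Qed.

End ParametricIntegral.

(** * Likelihood ratios of normal laws *)

Section LikelihoodRatio.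
Context {R : realType}.
Local Notation RR := (measurableTypeR R).
Local Notation leb := (@lebesgue_measure R).

(** The derivative equals [expR (l x)] almost everywhere, by uniqueness of densities. The
    measurability is that of the chosen version, whose logarithm enters [loglik_ratio]. *)
Lemma ln_Radon_Nikodym d (T : measurableType d) (Q Q' : probability T R) (l : T -> R) :
  measurable_fun [set: T] l ->
  (forall A, measurable A -> Q' A = \int[Q]_(x in A) (expR (l x))%:E)%E ->
  measurable_fun [set: T] (fun x => ln (fine (Radon_Nikodym (charge_of_finite_measure Q') Q x))) /\
  {ae Q, forall x, ln (fine (Radon_Nikodym (charge_of_finite_measure Q') Q x)) = l x}.
Proof.
move=> ml QE; set nu := charge_of_finite_measure Q'.
have ml' : measurable_fun [set: T] (fun x => (expR (l x))%:E).
  by apply/measurable_EFinP; exact: (measurableT_comp (@measurable_expR R)).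
have dom : nu `<< Q.
  apply/null_content_dominatesP => A mA QA0; rewrite [LHS]QE//.
  by apply: null_set_integral => //; exact: measurable_funTS.
have iRN := Radon_Nikodym_integrable dom; split.
  apply: (measurableT_comp (@measurable_ln R)).
  exact: (measurableT_comp (fine_measurable measurableT) (measurable_int _ iRN)).
have : ae_eq Q setT (Radon_Nikodym nu Q) (fun x => (expR (l x))%:E).
  apply: integral_ae_eq => // E _ mE.
  by rewrite -Radon_Nikodym_integral// -QE.
by apply: filterS => x /= /(_ I) ->; rewrite /= expRK.
Qed.

(** One coordinate is exchanged at a time. The hypothesis on [rho] is about extended-valued [h]
    because it is applied to an inner integral. *)
Lemma tprod_density (mu mu' : nat -> probability RR R) (rho : nat -> R -> R) n
    (f : n.-tuple R -> R) :
  (forall i, measurable_fun [set: R] (rho i)) -> (forall i x, 0 <= rho i x) ->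
  (forall i (h : R -> \bar R), measurable_fun [set: RR] h -> (forall x, 0 <= h x)%E ->
     \int[mu' i]_x h x = \int[mu i]_x (h x * (rho i x)%:E))%E ->
  measurable_fun [set: n.-tuple R] f -> (forall y, 0 <= f y) ->
  (\int[tprod mu' n]_y (f y)%:E =
   \int[tprod mu n]_y (f y * \prod_(i < n) rho i (tnth y i))%:E)%E.
Proof.
move=> mrho rho0; elim: n mu mu' rho mrho rho0 f => [|n IH] mu mu' rho mrho rho0 f hrho mf f0.
  by apply: eq_integral => y _; rewrite big_ord0 mulr1.
have mp k (r : nat -> R -> R) : (forall i, measurable_fun [set: R] (r i)) ->
    measurable_fun [set: k.-tuple R] (fun y => \prod_(i < k) r i (tnth y i)).
  move=> mr; apply: measurable_prod => i _.
  by apply: (measurableT_comp (mr i)); exact: measurable_tnth.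
rewrite ge0_integral_tprodS// ge0_integral_tprodS; last 2 first.
- by apply: measurable_funM => //; apply: mp => i; exact: mrho.
- by move=> y; rewrite mulr_ge0//; apply: prodr_ge0 => i _; exact: rho0.
rewrite hrho; last 2 first.
- apply: (@measurable_fun_fubini_tonelli_F _ _ RR (n.-tuple R) R (tprod (mu' \o S) n)
    (fun z => (f (cons_pair z))%:E)).
    by apply/measurable_EFinP; exact: measurable_tuple_cons.
  by move=> z; rewrite lee_fin.
- by move=> x; apply: integral_ge0 => y _; rewrite lee_fin.
apply: eq_integral => x _.
have mfx : measurable_fun [set: n.-tuple R] (fun y => f (cons_pair (x, y))).
  apply: (measurableT_comp mf).
  apply: (measurableT_comp (@measurable_cons_pair R n)).
  exact: measurable_pair1.
rewrite (IH (mu \o S) (mu' \o S) (rho \o S)) => //; last 3 first.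
- by move=> i; exact: mrho.
- by move=> i z; exact: rho0.
- by move=> i; exact: hrho.
rewrite muleC -ge0_integralZl//; first last.
- by rewrite lee_fin.
- by move=> y _; rewrite lee_fin mulr_ge0//; apply: prodr_ge0 => i _; exact: rho0.
- apply/measurable_EFinP; apply: measurable_funM => //; apply: mp => i; exact: mrho.
apply: eq_integral => y _; rewrite -EFinM mulrCA big_ord_recl; congr (_ * (_ * _))%:E.
by apply: eq_bigr => i _; rewrite tnthS.
Qed.

(** The mean of the log-ratio under the first law, that is, minus the Kullback-Leibler divergence of
    two normal laws with variance ratio [kappa] and standardized shift [d]. *)
Definition ratio_const (kappa d : R) : R := (ln kappa + 1 - kappa) / 2 - kappa * d ^+ 2 / 2.

Definition log_ratio (m s m' s' x : R) : R :=
  let kappa := (s / s') ^+ 2 in let d := (m' - m) / s in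
  ratio_const kappa d + quad_form m s (kappa * d) ((1 - kappa) / 2) x.

Lemma measurable_log_ratio m s m' s' : measurable_fun [set: R] (log_ratio m s m' s').
Proof. by apply: measurable_funD => //; exact: measurable_quad_form. Qed.

Lemma normal_pdf_ratio m s m' s' x : 0 < s -> 0 < s' ->
  normal_pdf m' s' x = expR (log_ratio m s m' s' x) * normal_pdf m s x.
Proof.
move=> s0 s'0; have s0' := lt0r_neq0 s0; have s'0' := lt0r_neq0 s'0.
rewrite !normal_pdfE//.
have k0 : 0 < s / s' by rewrite divr_gt0.
have -> : log_ratio m s m' s' x = ln (s / s') +
   (- ((x - m') ^+ 2 / (s' ^+ 2 *+ 2)) + (x - m) ^+ 2 / (s ^+ 2 *+ 2)).
  rewrite /log_ratio /ratio_const /quad_form lnXn// -[ln (s / s') *+ 2]mulr_natr.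
  set L := ln _; field; rewrite ?s0' ?s'0'//.
rewrite !expRD lnK ?posrE//.
have -> : normal_peak s' = s / s' * normal_peak s.
  have pk (z : R) : 0 < z -> normal_peak z = z^-1 * (Num.sqrt (pi *+ 2))^-1.
    move=> z0; rewrite /normal_peak -mulrnAr sqrtrM ?sqr_ge0// sqrtr_sqr gtr0_norm//.
    by rewrite invfM.
  rewrite !pk// mulrA; congr (_ * _); field.
  by rewrite s0' s'0'.
have nf (m0 s1 : R) : normal_fun m0 s1 x = expR (- ((x - m0) ^+ 2 / (s1 ^+ 2 *+ 2))).
  by rewrite /normal_fun mulNr.
set E := expR ((x - m) ^+ 2 / _).
rewrite !nf [in RHS](expRN ((x - m) ^+ 2 / _)) -/E.
have E0 : E != 0 by rewrite gt_eqF ?expR_gt0.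
by field; rewrite E0 s'0'.
Qed.

Lemma ge0_integral_normal_ratio m s m' s' (h : R -> \bar R) : 0 < s -> 0 < s' ->
  measurable_fun [set: RR] h -> (forall x, 0 <= h x)%E ->
  (\int[normal_prob m' s']_x h x =
   \int[normal_prob m s]_x (h x * (expR (log_ratio m s m' s' x))%:E))%E.
Proof.
move=> s0 s'0 mh h0.
have D a b := @ge0_integral_density _ _ R leb (normal_prob a b) (normal_pdf a b)
  (measurable_normal_pdf a b) (normal_pdf_ge0 a b) (fun A _ => erefl).
rewrite (D m' s' _ mh h0) (D m s).
- by apply: eq_integral => x _; rewrite -muleA -EFinM -normal_pdf_ratio.
- apply: emeasurable_funM => //; apply/measurable_EFinP.
  by apply: (measurableT_comp (@measurable_expR R)); exact: measurable_log_ratio.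
- by move=> x; rewrite mule_ge0// lee_fin expR_ge0.
Qed.

Lemma tprod_normal_density n (mu mu' : nat -> probability RR R) (m s m' s' : nat -> R) :
  mu' 0%N = mu 0%N -> (forall i, 0 < s i) -> (forall i, 0 < s' i) ->
  (forall i, mu i.+1 = normal_prob (m i) (s i)) ->
  (forall i, mu' i.+1 = normal_prob (m' i) (s' i)) ->
  forall A, measurable A -> (tprod mu' n.+1 A = \int[tprod mu n.+1]_(y in A)
    (expR (\sum_(i < n) log_ratio (m i) (s i) (m' i) (s' i) (tnth y (lift ord0 i))))%:E)%E.
Proof.
move=> mu0 s0 s'0 muS mu'S A mA.
(* Coordinate 0 has the same law on both sides and contributes no factor. *)
pose rho i x : R := if i is j.+1 then expR (log_ratio (m j) (s j) (m' j) (s' j) x) else 1.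
rewrite -(setIT A) -integral_indic// setIT.
rewrite (@tprod_density mu mu' rho).
- rewrite [RHS]integral_mkcond; apply: eq_integral => y _.
  rewrite big_ord_recl/= mul1r patchE indicE.
  case: ifP => yA; rewrite ?mul0r// mul1r; congr EFin.
  by rewrite expR_sum.
- case=> [|i]; first exact: measurable_cst.
  apply: (measurableT_comp (@measurable_expR R)); exact: measurable_log_ratio.
- by case=> [|i] x //=; exact: expR_ge0.
- case=> [|i] h mh h0; first by rewrite mu0; apply: eq_integral => x _; rewrite mule1.
  by rewrite muS mu'S; exact: ge0_integral_normal_ratio.
- exact: measurable_indic.
- by move=> y; rewrite indicE.
Qed.

End LikelihoodRatio.

(** The remainder vanishes at 0 and has derivative [y^2 / (1 + y)], at most [2 y^2] in absolute
    value for [|y| <= 1/2]. *)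
Lemma ln_taylor2 (R : realType) (x : R) : `|x| <= 2^-1 ->
  `|ln (1 + x) - x + x ^+ 2 / 2| <= 2 * `|x| ^+ 3.
Proof.
rewrite ler_norml => /andP[x1 x2].
pose g (y : R) : R := ln (1 + y) - y + y ^+ 2 / 2.
have dg (y : R) : -2^-1 <= y <= 2^-1 -> is_derive y 1 g (y ^+ 2 / (1 + y)).
  move=> /andP[y1 y2]; have y0 : 0 < 1 + y by lra.
  have h1 : is_derive y 1 (fun y : R => 1 + y) 1.
    rewrite -[X in is_derive _ _ _ X]add0r; exact: is_deriveD.
  have h2 := is_derive1_comp (is_derive1_ln y0) h1.
  have h3 : is_derive y 1 (fun y : R => y ^+ 2 / 2) y.
    by apply: is_derive_eq; rewrite /GRing.scale/=; field.
  by apply: is_derive_eq; rewrite /GRing.scale/=; field; rewrite gt_eqF.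
have g0 : g 0 = 0 by rewrite /g addr0 ln1 expr0n/= mul0r subrr addr0.
have bound (c : R) : `|c| <= `|x| -> -2^-1 <= c <= 2^-1 -> `|c ^+ 2 / (1 + c)| <= 2 * `|x| ^+ 2.
  move=> cx /andP[c1 c2]; have c0 : 0 < 1 + c by lra.
  rewrite normrM normfV (gtr0_norm c0) ler_pdivrMr// normrX.
  have : `|c| ^+ 2 <= `|x| ^+ 2 by rewrite lerXn2r ?nnegrE.
  by have := sqr_ge0 `|x|; nra.
have cont (a b : R) : -2^-1 <= a -> b <= 2^-1 -> {within `[a, b], continuous g}.
  move=> a1 b1; apply: derivable_within_continuous => z; rewrite in_itv/= => /andP[z1 z2].
  by have [] := dg z; [apply/andP; split; lra|].
have [x0|x0] := leP 0 x.
  have [z||c c01 e] := @MVT_segment R g (fun y => y ^+ 2 / (1 + y)) 0 x x0.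
  - by rewrite in_itv/= => /andP[z1 z2]; apply: dg; apply/andP; split; lra.
  - by apply: cont => //; lra.
  rewrite in_itv/= in c01; case/andP: c01 => c1 c2.
  rewrite -[X in `|X|]/(g x) -[g x]subr0 -g0 e subr0 normrM.
  have -> : 2 * `|x| ^+ 3 = 2 * `|x| ^+ 2 * `|x| by ring.
  by rewrite ler_wpM2r// bound ?ger0_norm//; apply/andP; split; lra.
have [z||c c01 e] := @MVT_segment R g (fun y => y ^+ 2 / (1 + y)) x 0 (ltW x0).
- by rewrite in_itv/= => /andP[z1 z2]; apply: dg; apply/andP; split; lra.
- by apply: cont => //; lra.
rewrite in_itv/= in c01; case/andP: c01 => c1 c2.
rewrite -[X in `|X|]/(g x) -[g x]subr0 -g0 distrC e sub0r normrM normrN.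
have -> : 2 * `|x| ^+ 3 = 2 * `|x| ^+ 2 * `|x| by ring.
by rewrite ler_wpM2r// bound ?ler0_norm ?lerN2//; try (apply/andP; split); lra.
Qed.

(** * Arrays of coefficients *)

Section SquareSums.
Context {R : realType}.
Implicit Types (x y : nat -> nat -> R).

Definition ssq x (n : nat) : R := \sum_(i < n) x n i ^+ 2.

Lemma ssq_ge0 x n : 0 <= ssq x n.
Proof. by apply: sumr_ge0 => i _; exact: sqr_ge0. Qed.

(** Allows estimates to be carried out up to a fixed factor [K], of unspecified sign. *)
Lemma cvg0_le (u : nat -> R) (K : R) :
  (forall g, 0 < g -> \forall n \near \oo, `|u n| <= g * K) -> u n @[n --> \oo] --> 0.
Proof.
move=> h; apply/cvgrPdist_le => e e0.
have K0 : 0 < `|K| + 1 by rewrite ltr_wpDl.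
have := h _ (divr_gt0 e0 K0); apply: filterS => n; rewrite sub0r normrN => /le_trans; apply.
rewrite mulrAC ler_pdivrMr// ler_wpM2l ?(ltW e0)//.
by rewrite (le_trans (ler_norm _))// lerDl.
Qed.

(** The form in which negligible coefficients appear: small relative to an array whose sum of
    squares stays bounded. Squaring is the reason for [Num.sqrt g] in the proof. *)
Lemma ssq0 x y (K : R) : (\forall n \near \oo, ssq y n <= K) ->
  (forall g, 0 < g -> \forall n \near \oo, forall i, (i < n)%N -> `|x n i| <= g * `|y n i|) ->
  ssq x n @[n --> \oo] --> 0.
Proof.
move=> yK h; apply: (@cvg0_le _ K) => g g0.
have sg0 : 0 < Num.sqrt g by rewrite sqrtr_gt0.
move: (h _ sg0) yK; apply: filterS2 => n xy yK.
rewrite ger0_norm ?ssq_ge0//; apply: (@le_trans _ _ (g * ssq y n)); last by rewrite ler_wpM2l// ltW.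
rewrite /ssq mulr_sumr; apply: ler_sum => i _.
rewrite -(real_normK (num_real (x n i))) -(real_normK (num_real (y n i))).
rewrite -[X in X * _](sqr_sqrtr (ltW g0)) -exprMn lerXn2r ?nnegrE// ?mulr_ge0 ?(ltW sg0)//.
exact: xy.
Qed.

Lemma ssq_Dle x y (a : R) n : 0 < a ->
  ssq (fun n i => x n i + y n i) n <= (1 + a) * ssq x n + (1 + a^-1) * ssq y n.
Proof.
move=> a0; rewrite /ssq !mulr_sumr -big_split/=; apply: ler_sum => i _.
have : 0 <= a^-1 * (a * x n i - y n i) ^+ 2 by rewrite mulr_ge0 ?sqr_ge0// invr_ge0 ltW.
have -> : a^-1 * (a * x n i - y n i) ^+ 2 = a * x n i ^+ 2 - 2 * x n i * y n i + a^-1 * y n i ^+ 2.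
  by field; rewrite gt_eqF.
by nra.
Qed.

Lemma ssqD0 x y : ssq x n @[n --> \oo] --> 0 -> ssq y n @[n --> \oo] --> 0 ->
  ssq (fun n i => x n i + y n i) n @[n --> \oo] --> 0.
Proof.
move=> cx cy.
have h : (1 + 1) * ssq x n + (1 + 1^-1) * ssq y n @[n --> \oo] --> 0.
  rewrite -[X in _ --> X](addr0 0) -[in X in _ --> X + _](mulr0 (1 + 1)).
  by rewrite -[in X in _ --> _ + X](mulr0 (1 + 1^-1)); apply: cvgD; apply: cvgMl_tmp.
apply: (squeeze_cvgr _ (cvg_cst 0) h); apply: nearW => n.
by rewrite ssq_ge0 ssq_Dle.
Qed.

Lemma ssq_dist_le x y (a : R) n : 0 < a ->
  `|ssq y n - ssq x n| <= a * ssq x n + (1 + a^-1) * ssq (fun n i => y n i - x n i) n.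
Proof.
move=> a0; rewrite /ssq !mulr_sumr -big_split/= -sumrB.
apply: (le_trans (ler_norm_sum _ _ _)); apply: ler_sum => i _.
set X := x n i; set D := y n i - X.
have -> : y n i ^+ 2 - X ^+ 2 = 2 * X * D + D ^+ 2 by rewrite /D; ring.
apply: (le_trans (ler_normD _ _)); rewrite (ger0_norm (sqr_ge0 D)) !normrM (ger0_norm (_ : 0 <= 2))//.
have := young_sqr `|X| `|D| a0; rewrite !real_normK ?num_real//.
by rewrite mulrDl mul1r; lra.
Qed.

(** In [ssq_dist_le] the weight [a] is first chosen small against the bound of [ssq x], then the
    difference array is small against [1 + a^-1]. *)
Lemma ssq_cvg x y (l : R) : ssq (fun n i => y n i - x n i) n @[n --> \oo] --> 0 ->
  ssq x n @[n --> \oo] --> l -> ssq y n @[n --> \oo] --> l.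
Proof.
move=> c0 cx.
suff h : ssq y n - ssq x n @[n --> \oo] --> 0.
  rewrite (_ : ssq y = fun n => ssq y n - ssq x n + ssq x n); last first.
    by apply/funext => n; rewrite subrK.
  by rewrite -[l]add0r; exact: cvgD.
apply/cvgrPdist_le => e e0.
have [M M0 hM] : exists2 M : R, 0 < M & \forall n \near \oo, ssq x n <= M.
  exists (`|l| + 1); first by rewrite ltr_wpDl.
  have /cvgrPdist_le/(_ _ ltr01) := cx; apply: filterS => n.
  by rewrite distrC => h; have := ler_norm (ssq x n - l); have := ler_norm l; lra.
pose a : R := Num.min 1 (e / 2 / (M + 1)).
have a0 : 0 < a by rewrite lt_min ltr01 !divr_gt0// addr_gt0.
have aM : a * M <= e / 2.
  apply: (@le_trans _ _ (e / 2 / (M + 1) * M)).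
    by rewrite ler_wpM2r ?(ltW M0)// ge_min lexx orbT.
  rewrite mulrAC ler_pdivrMr ?addr_gt0// ler_wpM2l ?lerDl// ltW// divr_gt0//.
have b0 : 0 < 1 + a^-1 by rewrite addr_gt0// invr_gt0.
have eb : 0 < e / 2 / (1 + a^-1) by rewrite !divr_gt0.
have /cvgrPdist_le/(_ _ eb) := c0.
move: hM; apply: filterS2 => n xM; rewrite !sub0r !normrN (ger0_norm (ssq_ge0 _ _)) ler_pdivlMr// => h.
rewrite (le_trans (ssq_dist_le _ _ _ a0))// [leRHS]splitr lerD//.
  by apply: le_trans aM; rewrite ler_wpM2l// ltW.
by rewrite mulrC.
Qed.

End SquareSums.

Ltac nonneg := repeat first [done | exact: ltW | exact: sqr_ge0 | exact: enorm_ge0 | exact: sqrtr_ge0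
  | apply: mulr_ge0 | apply: addr_ge0 | rewrite invr_ge0].

Lemma shrink_le (R : realFieldType) (c e : R) : 0 <= c -> 0 <= e -> c * (e / (c + 1)) <= e.
Proof.
move=> c0 e0; rewrite mulrCA -[leRHS]mulr1 ler_wpM2l//.
by rewrite ler_pdivrMr ?ltr_wpDl// mul1r lerDl.
Qed.

Lemma normr_quot_le (R : realFieldType) (x y z b : R) : 0 < z -> z <= y -> 0 <= b ->
  `|x| <= b * z -> `|x / y| <= b.
Proof.
move=> z0 zy b0 xb; have y0 := lt_le_trans z0 zy.
rewrite normrM normfV (gtr0_norm y0) ler_pdivrMr// (le_trans xb)//.
by rewrite ler_wpM2l.
Qed.

(** All errors are measured against a common scale [z], later [m] times the interval length, so that
    the bound no longer depends on it or only through [e1] and [c]. *)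
Lemma quot_dist_le (R : realFieldType) (x x0 y y0 z e1 e2 c : R) :
  0 < z -> z <= y -> z <= y0 -> 0 <= e1 -> 0 <= e2 -> 0 <= c ->
  `|x - x0| <= e1 * z -> `|x0| <= c * z -> `|y - y0| <= e2 * z ->
  `|x / y - x0 / y0| <= e1 + c * e2.
Proof.
move=> z0 zy zy0 e10 e20 c0 hx hx0 hy.
have y_gt0 := lt_le_trans z0 zy; have y0_gt0 := lt_le_trans z0 zy0.
have -> : x / y - x0 / y0 = (x - x0) / y - x0 / y0 * ((y - y0) / y).
  by field; rewrite !gt_eqF.
rewrite (le_trans (ler_normB _ _))// lerD//; first exact: (normr_quot_le z0).
by rewrite normrM ler_pM//; exact: (normr_quot_le z0).
Qed.

Lemma sqr_dist_le (R : realFieldType) (x y c e : R) : `|x| <= c -> `|y| <= c -> `|x - y| <= e ->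
  `|x ^+ 2 - y ^+ 2| <= e * (2 * c).
Proof.
move=> xc yc xye; rewrite subr_sqr normrM ler_pM//.
by rewrite (le_trans (ler_normD _ _))//; lra.
Qed.

Section UniformPositivity.
Context {R : realType}.

Lemma enorm_le_norm n (v : 'rV[R]_n) : enorm v <= n%:R * `|v|.
Proof.
case: n v => [|n] v; first by rewrite /enorm big_ord0 sqrtr0 mul0r.
rewrite -(@ler_pXn2r _ 2)// ?nnegrE ?mulr_ge0 ?enorm_ge0// enorm_sqr dotrE exprMn.
apply: (@le_trans _ _ (\sum_(i < n.+1) `|v| ^+ 2)).
  apply: ler_sum => i _; rewrite -expr2 -real_normK ?num_real//.
  rewrite lerXn2r ?nnegrE// [X in _ <= X]mx_normrE.
  exact: (le_bigmax 0 (fun ij => `|v ij.1 ij.2|) (0, i)).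
rewrite sumr_const card_ord -[leLHS]mulr_natl ler_wpM2r ?sqr_ge0// -natrX ler_nat.
by rewrite expnS expn1 leq_pmulr.
Qed.

Lemma near_enorm n (v : 'rV[R]_n) (e : R) : 0 < e -> \forall w \near v, enorm (w - v) <= e.
Proof.
move=> e0; have n0 : 0 < n%:R + 1 :> R by rewrite ltr_wpDl.
have := nbhsx_ballx v _ (divr_gt0 e0 n0).
apply: filterS => w; rewrite -ball_normE /= distrC => h.
apply: (le_trans (enorm_le_norm _)).
apply: (@le_trans _ _ ((n%:R + 1) * `|w - v|)); first by rewrite ler_wpM2r// lerDl.
by rewrite mulrC -ler_pdivlMr// ltW.
Qed.

(** Near each point half of the local lower bound survives; compactness yields one constant.
    Continuity is assumed for the quadratic forms only. *)
Lemma posdef_uniform_lb k d (M : 'rV[R]_d -> 'M[R]_k) (K Th : set 'rV[R]_d) :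
  compact K -> K `<=` Th -> (forall th, Th th -> posdef (M th)) ->
  (forall th0 e, Th th0 -> 0 < e -> \forall th \near th0, Th th ->
     forall v, `|bform (M th) v v - bform (M th0) v v| <= e * enorm v ^+ 2) ->
  exists2 l : R, 0 < l & forall th v, K th -> l * enorm v ^+ 2 <= bform (M th) v v.
Proof.
move=> /compact_near_coveringP cK KT pM cM.
pose P (l : R) th := Th th -> forall v, l * enorm v ^+ 2 <= bform (M th) v v.
have hP : forall x, K x -> \forall x' \near x & l \near (0 : R)^'+, P l x'.
  move=> x Kx; have [l0 l00 hl] := posdef_lb (pM _ (KT _ Kx)).
  have l2 : 0 < l0 / 2 by rewrite divr_gt0.
  have hM := cM x _ (KT _ Kx) l2; have hR := nbhs_right_le l2.
  exists ([set th | Th th -> forall v, `|bform (M th) v v - bform (M x) v v| <= l0 / 2 * enorm v ^+ 2],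
    [set l | l <= l0 / 2]) => // -[th l] /= [h1 h2] Tth v.
  have := h1 Tth v; rewrite ler_norml => /andP[h3 _].
  apply: (@le_trans _ _ (l0 / 2 * enorm v ^+ 2)); first by rewrite ler_wpM2r ?sqr_ge0.
  by have := hl v; move: h3; lra.
have h : \forall l \near (0 : R)^'+, K `<=` P l by exact: cK.
have [l [l0 hl]] : exists l : R, 0 < l /\ K `<=` P l.
  by apply: (@filter_ex _ (0 : R)^'+); exact: (filterI (nbhs_right_gt 0) h).
by exists l => // th v Kth; apply: hl => //; exact: KT.
Qed.

End UniformPositivity.

Section RegularArrays.
Context {R : realType} {k : nat}.
Implicit Types (h : nat -> nat -> R) (F : nat -> nat -> 'rV[R]_k -> R).

(* The properties of [F_i] and [G_i^2] that the asymptotics use; [h n i] is the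
   length of the [i]-th observation interval. *)
Record regular_array (D : set 'rV[R]_k) h (C : R) F : Prop := {
  regular_grad : forall n i a v, (i < n)%N -> D a ->
    `|dotr v (grad (F n i) a)| <= C * h n i * enorm v;
  regular_unif : forall g, 0 < g -> exists2 eta, 0 < eta &
    forall n i a a', (i < n)%N -> D a -> D a' -> enorm (a' - a) <= eta ->
    (forall v, `|dotr v (grad (F n i) a') - dotr v (grad (F n i) a)| <= g * h n i * enorm v) /\
    `|F n i a' - F n i a - dotr (a' - a) (grad (F n i) a)| <= g * h n i * enorm (a' - a) }.

Lemma regular_lip D h C F : regular_array D h C F -> exists2 eta, 0 < eta &
  forall n i a a', (i < n)%N -> D a -> D a' -> enorm (a' - a) <= eta ->
  `|F n i a' - F n i a| <= (C + 1) * h n i * enorm (a' - a).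
Proof.
move=> rF; have [eta eta0 hu] := regular_unif rF ltr01; exists eta => // n i a a' i_lt Da Da' aa'.
have [_ h1] := hu n i a a' i_lt Da Da' aa'.
have h2 := regular_grad rF (a' - a) i_lt Da.
rewrite -[X in `|X|](subrK (dotr (a' - a) (grad (F n i) a))) (le_trans (ler_normD _ _))//.
by rewrite -mulrA mulrDl addrC !mulrA lerD.
Qed.

End RegularArrays.

Section Information.
Context {R : realType} {p q : nat}.
Variables (A : set 'rV[R]_p) (B : set 'rV[R]_q) (h : nat -> nat -> R) (T : nat -> R) (C m : R).
Variables (F : nat -> nat -> 'rV[R]_p -> R) (H : nat -> nat -> 'rV[R]_q -> R).
Hypotheses (C0 : 0 <= C) (m0 : 0 < m).
Hypothesis h0 : forall n i, (i < n)%N -> 0 < h n i.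
Hypothesis hT : forall n, \sum_(i < n) h n i = T n.
Hypothesis rF : regular_array A h C F.
Hypothesis rH : regular_array B h C H.
Hypothesis mH : forall n i b, (i < n)%N -> B b -> m * h n i <= H n i b.

Let mh0 n i : (i < n)%N -> 0 < m * h n i.
Proof. by move=> i_lt; rewrite mulr_gt0 ?h0. Qed.

Let H0 n i b : (i < n)%N -> B b -> 0 < H n i b.
Proof. by move=> i_lt Bb; apply: lt_le_trans (mh0 i_lt) (mH i_lt Bb). Qed.

(** The information matrices enter through their quadratic forms, here expressed by [F] and
    [H = G^2] and without matrices. *)
Definition qform_alpha n a b v := (T n)^-1 * \sum_(i < n) dotr v (grad (F n i) a) ^+ 2 / H n i b.
Definition qform_beta n b v := (2 * n%:R)^-1 * \sum_(i < n) (dotr v (grad (H n i) b) / H n i b) ^+ 2.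

Lemma ratio_beta_le n i b v : (i < n)%N -> B b ->
  `|dotr v (grad (H n i) b) / H n i b| <= C / m * enorm v.
Proof.
move=> i_lt Bb; apply: (@normr_quot_le _ _ _ (m * h n i)); rewrite ?mh0 ?mH//.
  by rewrite mulr_ge0 ?enorm_ge0// divr_ge0// ltW.
rewrite (le_trans (regular_grad rH v i_lt Bb))//.
have -> // : C / m * enorm v * (m * h n i) = C * h n i * enorm v.
by field; rewrite gt_eqF.
Qed.

(** Numerator and denominator of each ratio are both of the order of the interval length, so the
    modulus of the ratio is the same for all [n] and [i], and so is that of the average. *)
Lemma qform_beta_equicont e : 0 < e -> exists2 eta, 0 < eta &
  forall n b b0, B b -> B b0 -> enorm (b - b0) <= eta ->
  forall v, `|qform_beta n b v - qform_beta n b0 v| <= e * enorm v ^+ 2.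
Proof.
move=> e0; have Cm0 : 0 <= C / m by rewrite divr_ge0// ltW.
pose k := e / (2 * (C / m) + 1).
have k0 : 0 < k by rewrite divr_gt0// ltr_wpDl// mulr_ge0.
have [eta1 eta10 hu] := regular_unif rH (mulr_gt0 m0 (divr_gt0 k0 (ltr0n R 2))).
have [eta2 eta20 hl] := regular_lip rH.
(* Effect of moving the denominator: the bound [C / m] of the ratio times the relative Lipschitz
   constant [(C + 1) / m]; [eta3] keeps it below [k / 2]. *)
pose c := C / m * ((C + 1) / m).
have c0 : 0 <= c by rewrite mulr_ge0// divr_ge0 ?addr_ge0// ltW.
pose eta3 := k / 2 / (c + 1).
have eta30 : 0 < eta3 by apply: divr_gt0; [exact: divr_gt0|rewrite ltr_wpDl].
exists (Num.min eta1 (Num.min eta2 eta3)); first by rewrite !lt_min eta10 eta20.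
move=> n b b0 Bb Bb0; rewrite !le_min => /and3P[bb1 bb2 bb3] v.
rewrite /qform_beta -mulrBr -sumrB normrM ger0_norm ?invr_ge0 ?mulr_ge0//.
apply: (@le_trans _ _ ((2 * n%:R)^-1 * (n%:R * (e * enorm v ^+ 2)))); last first.
  have n1 : (2 * n%:R)^-1 * n%:R <= 1 :> R.
    have [->|n0] := eqVneq n 0%N; first by rewrite mulr0.
    by rewrite invfM mulfVK ?pnatr_eq0// invf_le1 ?ler1n.
  by rewrite [leLHS]mulrA -[leRHS]mul1r ler_wpM2r// mulr_ge0 ?sqr_ge0 ?(ltW e0).
rewrite ler_wpM2l ?invr_ge0 ?mulr_ge0// (le_trans (ler_norm_sum _ _ _))//.
apply: (@le_trans _ _ (\sum_(i < n) (e * enorm v ^+ 2))); last first.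
  by rewrite sumr_const card_ord mulr_natl.
apply: ler_sum => i _; have i_lt := ltn_ord i.
apply: (@le_trans _ _ (k * enorm v * (2 * (C / m * enorm v)))); last first.
  have -> : k * enorm v * (2 * (C / m * enorm v)) = k * (2 * (C / m)) * enorm v ^+ 2 by ring.
  have Cm2 : 0 <= 2 * (C / m) by rewrite mulr_ge0.
  rewrite ler_wpM2r ?sqr_ge0// /k mulrAC ler_pdivrMr ?ltr_wpDl//.
  by rewrite ler_wpM2l ?(ltW e0)// lerDl.
apply: sqr_dist_le; rewrite ?ratio_beta_le//.
have [h1 _] := hu n i b0 b i_lt Bb0 Bb bb1.
have h2 := hl n i b0 b i_lt Bb0 Bb bb2.
have h3 := regular_grad rH v i_lt Bb0.
apply: (@le_trans _ _ (k / 2 * enorm v + C / m * enorm v * ((C + 1) / m * eta3))).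
  apply: (quot_dist_le (mh0 i_lt)); rewrite ?mH//.
  - by nonneg.
  - by nonneg.
  - by nonneg.
  - by rewrite (le_trans (h1 v))// le_eqVlt; apply/orP; left; apply/eqP; ring.
  - rewrite (le_trans h3)// le_eqVlt; apply/orP; left; apply/eqP; field.
    by rewrite gt_eqF.
  - apply: (le_trans h2).
    have -> : (C + 1) / m * eta3 * (m * h n i) = (C + 1) * h n i * eta3.
      by field; rewrite gt_eqF.
    by rewrite ler_wpM2l// mulr_ge0 ?addr_ge0// ltW// h0.
have -> : C / m * enorm v * ((C + 1) / m * eta3) = (c * eta3) * enorm v by rewrite /c; ring.
rewrite -mulrDl ler_wpM2r ?enorm_ge0// [leRHS]splitr lerD2l.
by apply: shrink_le => //; rewrite ltW// divr_gt0.
Qed.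

(** Each summand varies by at most its interval length times [e |v|^2], and the lengths add up to
    [T n]. *)
Lemma qform_alpha_equicont e : 0 < e -> exists2 eta, 0 < eta &
  forall n a a0 b b0, A a -> A a0 -> B b -> B b0 -> enorm (a - a0) <= eta -> enorm (b - b0) <= eta ->
  forall v, `|qform_alpha n a b v - qform_alpha n a0 b0 v| <= e * enorm v ^+ 2.
Proof.
move=> e0; pose g := e / 2 / (2 * C / m + 1).
have Cm0 : 0 <= 2 * C / m by rewrite divr_ge0 ?mulr_ge0// ltW.
have g0 : 0 < g by rewrite !divr_gt0// ltr_wpDl.
have [eta1 eta10 hu] := regular_unif rF g0.
have [eta2 eta20 hl] := regular_lip rH.
pose c := C ^+ 2 / m * ((C + 1) / m).
have c0 : 0 <= c by rewrite mulr_ge0// divr_ge0 ?addr_ge0 ?sqr_ge0// ltW.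
pose eta3 := e / 2 / (c + 1).
have eta30 : 0 < eta3 by rewrite !divr_gt0// ltr_wpDl.
exists (Num.min eta1 (Num.min eta2 eta3)); first by rewrite !lt_min eta10 eta20.
move=> n a a0 b b0 Aa Aa0 Bb Bb0; rewrite !le_min => /and3P[aa1 _ _] /and3P[_ bb2 bb3] v.
have T0 : 0 <= T n by rewrite -hT sumr_ge0// => i _; rewrite ltW// h0.
rewrite /qform_alpha -mulrBr -sumrB normrM ger0_norm ?invr_ge0//.
apply: (@le_trans _ _ ((T n)^-1 * (T n * (e * enorm v ^+ 2)))); last first.
  have T1 : (T n)^-1 * T n <= 1.
    by have [->|n0] := eqVneq (T n) 0; rewrite ?mulr0// mulVf.
  by rewrite [leLHS]mulrA -[leRHS]mul1r ler_wpM2r// mulr_ge0 ?sqr_ge0 ?(ltW e0).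
rewrite ler_wpM2l ?invr_ge0// (le_trans (ler_norm_sum _ _ _))// -hT mulr_suml.
apply: ler_sum => i _; have i_lt := ltn_ord i; have hi := h0 i_lt.
have [h1 _] := hu n i a0 a i_lt Aa0 Aa aa1.
have h2 := hl n i b0 b i_lt Bb0 Bb bb2.
have x1 := regular_grad rF v i_lt Aa; have x2 := regular_grad rF v i_lt Aa0.
have h4 := sqr_dist_le x1 x2 (h1 v).
apply: (@le_trans _ _ (2 * C / m * g * h n i * enorm v ^+ 2 +
    C ^+ 2 / m * h n i * enorm v ^+ 2 * ((C + 1) / m * eta3))).
  apply: (quot_dist_le (mh0 i_lt)); rewrite ?mH//.
  - by nonneg.
  - by nonneg.
  - by nonneg.
  - rewrite (le_trans h4)// le_eqVlt; apply/orP; left; apply/eqP; field.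
    by rewrite gt_eqF.
  - rewrite normrX; apply: (@le_trans _ _ ((C * h n i * enorm v) ^+ 2)).
      by rewrite lerXn2r ?nnegrE//; nonneg.
    rewrite le_eqVlt; apply/orP; left; apply/eqP; field.
    by rewrite gt_eqF.
  - apply: (le_trans h2).
    have -> : (C + 1) / m * eta3 * (m * h n i) = (C + 1) * h n i * eta3.
      by field; rewrite gt_eqF.
    by rewrite ler_wpM2l// mulr_ge0 ?addr_ge0// ltW.
have -> : C ^+ 2 / m * h n i * enorm v ^+ 2 * ((C + 1) / m * eta3) =
  h n i * (c * eta3 * enorm v ^+ 2) by rewrite /c; ring.
have -> : 2 * C / m * g * h n i * enorm v ^+ 2 = h n i * (2 * C / m * g * enorm v ^+ 2) by ring.
rewrite -mulrDr ler_wpM2l ?(ltW hi)// -mulrDl ler_wpM2r ?sqr_ge0// [leRHS]splitr lerD//.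
  by apply: shrink_le => //; rewrite ltW// divr_gt0.
by apply: shrink_le => //; rewrite ltW// divr_gt0.
Qed.

End Information.

(** The normalizing matrices are of size [r^(-1/2)], uniformly as long as [J] is bounded below by
    [l]. *)
Lemma scaled_inv_sqrtmx_le (R : realType) k (r l : R) (J : 'M[R]_k) (x : 'rV[R]_k) :
  0 < r -> 0 < l -> posdef J -> (forall u, l * enorm u ^+ 2 <= bform J u u) ->
  r * enorm (x *m inv_sqrtmx (r *: J)) ^+ 2 <= l^-1 * enorm x ^+ 2.
Proof.
move=> r0 l0 pJ lJ; rewrite [leRHS]mulrC ler_pdivlMr// mulrAC.
apply: (enorm_inv_sqrtmx _ (posdefZ r0 pJ) (mulr_gt0 r0 l0)) => u.
by rewrite bform_mxZ -mulrA ler_wpM2l ?(ltW r0).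
Qed.

Lemma sqrt_scale_le (R : rcfType) (T l x y : R) : 0 < T -> 0 < l -> 0 <= x -> 0 <= y ->
  T * x ^+ 2 <= l^-1 * y ^+ 2 -> x <= (Num.sqrt l)^-1 * y / Num.sqrt T.
Proof.
move=> T0 l0 x0 y0 hle; rewrite ler_pdivlMr ?sqrtr_gt0// -(@ler_pXn2r _ 2)//; last 2 first.
- by rewrite nnegrE; nonneg.
- by rewrite nnegrE; nonneg.
by rewrite !exprMn sqr_sqrtr ?(ltW T0)// exprVn sqr_sqrtr ?(ltW l0)// mulrC.
Qed.

Lemma bform_inv_sqrtmx (R : realType) k (M : 'M[R]_k) (x : 'rV[R]_k) : posdef M ->
  bform M (x *m inv_sqrtmx M) (x *m inv_sqrtmx M) = enorm x ^+ 2.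
Proof.
move=> pM; have [[sS _] _] := inv_sqrtmxP pM.
rewrite enorm_sqr -bform1 -(inv_sqrtmxK pM) /bform trmx_mul sS !mulmxA.
by [].
Qed.

(** * Asymptotics of the coefficient arrays *)

Section LocalAsymptotics.
Context {R : realType} {p q : nat}.
Variables (A : set 'rV[R]_p) (B : set 'rV[R]_q) (h : nat -> nat -> R) (T : nat -> R) (C m hmax : R).
Variables (F : nat -> nat -> 'rV[R]_p -> R) (H : nat -> nat -> 'rV[R]_q -> R).
Variables (Jp : 'rV[R]_p -> 'rV[R]_q -> 'M[R]_p) (Jq : 'rV[R]_q -> 'M[R]_q).
Hypotheses (C0 : 0 <= C) (m0 : 0 < m).
Hypothesis h0 : forall n i, (i < n)%N -> 0 < h n i.
Hypothesis hmaxP : forall n i, (i < n)%N -> h n i <= hmax.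
Hypothesis hT : forall n, \sum_(i < n) h n i = T n.
Hypothesis Too : T n @[n --> \oo] --> +oo.
Hypothesis rF : regular_array A h C F.
Hypothesis rH : regular_array B h C H.
Hypothesis mH : forall n i b, (i < n)%N -> B b -> m * h n i <= H n i b.
Hypothesis posJp : forall a b, A a -> B b -> posdef (Jp a b).
Hypothesis posJq : forall b, B b -> posdef (Jq b).
Hypothesis cvJp : forall e, 0 < e -> \forall n \near \oo, forall a b, A a -> B b ->
  forall v, `|qform_alpha T F H n a b v - bform (Jp a b) v v| <= e * enorm v ^+ 2.
Hypothesis cvJq : forall e, 0 < e -> \forall n \near \oo, forall b, B b ->
  forall v, `|qform_beta H n b v - bform (Jq b) v v| <= e * enorm v ^+ 2.

Lemma dist3_le (x y x0 y0 e : R) : `|x - y| <= e / 3 -> `|x - x0| <= e / 3 -> `|x0 - y0| <= e / 3 ->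
  `|y - y0| <= e.
Proof. by rewrite !ler_norml => /andP[? ?] /andP[? ?] /andP[? ?]; apply/andP; split; lra. Qed.

Lemma lsubmxB (u v : 'rV[R]_(p + q)) : lsubmx u - lsubmx v = lsubmx (u - v).
Proof. by apply/rowP => i; rewrite !mxE. Qed.

Lemma rsubmxB (u v : 'rV[R]_(p + q)) : rsubmx u - rsubmx v = rsubmx (u - v).
Proof. by apply/rowP => i; rewrite !mxE. Qed.

Lemma enorm_submx (u : 'rV[R]_(p + q)) : enorm u ^+ 2 = enorm (lsubmx u) ^+ 2 + enorm (rsubmx u) ^+ 2.
Proof.
rewrite !enorm_sqr !dotrE big_split_ord /=; congr (_ + _); apply: eq_bigr => i _; by rewrite !mxE.
Qed.

Lemma enorm_lsubmx_le (u : 'rV[R]_(p + q)) : enorm (lsubmx u) <= enorm u.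
Proof. by rewrite -(@ler_pXn2r _ 2)// ?nnegrE ?enorm_ge0// [leRHS]enorm_submx lerDl sqr_ge0. Qed.

Lemma enorm_rsubmx_le (u : 'rV[R]_(p + q)) : enorm (rsubmx u) <= enorm u.
Proof. by rewrite -(@ler_pXn2r _ 2)// ?nnegrE ?enorm_ge0// [leRHS]enorm_submx lerDr sqr_ge0. Qed.

(** The limits inherit continuity: with one [n] from the uniform convergence, three errors of
    [e / 3] compare [J] at two parameters through the equicontinuous form at [n]. *)
Lemma information_lb (K : set 'rV[R]_(p + q)) : compact K -> K `<=` Theta A B ->
  exists2 l : R, 0 < l & forall th, K th ->
    (forall v, l * enorm v ^+ 2 <= bform (Jp (lsubmx th) (rsubmx th)) v v) /\
    (forall v, l * enorm v ^+ 2 <= bform (Jq (rsubmx th)) v v).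
Proof.
move=> cK KT.
have [l1 l10 hl1] : exists2 l : R, 0 < l & forall th v, K th ->
    l * enorm v ^+ 2 <= bform (Jp (lsubmx th) (rsubmx th)) v v.
  apply: (posdef_uniform_lb cK KT) => [th [Ath Bth]|th0 e [Ath0 Bth0] e0]; first exact: posJp.
  have e3 : 0 < e / 3 by rewrite divr_gt0.
  have [eta eta0 heta] := qform_alpha_equicont C0 m0 h0 hT rF rH mH e3.
  have [n hn] : exists n, forall a b, A a -> B b ->
      forall v, `|qform_alpha T F H n a b v - bform (Jp a b) v v| <= e / 3 * enorm v ^+ 2.
    exact: (filter_ex (cvJp e3)).
  apply: filterS (near_enorm th0 eta0) => th hth [Ath Bth] v.
  apply: (@dist3_le (qform_alpha T F H n (lsubmx th) (rsubmx th) v) _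
    (qform_alpha T F H n (lsubmx th0) (rsubmx th0) v)); rewrite mulrAC; [exact: hn| |exact: hn].
  apply: heta => //.
    by rewrite lsubmxB (le_trans (enorm_lsubmx_le _)).
  by rewrite rsubmxB (le_trans (enorm_rsubmx_le _)).
have [l2 l20 hl2] : exists2 l : R, 0 < l & forall th v, K th ->
    l * enorm v ^+ 2 <= bform (Jq (rsubmx th)) v v.
  apply: (posdef_uniform_lb cK KT) => [th [Ath Bth]|th0 e [Ath0 Bth0] e0]; first exact: posJq.
  have e3 : 0 < e / 3 by rewrite divr_gt0.
  have [eta eta0 heta] := qform_beta_equicont C0 m0 h0 rH mH e3.
  have [n hn] : exists n, forall b, B b ->
      forall v, `|qform_beta H n b v - bform (Jq b) v v| <= e / 3 * enorm v ^+ 2.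
    exact: (filter_ex (cvJq e3)).
  apply: filterS (near_enorm th0 eta0) => th hth [Ath Bth] v.
  apply: (@dist3_le (qform_beta H n (rsubmx th) v) _
    (qform_beta H n (rsubmx th0) v)); rewrite mulrAC; [exact: hn| |exact: hn].
  apply: heta => //.
  by rewrite rsubmxB (le_trans (enorm_rsubmx_le _)).
exists (Num.min l1 l2); first by rewrite lt_min l10.
move=> th Kth; split=> v.
  by apply: le_trans (hl1 th v Kth); rewrite ler_wpM2r ?sqr_ge0// ge_min lexx.
by apply: le_trans (hl2 th v Kth); rewrite ler_wpM2r ?sqr_ge0// ge_min lexx orbT.
Qed.

Section Sequences.
Variables (l : R) (a_ a'_ wa_ : nat -> 'rV[R]_p) (b_ b'_ wb_ : nat -> 'rV[R]_q).
Variables (wa : 'rV[R]_p) (wb : 'rV[R]_q).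
Hypothesis l0 : 0 < l.
Hypothesis Aa : forall n, (0 < n)%N -> A (a_ n).
Hypothesis Aa' : forall n, (0 < n)%N -> A (a'_ n).
Hypothesis Bb : forall n, (0 < n)%N -> B (b_ n).
Hypothesis Bb' : forall n, (0 < n)%N -> B (b'_ n).
Hypothesis lJp : forall n v, (0 < n)%N -> l * enorm v ^+ 2 <= bform (Jp (a_ n) (b_ n)) v v.
Hypothesis lJq : forall n v, (0 < n)%N -> l * enorm v ^+ 2 <= bform (Jq (b_ n)) v v.

Let phi n := inv_sqrtmx (T n *: Jp (a_ n) (b_ n)).
Let psi n := inv_sqrtmx (n%:R *: Jq (b_ n)).

Hypothesis a'E : forall n, a'_ n = a_ n + wa_ n *m phi n.
Hypothesis b'E : forall n, b'_ n = b_ n + wb_ n *m psi n.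
Hypothesis cwa : enorm (wa_ n - wa) @[n --> \oo] --> 0.
Hypothesis cwb : enorm (wb_ n - wb) @[n --> \oo] --> 0.

Let s n i := Num.sqrt (H n i (b_ n)).

(** Coefficient of the standardized observation in the score along [x]; [score_beta] is twice that
    of its centred square along [y]. *)
Definition score_alpha n i x := dotr (x *m phi n) (grad (F n i) (a_ n)) / s n i.
Definition score_beta n i y := dotr (y *m psi n) (grad (H n i) (b_ n)) / H n i (b_ n).

Let T0 n : (0 < n)%N -> 0 < T n.
Proof.
case: n => // n _; rewrite -hT big_ord_recl ltr_pwDl ?h0// sumr_ge0// => i _.
by rewrite ltW// h0.
Qed.

Let H0 n i : (i < n)%N -> 0 < H n i (b_ n).
Proof.
move=> i_lt; have n0 : (0 < n)%N by case: (n) i_lt.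
by apply: lt_le_trans (mH i_lt (Bb n0)); rewrite mulr_gt0 ?h0.
Qed.

Let s0 n i : (i < n)%N -> 0 < s n i.
Proof. by move=> i_lt; rewrite sqrtr_gt0 H0. Qed.

Let s_lb n i : (i < n)%N -> Num.sqrt m * Num.sqrt (h n i) <= s n i.
Proof.
move=> i_lt; have n0 : (0 < n)%N by case: (n) i_lt.
by rewrite -sqrtrM ?(ltW m0)// ler_sqrt ?(ltW (H0 _))//; apply: mH => //; exact: Bb.
Qed.

Let phi_le n x : (0 < n)%N -> T n * enorm (x *m phi n) ^+ 2 <= l^-1 * enorm x ^+ 2.
Proof.
move=> n0; apply: scaled_inv_sqrtmx_le => //; [exact: T0|exact: posJp (Aa n0) (Bb n0)|].
by move=> u; exact: lJp.
Qed.

Let psi_le n y : (0 < n)%N -> n%:R * enorm (y *m psi n) ^+ 2 <= l^-1 * enorm y ^+ 2.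
Proof.
move=> n0; apply: scaled_inv_sqrtmx_le => //; [by rewrite ltr0n|exact: posJq (Bb n0)|].
by move=> u; exact: lJq.
Qed.

Let near_gt0 : \forall n \near \oo, (0 < n)%N.
Proof. by exists 1%N. Qed.

Let small (r : nat -> R) (z : nat -> R) (M : R) :
  r n @[n --> \oo] --> +oo -> (forall n, 0 <= z n) ->
  (\forall n \near \oo, r n * z n ^+ 2 <= M) -> z n @[n --> \oo] --> 0.
Proof.
move=> roo z0 hM; apply/cvgrPdist_le => e e0.
have e2 : 0 < e ^+ 2 by rewrite exprn_gt0.
move/cvgryPge: roo => /(_ ((`|M| + 1) / e ^+ 2)); move: hM; apply: filterS2 => n hM rn.
rewrite sub0r normrN ger0_norm// -(@ler_pXn2r _ 2) ?nnegrE ?(ltW e0)//.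
have r0 : 0 < r n by apply: lt_le_trans rn; rewrite divr_gt0// ltr_wpDl.
rewrite -(ler_pM2l r0) (le_trans hM)//.
rewrite ler_pdivrMr// in rn; apply: le_trans rn.
by rewrite (le_trans (ler_norm _))// lerDl.
Qed.


Let bounded_small (z M g : R) : 0 < g -> 0 <= z -> z <= g / (M + 1) -> 0 <= M -> M * z <= g.
Proof.
move=> g0 z0 zg M0; apply: le_trans (shrink_le M0 (ltW g0)).
by rewrite ler_wpM2l.
Qed.

Let near_le (z : nat -> R) (g : R) : 0 < g -> z n @[n --> \oo] --> 0 -> \forall n \near \oo, z n <= g.
Proof.
move=> g0 /cvgrPdist_le/(_ _ g0); apply: filterS => n; rewrite sub0r normrN.
exact: le_trans (ler_norm _).
Qed.

Definition bounded_rows k (x_ : nat -> 'rV[R]_k) := exists2 K : R, 0 <= K & \forall n \near \oo, enorm (x_ n) <= K.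

(** The reference arrays for [ssq0]; their sums of squares are [T n |x phi|^2] and [n |y psi|^2],
    bounded by the choice of the rates. *)
Let ya (x_ : nat -> 'rV[R]_p) n i := Num.sqrt (h n i) * enorm (x_ n *m phi n).
Let yb (y_ : nat -> 'rV[R]_q) n (i : nat) := enorm (y_ n *m psi n).

Let ssq_ya x_ n : ssq (ya x_) n = T n * enorm (x_ n *m phi n) ^+ 2.
Proof.
rewrite -hT mulr_suml; apply: eq_bigr => i _.
by rewrite /ya exprMn sqr_sqrtr// ltW// h0.
Qed.

Let ssq_yb y_ n : ssq (yb y_) n = n%:R * enorm (y_ n *m psi n) ^+ 2.
Proof. by rewrite /ssq /yb sumr_const card_ord mulr_natl. Qed.

Let ssq_ya_bounded x_ : bounded_rows x_ -> exists K : R, \forall n \near \oo, ssq (ya x_) n <= K.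
Proof.
move=> [K K0 hK]; exists (l^-1 * K ^+ 2); move: hK near_gt0; apply: filterS2 => n xK n0.
rewrite ssq_ya (le_trans (phi_le _ n0))// ler_wpM2l ?invr_ge0 ?(ltW l0)//.
by rewrite lerXn2r ?nnegrE ?enorm_ge0.
Qed.

Let ssq_yb_bounded y_ : bounded_rows y_ -> exists K : R, \forall n \near \oo, ssq (yb y_) n <= K.
Proof.
move=> [K K0 hK]; exists (l^-1 * K ^+ 2); move: hK near_gt0; apply: filterS2 => n xK n0.
rewrite ssq_yb (le_trans (psi_le _ n0))// ler_wpM2l ?invr_ge0 ?(ltW l0)//.
by rewrite lerXn2r ?nnegrE ?enorm_ge0.
Qed.

Let phi_small x_ : bounded_rows x_ -> enorm (x_ n *m phi n) @[n --> \oo] --> 0.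
Proof.
move=> /ssq_ya_bounded[K hK]; apply: (small Too (M := K)) => [n|]; first exact: enorm_ge0.
by apply: filterS hK => n; rewrite ssq_ya.
Qed.

Let psi_small y_ : bounded_rows y_ -> enorm (y_ n *m psi n) @[n --> \oo] --> 0.
Proof.
move=> /ssq_yb_bounded[K hK]; apply: (small (r := fun n => n%:R) (M := K)) => [|n|].
- exact: cvgr_idn.
- exact: enorm_ge0.
- by apply: filterS hK => n; rewrite ssq_yb.
Qed.

Let bounded_cst k (x : 'rV[R]_k) : bounded_rows (fun=> x).
Proof. by exists (enorm x); rewrite ?enorm_ge0//; exact: nearW. Qed.

Let enormD k (u v : 'rV[R]_k) : enorm (u + v) <= enorm u + enorm v.
Proof.
rewrite -(@ler_pXn2r _ 2)// ?nnegrE ?addr_ge0 ?enorm_ge0//.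
rewrite enorm_sqr dotrDl !(dotrC _ (u + v)) !dotrDl -!enorm_sqr sqrrD (dotrC v u).
by have := ler_norm (dotr u v); have := norm_dotr_le u v; rewrite mulr2n; lra.
Qed.

Let bounded_cvg k (x_ : nat -> 'rV[R]_k) x : enorm (x_ n - x) @[n --> \oo] --> 0 -> bounded_rows x_.
Proof.
move=> /(near_le ltr01) hx; exists (1 + enorm x); first by rewrite addr_ge0 ?enorm_ge0.
apply: filterS hx => n hn; rewrite -[X in enorm X](subrK x).
by rewrite (le_trans (enormD _ _))// lerD2r.
Qed.

Let shmax n i : (i < n)%N -> Num.sqrt (h n i) <= Num.sqrt hmax.
Proof.
move=> i_lt; rewrite ler_sqrt ?hmaxP// (le_trans _ (hmaxP i_lt))// ltW// h0//.
Qed.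

Let score_alpha_le n i x : (i < n)%N ->
  `|score_alpha n i x| <= C / Num.sqrt m * (Num.sqrt (h n i) * enorm (x *m phi n)).
Proof.
move=> i_lt; have n0 : (0 < n)%N by case: (n) i_lt.
have sm : 0 < Num.sqrt m by rewrite sqrtr_gt0.
have sh : 0 < Num.sqrt (h n i) by rewrite sqrtr_gt0 h0.
apply: (normr_quot_le (z := Num.sqrt m * Num.sqrt (h n i))); rewrite ?mulr_gt0 ?s_lb//.
  by nonneg.
rewrite (le_trans (regular_grad rF _ i_lt (Aa n0)))// -[in leLHS](sqr_sqrtr (ltW (h0 i_lt))).
rewrite le_eqVlt; apply/orP; left; apply/eqP; field; by rewrite gt_eqF.
Qed.

Let score_beta_le n i y : (i < n)%N -> `|score_beta n i y| <= C / m * enorm (y *m psi n).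
Proof.
move=> i_lt; have n0 : (0 < n)%N by case: (n) i_lt.
exact: (ratio_beta_le C0 m0 h0 rH mH _ i_lt (Bb n0)).
Qed.

(** A coefficient is at most a constant times [sqrt hmax |x phi|]; here the bound on the mesh is
    indispensable to the estimate, and [T n] tending to infinity makes it small. *)
Lemma score_alpha_max x g : 0 < g -> \forall n \near \oo, forall i, (i < n)%N -> `|score_alpha n i x| <= g.
Proof.
move=> g0; have M0 : 0 <= C / Num.sqrt m * Num.sqrt hmax by nonneg.
have g1 : 0 < g / (C / Num.sqrt m * Num.sqrt hmax + 1) by rewrite divr_gt0// ltr_wpDl.
have := near_le g1 (phi_small (bounded_cst x)); apply: filterS => n hn i i_lt.
apply: (le_trans (score_alpha_le x i_lt)); apply: le_trans (bounded_small g0 (enorm_ge0 _) hn M0).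
rewrite -[leRHS]mulrA ler_wpM2l ?divr_ge0 ?sqrtr_ge0// ler_wpM2r ?enorm_ge0//.
exact: shmax.
Qed.

Lemma score_beta_max y g : 0 < g -> \forall n \near \oo, forall i, (i < n)%N -> `|score_beta n i y| <= g.
Proof.
move=> g0; have M0 : 0 <= C / m by nonneg.
have g1 : 0 < g / (C / m + 1) by rewrite divr_gt0// ltr_wpDl.
have := near_le g1 (psi_small (bounded_cst y)); apply: filterS => n hn i i_lt.
apply: (le_trans (score_beta_le y i_lt)); exact: (bounded_small g0 (enorm_ge0 _) hn M0).
Qed.

(** The sum of squares is [T n] times the information form at [x phi]; replacing it by its limit
    gives exactly [|x|^2], since [phi] is the inverse square root of [T n J]. *)
Lemma ssq_score_alpha x : ssq (fun n i => score_alpha n i x) n @[n --> \oo] --> enorm x ^+ 2.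
Proof.
have [K hK] := ssq_ya_bounded (bounded_cst x).
suff : ssq (fun n i => score_alpha n i x) n - enorm x ^+ 2 @[n --> \oo] --> 0.
  move=> hc; rewrite (_ : ssq _ = fun n => ssq (fun n i => score_alpha n i x) n - enorm x ^+ 2 + enorm x ^+ 2).
    by rewrite -[X in _ --> X]add0r; apply: cvgD => //; exact: cvg_cst.
  by apply/funext => n; rewrite subrK.
apply: (@cvg0_le _ _ K) => g g0.
move: (cvJp g0) hK near_gt0; apply: filterS3 => n hn hK n0.
have Tn := T0 n0.
have -> : ssq (fun n i => score_alpha n i x) n = T n * qform_alpha T F H n (a_ n) (b_ n) (x *m phi n).
  rewrite /qform_alpha mulrA divff ?gt_eqF// mul1r; apply: eq_bigr => i _.
  by rewrite /score_alpha exprMn exprVn sqr_sqrtr// ltW// H0.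
have -> : enorm x ^+ 2 = T n * bform (Jp (a_ n) (b_ n)) (x *m phi n) (x *m phi n).
  by rewrite -bform_mxZ bform_inv_sqrtmx//; exact: posdefZ Tn (posJp (Aa n0) (Bb n0)).
rewrite -mulrBr normrM (gtr0_norm Tn); apply: (@le_trans _ _ (T n * (g * enorm (x *m phi n) ^+ 2))).
  by rewrite ler_wpM2l ?(ltW Tn)// hn//; [exact: Aa|exact: Bb].
by rewrite mulrCA ler_wpM2l ?(ltW g0)// -(ssq_ya (fun=> x)).
Qed.

(** As for [alpha]; the factor 2 undoes the [1 / (2 n)] in the definition of the information. *)
Lemma ssq_score_beta y : ssq (fun n i => score_beta n i y) n @[n --> \oo] --> 2 * enorm y ^+ 2.
Proof.
have [K hK] := ssq_yb_bounded (bounded_cst y).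
suff : ssq (fun n i => score_beta n i y) n - 2 * enorm y ^+ 2 @[n --> \oo] --> 0.
  move=> hc; rewrite (_ : ssq _ = fun n => ssq (fun n i => score_beta n i y) n - 2 * enorm y ^+ 2 + 2 * enorm y ^+ 2).
    by rewrite -[X in _ --> X]add0r; apply: cvgD => //; exact: cvg_cst.
  by apply/funext => n; rewrite subrK.
apply: (@cvg0_le _ _ (2 * K)) => g g0.
move: (cvJq g0) hK near_gt0; apply: filterS3 => n hn hK n0.
have Tn : 0 < n%:R :> R by rewrite ltr0n.
have Tn2 : 0 < 2 * n%:R :> R by rewrite mulr_gt0.
have -> : ssq (fun n i => score_beta n i y) n = 2 * n%:R * qform_beta H n (b_ n) (y *m psi n).
  by rewrite /qform_beta mulrA divff ?gt_eqF// mul1r.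
have -> : 2 * enorm y ^+ 2 = 2 * n%:R * bform (Jq (b_ n)) (y *m psi n) (y *m psi n).
  by rewrite -mulrA -bform_mxZ bform_inv_sqrtmx//; exact: posdefZ Tn (posJq (Bb n0)).
rewrite -mulrBr normrM (gtr0_norm Tn2); apply: (@le_trans _ _ (2 * n%:R * (g * enorm (y *m psi n) ^+ 2))).
  by rewrite ler_wpM2l ?(ltW Tn2)// hn//; exact: Bb.
by rewrite mulrCA ler_wpM2l ?(ltW g0)// -mulrA -(ssq_yb (fun=> y)) ler_wpM2l.
Qed.

Let delta n i := F n i (a'_ n) - F n i (a_ n).
Let kappa n i := H n i (b_ n) / H n i (b'_ n).

Let ua n := wa_ n *m phi n.
Let ub n := wb_ n *m psi n.

Let a'B n : a'_ n - a_ n = ua n.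
Proof. by rewrite a'E addrAC subrr add0r. Qed.

Let b'B n : b'_ n - b_ n = ub n.
Proof. by rewrite b'E addrAC subrr add0r. Qed.

Let H'0 n i : (i < n)%N -> 0 < H n i (b'_ n).
Proof.
move=> i_lt; have n0 : (0 < n)%N by case: (n) i_lt.
by apply: lt_le_trans (mH i_lt (Bb' n0)); rewrite mulr_gt0 ?h0.
Qed.

(** Two errors: the Taylor remainder of [F] along [wa_ n], negligible against [ya wa_], and the
    replacement of [wa_ n] by its limit in the linear term. *)
Lemma ssq_drift : ssq (fun n i => delta n i / s n i - score_alpha n i wa) n @[n --> \oo] --> 0.
Proof.
have bw := bounded_cvg cwa.
rewrite (_ : ssq _ = ssq (fun n i => (delta n i / s n i - score_alpha n i (wa_ n)) +
    score_alpha n i (wa_ n - wa))); last first.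
  apply/funext => n; apply: eq_bigr => i _; congr (_ ^+ 2).
  by rewrite /score_alpha mulmxBl dotrBl; ring.
apply: ssqD0.
  have [K hK] := ssq_ya_bounded bw; apply: (ssq0 hK) => g g0.
  have sm : 0 < Num.sqrt m by rewrite sqrtr_gt0.
  have [eta eta0 heta] := regular_unif rF (mulr_gt0 g0 sm).
  move: (near_le eta0 (phi_small bw)) near_gt0; apply: filterS2 => n un n0 i i_lt.
  have uE : enorm (a'_ n - a_ n) <= eta by rewrite a'B.
  have [_] := heta n i (a_ n) (a'_ n) i_lt (Aa n0) (Aa' n0) uE.
  rewrite a'B -/(delta n i) => hT1; rewrite /score_alpha -mulrBl.
  have sh : 0 < Num.sqrt (h n i) by rewrite sqrtr_gt0 h0.
  apply: (normr_quot_le (z := Num.sqrt m * Num.sqrt (h n i))); rewrite ?mulr_gt0 ?s_lb//.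
    by rewrite mulr_ge0// ltW.
  apply: (le_trans hT1); rewrite -[in leLHS](sqr_sqrtr (ltW (h0 i_lt))).
  rewrite /ya ger0_norm; last by nonneg.
  by rewrite le_eqVlt; apply/orP; left; apply/eqP; rewrite /ua; ring.
(* For the second error the reference array is [sqrt (h / T)], whose squares add up to 1; the small
   factor is [|wa_ n - wa|]. *)
have hK : \forall n \near \oo, ssq (fun n i => Num.sqrt (h n i) * (Num.sqrt (T n))^-1) n <= 1.
  apply: filterS near_gt0 => n n0; have Tn := T0 n0.
  rewrite /ssq; under eq_bigr => i _.
    rewrite exprMn exprVn !sqr_sqrtr ?(ltW Tn) ?(ltW (h0 (ltn_ord i)))//; over.
  by rewrite -mulr_suml hT divff ?gt_eqF.
apply: (ssq0 hK) => g g0.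
pose M := C / Num.sqrt m * (Num.sqrt l)^-1.
have M0 : 0 <= M by rewrite /M; nonneg.
have g1 : 0 < g / (M + 1) by rewrite divr_gt0// ltr_wpDl.
move: (near_le g1 cwa) near_gt0; apply: filterS2 => n wn n0 i i_lt; have Tn := T0 n0.
apply: (le_trans (score_alpha_le _ i_lt)).
rewrite ger0_norm; last by nonneg.
rewrite mulrCA [leRHS]mulrCA ler_wpM2l ?sqrtr_ge0//.
have hx : enorm ((wa_ n - wa) *m phi n) <= (Num.sqrt l)^-1 * enorm (wa_ n - wa) / Num.sqrt (T n).
  by apply: sqrt_scale_le; rewrite ?enorm_ge0//; exact: phi_le.
apply: (@le_trans _ _ (M * enorm (wa_ n - wa) / Num.sqrt (T n))).
  rewrite /M -!mulrA ler_wpM2l// ler_wpM2l ?invr_ge0 ?sqrtr_ge0//.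
  by rewrite mulrA.
by rewrite ler_wpM2r ?invr_ge0 ?sqrtr_ge0//; apply: bounded_small => //; exact: enorm_ge0.
Qed.

Let kappa_le : \forall n \near \oo, forall i, (i < n)%N ->
  `|H n i (b'_ n) - H n i (b_ n)| <= (C + 1) / m * enorm (ub n) * (m * h n i).
Proof.
have [eta eta0 heta] := regular_lip rH.
move: (near_le eta0 (psi_small (bounded_cvg cwb))) near_gt0; apply: filterS2 => n un n0 i i_lt.
have uE : enorm (b'_ n - b_ n) <= eta by rewrite b'B.
apply: (le_trans (heta n i (b_ n) (b'_ n) i_lt (Bb n0) (Bb' n0) uE)).
rewrite b'B le_eqVlt; apply/orP; left; apply/eqP; field.
by rewrite gt_eqF.
Qed.

Let one_kappaE n i : (i < n)%N -> 1 - kappa n i = (H n i (b'_ n) - H n i (b_ n)) / H n i (b'_ n).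
Proof. by move=> i_lt; rewrite /kappa mulrBl divff// gt_eqF// H'0. Qed.

Let one_kappa_le : \forall n \near \oo, forall i, (i < n)%N ->
  `|1 - kappa n i| <= (C + 1) / m * enorm (ub n).
Proof.
move: kappa_le near_gt0; apply: filterS2 => n hk n0 i i_lt; rewrite one_kappaE//.
apply: (normr_quot_le (z := m * h n i)); [by rewrite mulr_gt0// h0|exact: mH (Bb' n0)| |exact: hk].
by nonneg.
Qed.

Lemma variance_ratio_max g : 0 < g -> \forall n \near \oo, forall i, (i < n)%N -> `|1 - kappa n i| <= g.
Proof.
move=> g0; have M0 : 0 <= (C + 1) / m by nonneg.
have g1 : 0 < g / ((C + 1) / m + 1) by rewrite divr_gt0// ltr_wpDl.
move: (near_le g1 (psi_small (bounded_cvg cwb))) one_kappa_le; apply: filterS2 => n un hk i i_lt.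
apply: (le_trans (hk i i_lt)); exact: (bounded_small g0 (enorm_ge0 _) un M0).
Qed.

(** Same two errors as for the drift, with one more because [1 - kappa] has the displaced variance
    as its denominator. *)
Lemma ssq_variance_ratio : ssq (fun n i => 1 - kappa n i - score_beta n i wb) n @[n --> \oo] --> 0.
Proof.
have bw := bounded_cvg cwb.
rewrite (_ : ssq _ = ssq (fun n i => (1 - kappa n i - score_beta n i (wb_ n)) +
    score_beta n i (wb_ n - wb))); last first.
  apply/funext => n; apply: eq_bigr => i _; congr (_ ^+ 2).
  by rewrite /score_beta mulmxBl dotrBl; ring.
apply: ssqD0.
  have [K hK] := ssq_yb_bounded bw; apply: (ssq0 hK) => g g0.
  have [eta eta0 heta] := regular_unif rH (mulr_gt0 m0 (divr_gt0 g0 (ltr0n R 2))).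
  pose M := ((C + 1) / m) ^+ 2.
  have M0 : 0 <= M by exact: sqr_ge0.
  have g1 : 0 < g / 2 / (M + 1) by rewrite divr_gt0 ?divr_gt0// ltr_wpDl.
  have g2 : 0 < g / 2 by rewrite divr_gt0.
  near=> n => i i_lt.
  have n0 : (0 < n)%N by near: n.
  have un : enorm (ub n) <= eta by near: n; exact: near_le (psi_small bw).
  have un2 : enorm (ub n) <= g / 2 / (M + 1) by near: n; exact: near_le (psi_small bw).
  have hk : forall i, (i < n)%N -> `|H n i (b'_ n) - H n i (b_ n)| <= (C + 1) / m * enorm (ub n) * (m * h n i).
    by near: n; exact: kappa_le.
  have hk1 : forall i, (i < n)%N -> `|1 - kappa n i| <= (C + 1) / m * enorm (ub n).
    by near: n; exact: one_kappa_le.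
  have uE : enorm (b'_ n - b_ n) <= eta by rewrite b'B.
  have [_] := heta n i (b_ n) (b'_ n) i_lt (Bb n0) (Bb' n0) uE; rewrite b'B => hT1.
  have mh : 0 < m * h n i by rewrite mulr_gt0// h0.
  rewrite /yb -/(ub n) (ger0_norm (enorm_ge0 _)).
  (* The correction for the denominator is a product of two factors of order [|ub n|], so it is
     negligible against [yb]. *)
  have -> : 1 - kappa n i - score_beta n i (wb_ n) =
      (H n i (b'_ n) - H n i (b_ n) - dotr (ub n) (grad (H n i) (b_ n))) / H n i (b_ n) -
      (H n i (b'_ n) - H n i (b_ n)) / H n i (b_ n) * (1 - kappa n i).
    rewrite one_kappaE// /score_beta -/(ub n); field.
    by rewrite !gt_eqF ?H0 ?H'0.
  rewrite (le_trans (ler_normB _ _))//.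
  apply: (@le_trans _ _ (g / 2 * enorm (ub n) + (C + 1) / m * enorm (ub n) * ((C + 1) / m * enorm (ub n)))).
    apply: lerD.
      apply: (normr_quot_le mh); [exact: mH (Bb n0)|by nonneg|].
      by apply: (le_trans hT1); rewrite le_eqVlt; apply/orP; left; apply/eqP; ring.
    rewrite normrM ler_pM//; last exact: hk1.
    by apply: (normr_quot_le mh); [exact: mH (Bb n0)|by nonneg|exact: hk].
  have hM : M * enorm (ub n) <= g / 2 by apply: bounded_small => //; exact: enorm_ge0.
  rewrite [leRHS](_ : _ = g / 2 * enorm (ub n) + g / 2 * enorm (ub n)); last by field.
  rewrite lerD2l; have -> : (C + 1) / m * enorm (ub n) * ((C + 1) / m * enorm (ub n)) =
    M * enorm (ub n) * enorm (ub n) by rewrite /M; ring.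
  by rewrite ler_wpM2r ?enorm_ge0.
have hK : \forall n \near \oo, ssq (fun n _ => (Num.sqrt (n%:R : R))^-1) n <= 1.
  apply: filterS near_gt0 => n n0; have Tn : 0 < n%:R :> R by rewrite ltr0n.
  rewrite /ssq sumr_const card_ord exprVn sqr_sqrtr ?(ltW Tn)// -[leLHS]mulr_natl.
  by rewrite divff ?gt_eqF.
apply: (ssq0 hK) => g g0.
pose M := C / m * (Num.sqrt l)^-1.
have M0 : 0 <= M by rewrite /M; nonneg.
have g1 : 0 < g / (M + 1) by rewrite divr_gt0// ltr_wpDl.
move: (near_le g1 cwb) near_gt0; apply: filterS2 => n wn n0 i i_lt.
have Tn : 0 < n%:R :> R by rewrite ltr0n.
apply: (le_trans (score_beta_le _ i_lt)).
rewrite (ger0_norm (_ : 0 <= (Num.sqrt n%:R)^-1)); last by nonneg.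
have hx : enorm ((wb_ n - wb) *m psi n) <= (Num.sqrt l)^-1 * enorm (wb_ n - wb) / Num.sqrt n%:R.
  by apply: sqrt_scale_le; rewrite ?enorm_ge0//; exact: psi_le.
apply: (@le_trans _ _ (M * enorm (wb_ n - wb) / Num.sqrt n%:R)).
  rewrite /M -!mulrA ler_wpM2l// ler_wpM2l ?invr_ge0 ?(ltW m0)//.
  by rewrite mulrA.
by rewrite ler_wpM2r ?invr_ge0 ?sqrtr_ge0//; apply: bounded_small => //; exact: enorm_ge0.
Unshelve. all: by end_near. Qed.

Let d n i := delta n i / s n i.

Let ssq_d : ssq d n @[n --> \oo] --> enorm wa ^+ 2.
Proof. by apply: (ssq_cvg ssq_drift); exact: ssq_score_alpha. Qed.

Let ssq_z : ssq (fun n i => 1 - kappa n i) n @[n --> \oo] --> 2 * enorm wb ^+ 2.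
Proof. by apply: (ssq_cvg ssq_variance_ratio); exact: ssq_score_beta. Qed.

Let near_ub (z : nat -> R) (c : R) : z n @[n --> \oo] --> c -> \forall n \near \oo, z n <= c + 1.
Proof.
move=> /cvgrPdist_le/(_ _ ltr01); apply: filterS => n.
by rewrite distrC => hn; have := ler_norm (z n - c); lra.
Qed.

Lemma ssq_linear_remainder :
  ssq (fun n i => kappa n i * d n i - score_alpha n i wa) n @[n --> \oo] --> 0.
Proof.
rewrite (_ : ssq _ = ssq (fun n i => (d n i - score_alpha n i wa) + (kappa n i - 1) * d n i)); last first.
  by apply/funext => n; apply: eq_bigr => i _; congr (_ ^+ 2); ring.
apply: ssqD0; first exact: ssq_drift.
apply: (ssq0 (near_ub ssq_d)) => g g0; apply: filterS (variance_ratio_max g0) => n hn i i_lt.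
by rewrite normrM ler_wpM2r// distrC hn.
Qed.

(** With [z = 1 - kappa], each constant is [- z^2 / 4 - d^2 / 2] up to cubic terms; the two sums of
    squares tend to [2 |wb|^2] and [|wa|^2]. *)
Lemma ratio_const_cvg : \sum_(i < n) ratio_const (kappa n i) (d n i) @[n --> \oo] -->
  - (2^-1 * (enorm wa ^+ 2 + enorm wb ^+ 2)).
Proof.
pose rem n := \sum_(i < n) ratio_const (kappa n i) (d n i) +
  (4^-1 * ssq (fun n i => 1 - kappa n i) n + 2^-1 * ssq d n).
have rem0 : rem n @[n --> \oo] --> 0.
  apply: (@cvg0_le _ _ (2 * enorm wb ^+ 2 + 1 + (enorm wa ^+ 2 + 1))) => g g0.
  (* The bound 1/2 on [|1 - kappa|] is what [ln_taylor2] requires; the bound [g] makes the cubic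
     terms small against the squares. *)
  have g1 : 0 < Num.min g 2^-1 by rewrite lt_min g0 invr_gt0 ltr0n.
  move: (near_ub ssq_z) (near_ub ssq_d) (variance_ratio_max g1); apply: filterS3 => n zK dK hk.
  apply: (@le_trans _ _ (g * (ssq (fun n i => 1 - kappa n i) n + ssq d n))); last first.
    by rewrite ler_wpM2l ?(ltW g0)// lerD.
  rewrite /rem /ssq !mulr_sumr mulrDr !mulr_sumr -!big_split/=.
  apply: (le_trans (ler_norm_sum _ _ _)); apply: ler_sum => i _.
  have := hk i (ltn_ord i); rewrite le_min => /andP[kg k2].
  set k := kappa n i in kg k2 *; set z := 1 - k; set e := d n i.
  have := ln_taylor2 (x := - z); rewrite normrN => /(_ k2).
  have -> : 1 + - z = k by rewrite /z; ring.
  rewrite opprK sqrrN => hln.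
  have -> : ratio_const k e + (4^-1 * z ^+ 2 + 2^-1 * e ^+ 2) =
      2^-1 * (ln k + z + z ^+ 2 / 2) + 2^-1 * (z * e ^+ 2).
    by rewrite /ratio_const /z; field.
  apply: (le_trans (ler_normD _ _)); rewrite !(normrM 2^-1) (normrM z) (ger0_norm (_ : 0 <= 2^-1))//.
  have z3 : `|z| ^+ 3 <= g * z ^+ 2.
    rewrite -[z ^+ 2]real_normK ?num_real// exprS ler_wpM2r ?sqr_ge0//.
  have ze : `|z| * `|e ^+ 2| <= g * e ^+ 2.
    by rewrite (ger0_norm (sqr_ge0 e)) ler_wpM2r ?sqr_ge0.
  have ge : 0 <= g * e ^+ 2 by rewrite mulr_ge0 ?sqr_ge0// ltW.
  by move: hln z3 ze ge; lra.
have hlim : 4^-1 * ssq (fun n i => 1 - kappa n i) n + 2^-1 * ssq d n @[n --> \oo] -->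
    4^-1 * (2 * enorm wb ^+ 2) + 2^-1 * enorm wa ^+ 2.
  by apply: cvgD; apply: cvgMl_tmp.
rewrite (_ : (fun n => _) = fun n => rem n - (4^-1 * ssq (fun n i => 1 - kappa n i) n + 2^-1 * ssq d n)); last first.
  by apply/funext => n; rewrite /rem addrK.
rewrite (_ : - _ = 0 - (4^-1 * (2 * enorm wb ^+ 2) + 2^-1 * enorm wa ^+ 2)); last by field.
exact: cvgB.
Qed.

End Sequences.
End LocalAsymptotics.

(** * From integrals of the coefficients to regular arrays *)

Section GradientOfLogarithm.
Context {R : realType} {k : nat}.
Implicit Types (g : 'rV[R]_k -> R) (a v : 'rV[R]_k).

Lemma is_derive_line g a v (l : R) :
  is_derive a v g l <-> is_derive (0 : R) 1 (fun y : R => g (a + y *: v)) l.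
Proof.
have e : (fun y : R => y^-1 *: (((fun y : R => g (a + y *: v)) \o shift 0) (y *: 1) - g (a + 0 *: v))) =
    (fun y : R => y^-1 *: ((g \o shift a) (y *: v) - g a)).
  apply/funext => y; rewrite /= scale0r !addr0 /GRing.scale/= mulr1.
  by rewrite [a + _]addrC.
by split=> -[dg lg]; apply: DeriveDef; rewrite ?/derivable ?/derive ?e//;
  move: dg lg; rewrite /derivable /derive e.
Qed.

Lemma is_derive_ln_comp g a v (l : R) : 0 < g a -> is_derive a v g l ->
  is_derive a v (fun x => ln (g x)) (l / g a).
Proof.
move=> g0 /is_derive_line dg; apply/is_derive_line.
have ga : g (a + 0 *: v) = g a by rewrite scale0r addr0.
have dl : is_derive (g (a + 0 *: v)) 1 (@ln R) (g (a + 0 *: v))^-1.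
  by apply: is_derive1_ln; rewrite ga.
have := is_derive1_comp dl dg; rewrite ga /GRing.scale/= mulrC => h.
exact: h.
Qed.

(** Phrased with directional derivatives of [g], which is what differentiation under the integral
    provides. *)
Lemma dotr_grad_ln g a v : 0 < g a -> (forall u, exists l, is_derive a u g l) ->
  dotr v (grad (fun x => ln (g x)) a) = dotr v (grad g a) / g a.
Proof.
move=> g0 dg; rewrite !dotrE mulr_suml; apply: eq_bigr => i _; rewrite -mulrA; congr (_ * _).
rewrite !mxE; have [l hl] := dg (delta_mx 0 i).
by have hL := is_derive_ln_comp g0 hl; rewrite !derive_val.
Qed.

End GradientOfLogarithm.

Section BorelSections.
Context {R : realType} {k : nat}.

(** The embedding [s -> (a, s)] is continuous, so it pulls joint Borel sets back to Borel sets of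
    the line. *)
Lemma borel_fun_on_section (D : set 'rV[R]_k) (g : 'rV[R]_k -> R -> R) (a : 'rV[R]_k) (t0 t1 : R) :
  borel_fun_on [set x : 'rV[R]_k * R | D x.1 /\ 0 <= x.2] (fun x => g x.1 x.2) ->
  D a -> 0 <= t0 -> measurable_fun `[t0, t1] (g a).
Proof.
move=> bg Da t00.
pose G : set (set ('rV[R]_k * R)) := [set O | open O].
have mj : measurable_fun [set: R] ((fun s => (a, s)) : R -> g_sigma_algebraType G).
  apply: (@measurability _ _ _ (g_sigma_algebraType G) _ _ G) => //.
  move=> _ [V oV <-]; rewrite setTI.
  apply: open_measurable; apply: open_comp oV => s _.
  move=> S [[S1 S2] /= [nS1 nS2] hS]; apply: filterS nS2 => z Sz; apply: hS; split => //=.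
  exact: nbhs_singleton nS1.
move=> mI U mU.
have mU' := mj measurableT _ (bg U mU).
rewrite (_ : _ `&` _ = `[t0, t1] `&` ([set: R] `&` (fun s => (a, s)) @^-1`
    ([set x : 'rV[R]_k * R | D x.1 /\ 0 <= x.2] `&` (fun x => g x.1 x.2) @^-1` U))).
  exact: measurableI.
apply/seteqP; split=> [s [sI sU]|s [sI [_ [_ sU]]]] //=.
split=> //; split=> //; split=> //; split=> //.
by move: sI; rewrite /= in_itv/= => /andP[ts _]; rewrite (le_trans t00).
Qed.

End BorelSections.

Section RegularIntegrals.
Context {R : realType} {k : nat}.
Variables (D : set 'rV[R]_k) (g : 'rV[R]_k -> R -> R) (t : nat -> nat -> R) (C : R).
Hypotheses (oD : open D) (cD : convex_set D).
Hypothesis t_ge0 : forall n i, (i <= n)%N -> 0 <= t n i.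
Hypothesis t_lt : forall n i, (i < n)%N -> t n i < t n i.+1.
Hypothesis dg : forall s, 0 <= s -> forall a, D a -> differentiable (g ^~ s) a.
Hypothesis ig : forall a n i, (i < n)%N -> D a ->
  lebesgue_measure.-integrable `[t n i, t n i.+1] (EFin \o g a).
Hypothesis gC : forall a s, D a -> 0 <= s -> enorm (grad (g ^~ s) a) <= C.
Hypothesis ug : forall gamma, 0 < gamma -> exists2 eta, 0 < eta & forall a a', D a -> D a' ->
  enorm (a - a') <= eta -> forall s, 0 <= s -> enorm (grad (g ^~ s) a - grad (g ^~ s) a') <= gamma.

Let nonneg_itv n i s : (i < n)%N -> s \in `[t n i, t n i.+1] -> 0 <= s.
Proof.
move=> i_lt; rewrite in_itv/= => /andP[ts _].
by rewrite (le_trans _ ts)// t_ge0// ltnW.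
Qed.

Let ug_itv n i gamma : (i < n)%N -> 0 < gamma ->
  exists2 eta, 0 < eta & equicontinuous_grad D g (t n i) (t n i.+1) eta gamma.
Proof.
move=> i_lt g0; have [eta eta0 h] := ug g0; exists eta => // a a' Da Da' aa' s sI.
by apply: h => //; exact: nonneg_itv sI.
Qed.

Let dg_itv n i : (i < n)%N -> forall s, s \in `[t n i, t n i.+1] -> forall a, D a -> differentiable (g ^~ s) a.
Proof. by move=> i_lt s sI b Db; apply: dg => //; exact: nonneg_itv sI. Qed.

Let gC_itv n i : (i < n)%N -> forall a s, D a -> s \in `[t n i, t n i.+1] -> enorm (grad (g ^~ s) a) <= C.
Proof. by move=> i_lt b s Db sI; apply: gC => //; exact: nonneg_itv sI. Qed.

Lemma derive_regular_integral n i a v : (i < n)%N -> D a ->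
  exists l, is_derive a v (fun a => \int[lebesgue_measure]_(s in `[t n i, t n i.+1]) g a s) l.
Proof.
move=> i_lt Da; exists (\int[lebesgue_measure]_(s in `[t n i, t n i.+1]) dotr v (grad (g ^~ s) a)).
exact: (derive_Rintegral oD cD (ltW (t_lt i_lt)) (dg_itv i_lt) (fun b => ig i_lt) (gC_itv i_lt)
  (fun gamma => ug_itv i_lt)).
Qed.

Lemma regular_integral : regular_array D (fun n i => t n i.+1 - t n i) C
  (fun n i a => \int[lebesgue_measure]_(s in `[t n i, t n i.+1]) g a s).
Proof.
split=> [n i a v i_lt Da|gamma g0].
  exact: (dotr_grad_le oD cD (ltW (t_lt i_lt)) (dg_itv i_lt) (fun b => ig i_lt) (gC_itv i_lt)
    (fun gamma => ug_itv i_lt)).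
have [eta eta0 h] := ug g0; exists eta => // n i a a' i_lt Da Da' aa'.
have ue : equicontinuous_grad D g (t n i) (t n i.+1) eta gamma.
  by move=> b b' Db Db' bb' s sI; apply: h => //; exact: nonneg_itv sI.
split=> [v|].
  exact: (dotr_grad_dist_le oD cD (ltW (t_lt i_lt)) (dg_itv i_lt) (fun b => ig i_lt) (gC_itv i_lt)
    (fun gamma => ug_itv i_lt) v ue Da' Da aa').
exact: (Rintegral_taylor oD cD (ltW (t_lt i_lt)) (dg_itv i_lt) (fun b => ig i_lt) (gC_itv i_lt)
  (fun gamma => ug_itv i_lt) ue Da Da' aa').
Qed.

End RegularIntegrals.

(** * The coefficients of the model *)

Section Coefficients.
Context {R : realType} {p q : nat}.
Variables (A : set 'rV[R]_p) (B : set 'rV[R]_q).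
Variables (f : 'rV[R]_p -> R -> R) (sigma : 'rV[R]_q -> R -> R).
Variable t : nat -> nat -> R.
Variables (Jp : 'rV[R]_p -> 'rV[R]_q -> 'M[R]_p) (Jq : 'rV[R]_q -> 'M[R]_q).
Implicit Types (n i : nat) (th : 'rV[R]_(p + q)).

(** Intervals are numbered from 0, to match ordinals: index [i] stands for [[t n i, t n i.+1]], the
    interval of the observation [i.+1]. *)
Definition drift n i := F_ f t n i.+1.
Definition vol n i := G_ sigma t n i.+1.
Definition vol2 n i (b : 'rV[R]_q) : R := vol n i b ^+ 2.
Definition step n i : R := t n i.+1 - t n i.

Definition rate_alpha n th := inv_sqrtmx (horizon t n *: Jp (lsubmx th) (rsubmx th)).
Definition rate_beta n th := inv_sqrtmx (n%:R *: Jq (rsubmx th)).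

Definition lin_coef n th i (x : 'rV[R]_p) : R :=
  dotr (x *m rate_alpha n th) (grad (drift n i) (lsubmx th)) / vol n i (rsubmx th).
Definition quad_coef n th i (y : 'rV[R]_q) : R :=
  dotr (y *m rate_beta n th) (grad (vol2 n i) (rsubmx th)) / vol2 n i (rsubmx th).

Lemma mul_Phi n th (w : 'rV[R]_(p + q)) : w *m Phi t Jp Jq n th =
  row_mx (lsubmx w *m rate_alpha n th) (rsubmx w *m rate_beta n th).
Proof.
by rewrite -{1}(hsubmxK w) /Phi mul_row_block !mulmx0 addr0 add0r.
Qed.

Hypotheses (oA : open A) (cA : convex_set A) (oB : open B) (cB : convex_set B).
Hypothesis bsigma : borel_fun_on [set x : 'rV[R]_q * R | B x.1 /\ 0 <= x.2] (fun x => sigma x.1 x.2).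
Hypothesis t0 : forall n, t n 0%N = 0.
Hypothesis t_lt : forall n i, (i < n)%N -> t n i < t n i.+1.
Hypothesis hmesh : exists M, forall n, mesh t n <= M.
Hypotheses (cA1 : condA1 f sigma A B) (cA2 : condA2 f sigma A B) (cA3 : condA3 f sigma t A B Jp Jq).

Lemma t_ge0 n i : (i <= n)%N -> 0 <= t n i.
Proof.
by move=> i_le; rewrite -(t0 n) (step_mono (m := n))// => j /(t_lt (n := n))/ltW.
Qed.

Lemma step_gt0 n i : (i < n)%N -> 0 < step n i.
Proof. by move=> i_lt; rewrite subr_gt0 t_lt. Qed.

Lemma sum_step n : \sum_(i < n) step n i = horizon t n.
Proof.
rewrite /horizon; have := telescope_sumr (t n) (leq0n n); rewrite t0 subr0 => <-.
by rewrite big_mkord.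
Qed.

Lemma step_le : exists hmax : R, forall n i, (i < n)%N -> step n i <= hmax.
Proof.
have [M hM] := hmesh; exists M => n i i_lt; apply: le_trans (hM n).
rewrite /mesh big_add1 big_mkord.
exact: (le_bigmax 0 (fun i : 'I_n => step n i) (Ordinal i_lt)).
Qed.

Lemma vol2E : vol2 = fun n i b => \int[lebesgue_measure]_(s in `[t n i, t n i.+1]) (sigma b s ^+ 2).
Proof.
apply/funext => n; apply/funext => i; apply/funext => b.
by rewrite /vol2 /vol /G_ sqr_sqrtr//; apply: Rintegral_ge0 => s _; exact: sqr_ge0.
Qed.

Lemma sqrt_vol2 n i b : Num.sqrt (vol2 n i b) = vol n i b.
Proof. by rewrite /vol2 sqrtr_sqr ger0_norm// sqrtr_ge0. Qed.

Lemma itv_nonneg n i s : (i < n)%N -> s \in `[t n i, t n i.+1] -> 0 <= s.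
Proof.
move=> i_lt; rewrite in_itv/= => /andP[ts _].
by rewrite (le_trans _ ts)// t_ge0// ltnW.
Qed.

Lemma drift_integrable n i a : (i < n)%N -> A a ->
  lebesgue_measure.-integrable `[t n i, t n i.+1] (EFin \o f a).
Proof.
move=> i_lt Aa; have [iF _ _ _] := cA2.
have ti : 0 <= t n i.+1 by rewrite t_ge0.
apply: integrableS (iF a Aa _ ti) => // s /= sI; have := itv_nonneg i_lt sI.
by move: sI; rewrite !in_itv/= => /andP[_ ->] ->.
Qed.

Lemma measurable_sigma n i b : (i < n)%N -> B b -> measurable_fun `[t n i, t n i.+1] (sigma b).
Proof. by move=> i_lt Bb; apply: (borel_fun_on_section bsigma Bb); rewrite t_ge0// ltnW. Qed.

Lemma sigma2_integrable n i b : (i < n)%N -> B b ->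
  lebesgue_measure.-integrable `[t n i, t n i.+1] (EFin \o (fun s => sigma b s ^+ 2)).
Proof.
move=> i_lt Bb; have [_ [m [M [m0 hM]]] _ _] := cA2.
apply: (@integrable_itv_bounded _ _ _ _ M).
  by apply: measurable_funX; exact: measurable_sigma.
move=> s sI; rewrite ger0_norm ?sqr_ge0//.
by case/andP: (hM b s Bb (itv_nonneg i_lt sI)).
Qed.

Lemma vol2_ge : exists2 m : R, 0 < m & forall n i b, (i < n)%N -> B b -> m * step n i <= vol2 n i b.
Proof.
have [_ [m [M [m0 hM]]] _ _] := cA2; exists m => // n i b i_lt Bb.
rewrite vol2E; apply: Rintegral_itv_ge; first exact: ltW (t_lt i_lt).
  exact: sigma2_integrable.
by move=> s sI; case/andP: (hM b s Bb (itv_nonneg i_lt sI)).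
Qed.

Lemma vol2_gt0 n i b : (i < n)%N -> B b -> 0 < vol2 n i b.
Proof.
have [m m0 hm] := vol2_ge => i_lt Bb; apply: lt_le_trans (hm n i b i_lt Bb).
by rewrite mulr_gt0// step_gt0.
Qed.

Lemma vol_gt0 n i b : (i < n)%N -> B b -> 0 < vol n i b.
Proof. by move=> i_lt Bb; rewrite -sqrt_vol2 sqrtr_gt0 vol2_gt0. Qed.

Hypotheses (A_ex : exists a, A a) (B_ex : exists b, B b).

(** A1 quantifies over both parameters at once, so the part about [f] is extracted by taking the
    same point of [B] twice. *)
Lemma grad_f_unif gamma : 0 < gamma -> exists2 eta, 0 < eta & forall a a', A a -> A a' ->
  enorm (a - a') <= eta -> forall s, 0 <= s -> enorm (grad (f ^~ s) a - grad (f ^~ s) a') <= gamma.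
Proof.
move=> g0; have [_ _ _ /(_ _ g0)[eta eta0 h]] := cA1; exists eta => // a a' Aa Aa' aa' s s0.
have [b Bb] := B_ex; have [|h1 _] := h a a' b b Aa Aa' Bb Bb aa'; last exact: h1.
by rewrite subrr enorm0 ltW.
Qed.

Lemma grad_sigma2_unif gamma : 0 < gamma -> exists2 eta, 0 < eta & forall b b', B b -> B b' ->
  enorm (b - b') <= eta -> forall s, 0 <= s ->
  enorm (grad (fun c => sigma c s ^+ 2) b - grad (fun c => sigma c s ^+ 2) b') <= gamma.
Proof.
move=> g0; have [_ _ _ /(_ _ g0)[eta eta0 h]] := cA1; exists eta => // b b' Bb Bb' bb' s s0.
have [a Aa] := A_ex; have [|//|_ h1] := h a a b b' Aa Aa Bb Bb'; first by rewrite subrr enorm0 ltW.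
by apply: le_trans (h1 s s0); rewrite lerDl opnorm_ge0.
Qed.

Lemma regular_coefs : exists C : R, [/\ 0 <= C, regular_array A step C drift & regular_array B step C vol2].
Proof.
have [_ _ [C1 hC1] [C2 hC2]] := cA2; have [df ds _ _] := cA1.
exists (Num.max 0 (Num.max C1 C2)); split; first by rewrite le_max lexx.
  apply: (@regular_integral _ _ A f t _ oA cA t_ge0 t_lt df) => //.
  - by move=> a n i i_lt Aa; exact: drift_integrable.
  - by move=> a s Aa s0; rewrite !le_max hC1// orbT.
  - exact: grad_f_unif.
rewrite vol2E.
apply: (@regular_integral _ _ B (fun b s => sigma b s ^+ 2) t _ oB cB t_ge0 t_lt ds) => //.
- by move=> b n i i_lt Bb; exact: sigma2_integrable.
- by move=> b s Bb s0; rewrite !le_max hC2// !orbT.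
- exact: grad_sigma2_unif.
Qed.

Lemma dotr_grad_ln_vol2 n i b v : (i < n)%N -> B b ->
  dotr v (grad (fun b => ln (vol2 n i b)) b) = dotr v (grad (vol2 n i) b) / vol2 n i b.
Proof.
move=> i_lt Bb; apply: dotr_grad_ln; first exact: vol2_gt0.
move=> u; rewrite vol2E; have [_ _ _ [C2 hC2]] := cA2; have [df ds _ _] := cA1.
apply: (@derive_regular_integral _ _ B (fun b s => sigma b s ^+ 2) t C2 oB cB t_ge0 t_lt ds) => //.
- by move=> c j k j_lt Bc; exact: sigma2_integrable.
- exact: grad_sigma2_unif.
Qed.

Lemma bform_opnorm_le k (M N : 'M[R]_k) e v : opnorm (M - N) <= e ->
  `|bform M v v - bform N v v| <= e * enorm v ^+ 2.
Proof.
move=> h; rewrite -bform_mxB; apply: (le_trans (opbound_opnorm _ _ _)).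
by rewrite -expr2 ler_wpM2r ?sqr_ge0.
Qed.

Lemma qform_alpha_cvg e : 0 < e -> \forall n \near \oo, forall a b, A a -> B b ->
  forall v, `|qform_alpha (horizon t) drift vol2 n a b v - bform (Jp a b) v v| <= e * enorm v ^+ 2.
Proof.
have [_ _ h _] := cA3 => /h; apply: filterS => n hn a b Aa Bb v.
have -> : qform_alpha (horizon t) drift vol2 n a b v = bform (info_alpha f sigma t n a b) v v.
  rewrite /info_alpha bform_mxZ bform_sum big_add1 big_mkord; congr (_ * _).
  by apply: eq_bigr => i _; rewrite bform_mxZ bform_outer mulrC -expr2.
by apply: bform_opnorm_le; exact: hn.
Qed.

Lemma qform_beta_cvg e : 0 < e -> \forall n \near \oo, forall b, B b ->
  forall v, `|qform_beta vol2 n b v - bform (Jq b) v v| <= e * enorm v ^+ 2.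
Proof.
have [_ _ _ h] := cA3 => /h; apply: filterS => n hn b Bb v.
have -> : qform_beta vol2 n b v = bform (info_beta sigma t n b) v v.
  rewrite /info_beta bform_mxZ bform_sum big_add1 big_mkord; congr (_ * _).
  apply: eq_bigr => i _; rewrite bform_outer -expr2; congr (_ ^+ 2).
  by rewrite -[RHS]/(dotr v (grad (fun b => ln (vol2 n i b)) b)) dotr_grad_ln_vol2.
by apply: bform_opnorm_le; exact: hn.
Qed.

End Coefficients.

(** * Sums of quadratic functions of independent normal variables *)

Section NormalSums.
Context {R : realType}.
Local Notation RR := (measurableTypeR R).
Variables (mu : nat -> probability RR R) (m s : nat -> R).
Hypothesis s0 : forall i, 0 < s i.
Hypothesis muS : forall i, mu i.+1 = normal_prob (m i) (s i).

Definition quad_sum n (a b : nat -> R) (y : n.+1.-tuple R) : R :=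
  \sum_(i < n) quad_form (m i) (s i) (a i) (b i) (tnth y (lift ord0 i)).

Let zform (a b : nat -> R) i x : R := if i is j.+1 then quad_form (m j) (s j) (a j) (b j) x else 0.
Let shift (v : nat -> R) i : R := if i is j.+1 then v j else 0.

Let measurable_zform a b i : measurable_fun [set: R] (zform a b i).
Proof. by case: i => [|i]; [exact: measurable_cst|exact: measurable_quad_form]. Qed.

Let quad_sumE n a b (y : n.+1.-tuple R) : quad_sum a b y = coord_sum (zform a b) y.
Proof. by rewrite /coord_sum big_ord_recl add0r. Qed.

Let sum_shift n (v : nat -> R) : \sum_(i < n.+1) shift v i = \sum_(i < n) v i.
Proof. by rewrite big_ord_recl add0r. Qed.

Lemma measurable_quad_sum n a b : measurable_fun [set: n.+1.-tuple R] (@quad_sum n a b).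
Proof.
rewrite (_ : @quad_sum n a b = coord_sum (zform a b)); last exact/funext/quad_sumE.
exact: measurable_coord_sum.
Qed.

Lemma quad_sum_cos n (a b : nat -> R) (c : R) :
  `|\int[tprod mu n.+1]_y cos (c + quad_sum a b y)
    - cos c * expR (- ((\sum_(i < n) (a i ^+ 2 + 2 * b i ^+ 2)) / 2))|
  <= 2 * \sum_(i < n) (14 * (`|a i| + `|b i|) ^+ 3 + (`|a i| + `|b i|) ^+ 4).
Proof.
rewrite -(sum_shift n (fun i => a i ^+ 2 + 2 * b i ^+ 2)).
rewrite -(sum_shift n (fun i => 14 * (`|a i| + `|b i|) ^+ 3 + (`|a i| + `|b i|) ^+ 4)).
under eq_Rintegral do rewrite quad_sumE.
apply: tprod_cos => //.
- by case=> [|i] /=; [|apply: addr_ge0; [|apply: mulr_ge0 => //]; exact: sqr_ge0].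
- case=> [|i] /=; last by rewrite muS; exact: quad_form_cos.
  under eq_Rintegral do rewrite cos0.
  by rewrite Rintegral_prob_cst mul0r oppr0 expR0 subrr normr0.
- case=> [|i] /=; last by rewrite muS; exact: quad_form_sin.
  under eq_Rintegral do rewrite sin0.
  by rewrite Rintegral_prob_cst normr0.
Qed.

Lemma quad_sum_sqr n (a b : nat -> R) (c : R) :
  (\int[tprod mu n.+1]_y ((c + quad_sum a b y) ^+ 2)%:E =
   (c ^+ 2 + \sum_(i < n) (a i ^+ 2 + 2 * b i ^+ 2))%:E)%E.
Proof.
rewrite -(sum_shift n (fun i => a i ^+ 2 + 2 * b i ^+ 2)).
under eq_integral do rewrite quad_sumE.
have i0 : (mu 0%N).-integrable [set: RR] (EFin \o (fun=> 0)).
  by apply: (@integrable_bounded _ _ R (mu 0%N) (fun=> 0) 0) => // x; rewrite normr0.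
apply: tprod_sqr => //.
- by case=> [|i] //=; rewrite muS; exact: quad_form_integrable.
- case=> [|i] /=; last by rewrite muS; exact: quad_form_sqr_integrable.
  by apply: eq_integrable i0 => // x _; rewrite /= expr0n.
- case=> [|i] /=; last by rewrite muS; exact: quad_form_mean.
  exact: Rintegral_prob_cst.
- case=> [|i] /=; last by rewrite muS; exact: quad_form_variance.
  under eq_Rintegral do rewrite expr0n.
  exact: Rintegral_prob_cst.
Qed.

End NormalSums.

Lemma eq_law_ge0_integral d1 d2 (T1 : measurableType d1) (T2 : measurableType d2) (R : realType)
    (P : probability T1 R) (Z : T1 -> T2) (Q : probability T2 R) (g : T2 -> R) :
  measurable_fun [set: T1] Z -> measurable_fun [set: T2] g -> (forall x, 0 <= g x) ->
  (forall A, measurable A -> P (Z @^-1` A) = Q A) ->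
  (\int[P]_w (g (Z w))%:E = \int[Q]_y (g y)%:E)%E.
Proof.
move=> mZ mg g0 h; pose ZZ : {mfun T1 >-> T2} := mfun_Sub (mem_set mZ).
transitivity (\int[distribution P ZZ]_y (EFin \o g) y)%E.
  by rewrite ge0_integral_distribution//; exact/measurable_EFinP.
by apply: eq_measure_integral => A mA _; exact: h.
Qed.

Lemma chebyshev_sqr d (T : measurableType d) (R : realType) (P : probability T R) (Z : T -> R) (e v : R) :
  0 < e -> measurable_fun [set: T] Z -> (\int[P]_w (Z w ^+ 2)%:E <= v%:E)%E ->
  (P [set w | (e < `|Z w|)%R] <= (v / e ^+ 2)%:E)%E.
Proof.
move=> e0 mZ hv; set A := [set w | _].
have mA : measurable A.
  rewrite -[A]setTI; apply: (measurable_fun_ltr (measurable_cst e)) => //.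
  exact: measurableT_comp.
have e2 : 0 < e ^+ 2 by rewrite exprn_gt0.
have mZ2 : measurable_fun [set: T] (fun w => (Z w ^+ 2)%:E).
  by apply/measurable_EFinP; exact: measurable_funX.
have h : ((e ^+ 2)%:E * P A <= v%:E)%E.
  apply: le_trans hv; rewrite -integral_cst//.
  apply: (@le_trans _ _ (\int[P]_(w in A) (Z w ^+ 2)%:E)%E).
    apply: ge0_le_integral => //.
    - by move=> w _; rewrite lee_fin ltW.
    - exact: measurable_funTS.
    - move=> w; rewrite /A/= => hw; rewrite lee_fin -(real_normK (num_real (Z w))).
      by rewrite lerXn2r ?nnegrE ?(ltW e0)// ltW.
  by apply: ge0_subset_integral => // w _; rewrite lee_fin sqr_ge0.
have PA : P A \is a fin_num by exact: fin_num_measure.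
by move: h; rewrite -(fineK PA) -EFinM !lee_fin ler_pdivlMr// mulrC.
Qed.

(** * The score and the remainder *)

Section Score.
Context {R : realType} {p q : nat}.
Variables (A : set 'rV[R]_p) (B : set 'rV[R]_q).
Variables (f : 'rV[R]_p -> R -> R) (sigma : 'rV[R]_q -> R -> R).
Variable t : nat -> nat -> R.
Variables (Jp : 'rV[R]_p -> 'rV[R]_q -> 'M[R]_p) (Jq : 'rV[R]_q -> 'M[R]_q).
Implicit Types (n i : nat) (th : 'rV[R]_(p + q)).

Definition residual n th i (x : R) : R := (x - drift f t n i (lsubmx th)) / vol sigma t n i (rsubmx th).

Definition score n th (y : n.+1.-tuple R) : 'rV[R]_(p + q) :=
  row_mx
    (\sum_(i < n) (residual n th i (tnth y (lift ord0 i)) / vol sigma t n i (rsubmx th))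
       *: (grad (drift f t n i) (lsubmx th) *m rate_alpha t Jp n th))
    (2^-1 *: \sum_(i < n) (residual n th i (tnth y (lift ord0 i)) ^+ 2 - 1)
       *: (grad (fun b => ln (vol2 sigma t n i b)) (rsubmx th) *m rate_beta Jq n th)).

Lemma measurable_score n th j : measurable_fun [set: n.+1.-tuple R] (fun y => score th y 0 j).
Proof.
have mr (i : 'I_n) : measurable_fun [set: n.+1.-tuple R] (fun y => residual n th i (tnth y (lift ord0 i))).
  apply: measurable_funM => //; apply: measurable_funB => //; exact: measurable_tnth.
have [k ->|k ->] := split_ordP j.
  under eq_fun do rewrite row_mxEl summxE.
  apply: measurable_sum => i; under eq_fun do rewrite mxE.
  by apply: measurable_funM => //; exact: measurable_funM.
under eq_fun do rewrite row_mxEr mxE summxE.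
apply: measurable_funM => //; apply: measurable_sum => i; under eq_fun do rewrite mxE.
apply: measurable_funM => //; apply: measurable_funB => //; exact: measurable_funX.
Qed.

(* Standard deviations beyond the last observation are irrelevant; 1 keeps them positive. *)
Definition sd n th i : R := if (i < n)%N then vol sigma t n i (rsubmx th) else 1.

Definition mean n th i : R := drift f t n i (lsubmx th).

(** The law of the initial value is a parameter, so that the laws for two values of theta can share
    it literally. *)
Definition obs_law (nu : probability (measurableTypeR R) R) n th i : probability (measurableTypeR R) R :=
  if i is j.+1 then normal_prob (mean n th j) (sd n th j) else nu.

Hypotheses (oB : open B) (cB : convex_set B).
Hypothesis bsigma : borel_fun_on [set x : 'rV[R]_q * R | B x.1 /\ 0 <= x.2] (fun x => sigma x.1 x.2).
Hypothesis t0 : forall n, t n 0%N = 0.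
Hypothesis t_lt : forall n i, (i < n)%N -> t n i < t n i.+1.
Hypotheses (cA1 : condA1 f sigma A B) (cA2 : condA2 f sigma A B) (cA3 : condA3 f sigma t A B Jp Jq).

Let horizon_gt0 n : (0 < n)%N -> 0 < horizon t n.
Proof.
case: n => // n _; rewrite /horizon -(t0 n.+1).
have := step_mono (m := n.+1) (u := t n.+1) (fun i h => ltW (t_lt h)) (i := 1%N) (j := n.+1).
by rewrite leqnn => /(_ isT); apply: lt_le_trans; exact: t_lt.
Qed.

Lemma sd_gt0 n th i : Theta A B th -> 0 < sd n th i.
Proof.
move=> [_ Bth]; rewrite /sd; case: ifP => // i_lt.
exact: (vol_gt0 bsigma t0 t_lt cA2 i_lt Bth).
Qed.

Lemma rate_alpha_sym n th : (0 < n)%N -> Theta A B th -> (rate_alpha t Jp n th)^T = rate_alpha t Jp n th.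
Proof.
move=> n0 [Ath Bth]; have [pJ _ _ _] := cA3.
by have [[]] := inv_sqrtmxP (posdefZ (horizon_gt0 n0) (pJ _ _ Ath Bth)).
Qed.

Lemma rate_beta_sym n th : (0 < n)%N -> Theta A B th -> (rate_beta Jq n th)^T = rate_beta Jq n th.
Proof.
move=> n0 [Ath Bth]; have [_ pJ _ _] := cA3; have n1 : 0 < n%:R :> R by rewrite ltr0n.
by have [[]] := inv_sqrtmxP (posdefZ n1 (pJ _ Bth)).
Qed.

Lemma dotr_row_mx (u : 'rV[R]_(p + q)) (x : 'rV[R]_p) (y : 'rV[R]_q) :
  dotr u (row_mx x y) = dotr (lsubmx u) x + dotr (rsubmx u) y.
Proof.
rewrite !dotrE big_split_ord /=; congr (_ + _); apply: eq_bigr => i _.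
  by rewrite row_mxEl !mxE.
by rewrite row_mxEr !mxE.
Qed.

Hypothesis A_ex : exists a, A a.

(** The rates are symmetric, so they move from the gradients to [u]; the gradient of the logarithm
    becomes a quotient, and the factor 1/2 goes into the quadratic coefficient. *)
Lemma dotr_score n th (u : 'rV[R]_(p + q)) (y : n.+1.-tuple R) : (0 < n)%N -> Theta A B th ->
  dotr u (score th y) = quad_sum (mean n th) (sd n th)
    (fun i => lin_coef f sigma t Jp n th i (lsubmx u))
    (fun i => quad_coef sigma t Jq n th i (rsubmx u) / 2) y.
Proof.
move=> n0 Tth; have [Ath Bth] := Tth.
rewrite /score dotr_row_mx dotrZr !dotr_sumr mulr_sumr -big_split/=; apply: eq_bigr => i _.
rewrite !dotrZr (dotr_mulmx_sym _ _ (rate_alpha_sym n0 Tth)) (dotr_mulmx_sym _ _ (rate_beta_sym n0 Tth)).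
rewrite (dotr_grad_ln_vol2 oB cB bsigma t0 t_lt cA1 cA2 A_ex _ (ltn_ord i) Bth).
rewrite /quad_form /lin_coef /quad_coef /mean /sd ltn_ord /residual.
have v0 := vol_gt0 bsigma t0 t_lt cA2 (ltn_ord i) Bth.
have v20 := vol2_gt0 bsigma t0 t_lt cA2 (ltn_ord i) Bth.
by field; rewrite !gt_eqF.
Qed.

Section Law.
Context {dO : measure_display} {Om : measurableType dO}.
Variables (P : 'rV[R]_(p + q) -> probability Om R) (X : R -> {mfun Om >-> R}) (W : 'rV[R]_(p + q) -> R -> Om -> R).
Hypothesis hproc : forall th, Theta A B th ->
    [/\ wiener_process (P th) (W th),
        solves_sde (P th) (W th) (fun s => X s) (f (lsubmx th)) (sigma (rsubmx th)) &
        independent_of_process (P th) (X 0) (W th)].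
Hypothesis hX0 : forall th th', Theta A B th -> Theta A B th' ->
    forall U : set R, measurable U -> P th (X 0 @^-1` U) = P th' (X 0 @^-1` U).

(** The initial law is taken under a reference parameter [th0]; this is legitimate because it does
    not depend on theta, and lets it cancel in the likelihood ratio. *)
Lemma obs_lawE n th0 th E : Theta A B th0 -> Theta A B th -> measurable E ->
  Pn t P X n th E = tprod (obs_law (distribution (P th0) (initial (X 0))) n th) n.+1 E.
Proof.
move=> Tth0 Tth; have [Ath Bth] := Tth; have [wW sde iW] := hproc Tth.
apply: (wiener_integrals_law wW iW (t := t n) (b := f (lsubmx th)) (g := sigma (rsubmx th)) (X := X)) => //.
- by rewrite t0.
- by move=> i i_lt; exact: ltW (t_lt i_lt).
- by move=> i i_lt; exact: (measurable_sigma bsigma t0 t_lt i_lt Bth).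
- by move=> i i_lt; exact: (sigma2_integrable bsigma t0 t_lt cA2 i_lt Bth).
- by move=> w; rewrite tnth_mktuple.
- by move=> w i; rewrite tnth_mktuple.
- by move=> U mU; rewrite -(hX0 Tth0 Tth mU).
- by move=> i i_lt; have := vol2_gt0 bsigma t0 t_lt cA2 i_lt Bth; rewrite vol2E.
- by move=> i i_lt; rewrite /obs_law /sd i_lt.
Qed.

Lemma log_likelihoodE n th th' : (0 < n)%N -> Theta A B th -> Theta A B th' ->
  let l y := \sum_(i < n) log_ratio (mean n th i) (sd n th i) (mean n th' i) (sd n th' i) (tnth y (lift ord0 i)) in
  measurable_fun [set: n.+1.-tuple R] (fun y => ln (fine (Radon_Nikodym
     (charge_of_finite_measure (Pn t P X n th')) (Pn t P X n th) y))) /\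
  {ae Pn t P X n th, forall y, ln (fine (Radon_Nikodym
     (charge_of_finite_measure (Pn t P X n th')) (Pn t P X n th) y)) = l y}.
Proof.
move=> n0 Tth Tth' l; apply: ln_Radon_Nikodym.
  apply: measurable_sum => i; apply: (measurableT_comp (measurable_log_ratio _ _ _ _)).
  exact: measurable_tnth.
move=> E mE; rewrite (obs_lawE Tth Tth' mE).
rewrite (@tprod_normal_density _ n (obs_law (distribution (P th) (initial (X 0))) n th) _
  (mean n th) (sd n th) (mean n th') (sd n th'))//.
- by apply: eq_measure_integral => D mD _; apply/esym; exact: obs_lawE.
- by move=> i; exact: sd_gt0.
- by move=> i; exact: sd_gt0.
Qed.

End Law.
End Score.

(** Again the product estimate [tprod_cos] with zero error. *)
Lemma std_normal_cos (R : realType) d (c : R) (u : 'rV[R]_d) :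
  \int[std_normal d]_y cos (c + dotr u (row_of_tuple y)) = cos c * expR (- (enorm u ^+ 2 / 2)).
Proof.
rewrite std_normal_tprod.
pose v i : R := if insub i is Some j then u 0 j else 0.
have vE (j : 'I_d) : v j = u 0 j by rewrite /v valK.
have := @tprod_cos R (fun=> normal_prob 0 1) d (fun i x => v i * x) (fun i => v i ^+ 2) (fun=> 0) c.
have -> : \sum_(i < d) v i ^+ 2 = enorm u ^+ 2.
  by rewrite enorm_sqr dotrE; apply: eq_bigr => i _; rewrite vE expr2.
have -> : 2 * \sum_(i < d) 0 = 0 :> R by rewrite big1// mulr0.
move=> h.
apply/eqP; rewrite -subr_eq0 -normr_le0.
rewrite (_ : \int[_]_y _ = \int[tprod (fun=> normal_prob 0 1) d]_y cos (c + coord_sum (fun i x => v i * x) y)).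
  apply: h.
  - by move=> i; exact: measurable_funM.
  - by move=> i; exact: sqr_ge0.
  - move=> i; have := normal_cos 0 (@ltr01 R) 0 (v i); under eq_Rintegral do rewrite add0r subr0.
    by move=> ->; rewrite cos0 expr1n !mul1r subrr normr0.
  - move=> i; have := normal_sin 0 (@ltr01 R) 0 (v i); under eq_Rintegral do rewrite add0r subr0.
    by move=> ->; rewrite sin0 mul0r normr0.
apply: eq_Rintegral => y _; congr (cos (_ + _)); rewrite dotrE; apply: eq_bigr => i _.
by rewrite vE mxE.
Qed.

(** A Lyapunov argument: uniformly small coefficients make the cubes negligible against the squares,
    whose sums converge. *)
Lemma quad_error_cvg (R : realType) (a b : nat -> nat -> R) (la lb : R) :
  ssq a n @[n --> \oo] --> la -> ssq b n @[n --> \oo] --> lb ->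
  (forall g, 0 < g -> \forall n \near \oo, forall i, (i < n)%N -> `|a n i| <= g) ->
  (forall g, 0 < g -> \forall n \near \oo, forall i, (i < n)%N -> `|b n i| <= g) ->
  2 * \sum_(i < n) (14 * (`|a n i| + `|b n i|) ^+ 3 + (`|a n i| + `|b n i|) ^+ 4) @[n --> \oo] --> 0.
Proof.
(* With [r = |a| + |b| <= 1] and [r <= g]: [2 (14 r^3 + r^4) <= 30 r^3 <= 30 g r^2 <= 60 g (a^2 +
   b^2)]. *)
move=> ca cb ma mb; apply: (@cvg0_le _ _ (60 * (la + 1 + (lb + 1)))) => g g0.
have g1 : 0 < Num.min (g / 2) 2^-1 by rewrite lt_min divr_gt0//= invr_gt0.
near=> n.
have hA : ssq a n <= la + 1.
  near: n; move/cvgrPdist_le: ca => /(_ _ ltr01); apply: filterS => n.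
  by rewrite distrC => hn; have := ler_norm (ssq a n - la); lra.
have hB : ssq b n <= lb + 1.
  near: n; move/cvgrPdist_le: cb => /(_ _ ltr01); apply: filterS => n.
  by rewrite distrC => hn; have := ler_norm (ssq b n - lb); lra.
have hma : forall i, (i < n)%N -> `|a n i| <= Num.min (g / 2) 2^-1 by near: n; exact: ma.
have hmb : forall i, (i < n)%N -> `|b n i| <= Num.min (g / 2) 2^-1 by near: n; exact: mb.
rewrite ger0_norm; last first.
  by rewrite mulr_ge0// sumr_ge0.
apply: (@le_trans _ _ (60 * g * (ssq a n + ssq b n))); last first.
  have -> : g * (60 * (la + 1 + (lb + 1))) = 60 * g * (la + 1 + (lb + 1)) by ring.
  by rewrite ler_wpM2l ?lerD// mulr_ge0// ltW.
rewrite mulr_sumr [leRHS](_ : _ = \sum_(i < n) 60 * g * (a n i ^+ 2 + b n i ^+ 2)); last first.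
  by rewrite /ssq -big_split/= mulr_sumr.
apply: ler_sum => i _.
have := hma i (ltn_ord i); have := hmb i (ltn_ord i); rewrite !le_min => /andP[b1 b2] /andP[a1 a2].
set x := `|a n i| in a1 a2 *; set y := `|b n i| in b1 b2 *.
rewrite -(real_normK (num_real (a n i))) -(real_normK (num_real (b n i))) -/x -/y.
have x0 : 0 <= x by exact: normr_ge0.
have y0 : 0 <= y by exact: normr_ge0.
set r := x + y; have r0 : 0 <= r by rewrite addr_ge0.
have rg : r <= g by rewrite /r; lra.
have r1 : r <= 1 by rewrite /r; lra.
have r2 : r ^+ 2 <= 2 * (x ^+ 2 + y ^+ 2).
  by rewrite /r; have := sqr_ge0 (x - y); nra.
have r3 : r ^+ 3 <= g * r ^+ 2 by rewrite exprS ler_wpM2r ?sqr_ge0.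
have r4 : r ^+ 4 <= r ^+ 3 by rewrite exprS ler_piMl// exprn_ge0.
have : g * r ^+ 2 <= g * (2 * (x ^+ 2 + y ^+ 2)) by rewrite ler_wpM2l ?(ltW g0).
by move: r3 r4; lra.
Unshelve. all: by end_near. Qed.

(** * The arrays of the model along a sequence of parameters *)

Section Sequences.
Context {R : realType} {p q : nat}.
Variables (A : set 'rV[R]_p) (B : set 'rV[R]_q).
Variables (f : 'rV[R]_p -> R -> R) (sigma : 'rV[R]_q -> R -> R).
Variable t : nat -> nat -> R.
Variables (Jp : 'rV[R]_p -> 'rV[R]_q -> 'M[R]_p) (Jq : 'rV[R]_q -> 'M[R]_q).
Hypotheses (oA : open A) (cA : convex_set A) (oB : open B) (cB : convex_set B).
Hypothesis bsigma : borel_fun_on [set x : 'rV[R]_q * R | B x.1 /\ 0 <= x.2] (fun x => sigma x.1 x.2).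
Hypothesis t0 : forall n, t n 0%N = 0.
Hypothesis t_lt : forall n i, (i < n)%N -> t n i < t n i.+1.
Hypothesis Too : horizon t n @[n --> \oo] --> +oo.
Hypothesis hmesh : exists M, forall n, mesh t n <= M.
Hypotheses (cA1 : condA1 f sigma A B) (cA2 : condA2 f sigma A B) (cA3 : condA3 f sigma t A B Jp Jq).
Variables (K : set 'rV[R]_(p + q)) (th_ w_ : nat -> 'rV[R]_(p + q)) (w : 'rV[R]_(p + q)).
Hypotheses (cK : compact K) (KT : K `<=` Theta A B).
Hypothesis Kth : forall n, (0 < n)%N -> K (th_ n) /\ K (th_ n + w_ n *m Phi t Jp Jq n (th_ n)).
Hypothesis cw : w_ n @[n --> \oo] --> w.

Definition alternative n := th_ n + w_ n *m Phi t Jp Jq n (th_ n).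

Let Tth n : (0 < n)%N -> Theta A B (th_ n). Proof. by move=> n0; apply: KT; have [] := Kth n0. Qed.
Let Tth' n : (0 < n)%N -> Theta A B (alternative n). Proof. by move=> n0; apply: KT; have [] := Kth n0. Qed.

Definition a_lin n i := lin_coef f sigma t Jp n (th_ n) i.
Definition a_quad n i := quad_coef sigma t Jq n (th_ n) i.
Definition kappa n i := vol2 sigma t n i (rsubmx (th_ n)) / vol2 sigma t n i (rsubmx (alternative n)).
Definition shift_coef n i :=
  (drift f t n i (lsubmx (alternative n)) - drift f t n i (lsubmx (th_ n))) / vol sigma t n i (rsubmx (th_ n)).

Lemma coef_asymptotics :
  [/\ forall x, ssq (fun n i => a_lin n i x) n @[n --> \oo] --> enorm x ^+ 2,
      forall y, ssq (fun n i => a_quad n i y) n @[n --> \oo] --> 2 * enorm y ^+ 2,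
      forall x g, 0 < g -> \forall n \near \oo, forall i, (i < n)%N -> `|a_lin n i x| <= g,
      forall y g, 0 < g -> \forall n \near \oo, forall i, (i < n)%N -> `|a_quad n i y| <= g &
      [/\ ssq (fun n i => kappa n i * shift_coef n i - a_lin n i (lsubmx w)) n @[n --> \oo] --> 0,
          ssq (fun n i => 1 - kappa n i - a_quad n i (rsubmx w)) n @[n --> \oo] --> 0 &
          \sum_(i < n) ratio_const (kappa n i) (shift_coef n i) @[n --> \oo] --> - (2^-1 * enorm w ^+ 2)]].
Proof.
(* The parameter sets are nonempty since the sequence visits them at index 1; index 0, where the
   horizon is 0, is excluded. *)
have [Ae Be] : (exists a, A a) /\ (exists b, B b).
  by have [Ath Bth] := Tth (ltn0Sn 0); split; [exists (lsubmx (th_ 1%N))|exists (rsubmx (th_ 1%N))].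
have [C [C0 rF rH]] := regular_coefs oA cA oB cB bsigma t0 t_lt cA1 cA2 Ae Be.
have [m m0 mH] := vol2_ge bsigma t0 t_lt cA2.
have [hmax hm] := step_le hmesh.
have h0 := step_gt0 t_lt.
have hT := sum_step t0.
have cJp := qform_alpha_cvg cA3.
have cJq := qform_beta_cvg oB cB bsigma t0 t_lt cA1 cA2 cA3 Ae.
have [pJp pJq _ _] := cA3.
have [l l0 hl] := information_lb C0 m0 h0 hT rF rH mH pJp pJq cJp cJq cK KT.
pose a_ n := lsubmx (th_ n); pose b_ n := rsubmx (th_ n).
pose a'_ n := lsubmx (alternative n); pose b'_ n := rsubmx (alternative n).
pose wa_ n := lsubmx (w_ n); pose wb_ n := rsubmx (w_ n).
have Aa n : (0 < n)%N -> A (a_ n) by move=> /Tth[].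
have Bb n : (0 < n)%N -> B (b_ n) by move=> /Tth[].
have Aa' n : (0 < n)%N -> A (a'_ n) by move=> /Tth'[].
have Bb' n : (0 < n)%N -> B (b'_ n) by move=> /Tth'[].
have lJp n v : (0 < n)%N -> l * enorm v ^+ 2 <= bform (Jp (a_ n) (b_ n)) v v.
  by move=> n0; have [Kn _] := Kth n0; have [h _] := hl _ Kn.
have lJq n v : (0 < n)%N -> l * enorm v ^+ 2 <= bform (Jq (b_ n)) v v.
  by move=> n0; have [Kn _] := Kth n0; have [_ h] := hl _ Kn.
have a'E n : a'_ n = a_ n + wa_ n *m inv_sqrtmx (horizon t n *: Jp (a_ n) (b_ n)).
  by rewrite /a'_ /alternative linearD/= mul_Phi row_mxKl.
have b'E n : b'_ n = b_ n + wb_ n *m inv_sqrtmx (n%:R *: Jq (b_ n)).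
  by rewrite /b'_ /alternative linearD/= mul_Phi row_mxKr.
have cwn : enorm (w_ n - w) @[n --> \oo] --> 0.
  apply/cvgrPdist_le => e e0; have hn : \forall n \near \oo, enorm (w_ n - w) <= e by exact: cw (near_enorm w e0).
  apply: filterS hn => n.
  by rewrite sub0r normrN ger0_norm// enorm_ge0.
have cwa : enorm (wa_ n - lsubmx w) @[n --> \oo] --> 0.
  apply: (squeeze_cvgr _ (cvg_cst 0) cwn); apply: nearW => n.
  by rewrite enorm_ge0 /wa_ lsubmxB enorm_lsubmx_le.
have cwb : enorm (wb_ n - rsubmx w) @[n --> \oo] --> 0.
  apply: (squeeze_cvgr _ (cvg_cst 0) cwn); apply: nearW => n.
  by rewrite enorm_ge0 /wb_ rsubmxB enorm_rsubmx_le.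
have linE x : (fun n i => a_lin n i x) = (fun n i =>
    score_alpha (horizon t) (drift f t) (vol2 sigma t) Jp a_ b_ n i x).
  by apply/funext => n; apply/funext => i; rewrite /score_alpha sqrt_vol2.
have shE : shift_coef = (fun n i =>
    (drift f t n i (a'_ n) - drift f t n i (a_ n)) / Num.sqrt (vol2 sigma t n i (b_ n))).
  by apply/funext => n; apply/funext => i; rewrite sqrt_vol2.
split.
- move=> x; rewrite linE; exact: (ssq_score_alpha m0 h0 hT mH pJp cJp l0 Aa Bb lJp).
- by move=> y; exact: (ssq_score_beta pJq cJq l0 Bb lJq).
- move=> x g g0; have h := score_alpha_max C0 m0 h0 hm hT Too rF mH pJp l0 Aa Bb lJp x g0.
  apply: filterS h => n hn i i_lt.
  by rewrite -[a_lin n i x]/((fun n i => a_lin n i x) n i) linE; exact: hn.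
- by move=> y g g0; exact: (score_beta_max C0 m0 h0 rH mH pJq l0 Bb lJq y g0).
split.
- have h := ssq_linear_remainder C0 m0 h0 hT Too rF rH mH pJp pJq cJp l0 Aa Aa' Bb Bb' lJp lJq a'E b'E cwa cwb.
  rewrite shE; have := linE (lsubmx w) => lE.
  rewrite (_ : (fun n i => _) = (fun n i => kappa n i * ((drift f t n i (a'_ n) - drift f t n i (a_ n)) /
    Num.sqrt (vol2 sigma t n i (b_ n))) - score_alpha (horizon t) (drift f t) (vol2 sigma t) Jp a_ b_ n i (lsubmx w))).
    exact: h.
  apply/funext => n; apply/funext => i; congr (_ - _).
  by rewrite -[LHS]/((fun n i => a_lin n i (lsubmx w)) n i) linE.
- exact: (ssq_variance_ratio C0 m0 h0 rH mH pJq l0 Bb Bb' lJq b'E cwb).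
- rewrite shE (enorm_submx w).
  exact: (ratio_const_cvg C0 m0 h0 hT Too rF rH mH pJp pJq cJp cJq l0 Aa Aa' Bb Bb' lJp lJq a'E b'E cwa cwb).
Qed.

End Sequences.

(** * Convergence in law of the score and vanishing of the remainder *)

Section Conclusion.
Context {R : realType} {p q : nat}.
Variables (A : set 'rV[R]_p) (B : set 'rV[R]_q).
Variables (f : 'rV[R]_p -> R -> R) (sigma : 'rV[R]_q -> R -> R).
Context {dO : measure_display} {Om : measurableType dO}.
Variables (P : 'rV[R]_(p + q) -> probability Om R) (X : R -> {mfun Om >-> R}) (W : 'rV[R]_(p + q) -> R -> Om -> R).
Variable t : nat -> nat -> R.
Variables (Jp : 'rV[R]_p -> 'rV[R]_q -> 'M[R]_p) (Jq : 'rV[R]_q -> 'M[R]_q).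
Hypotheses (oA : open A) (cA : convex_set A) (oB : open B) (cB : convex_set B).
Hypothesis bsigma : borel_fun_on [set x : 'rV[R]_q * R | B x.1 /\ 0 <= x.2] (fun x => sigma x.1 x.2).
Hypothesis hproc : forall th, Theta A B th ->
    [/\ wiener_process (P th) (W th),
        solves_sde (P th) (W th) (fun s => X s) (f (lsubmx th)) (sigma (rsubmx th)) &
        independent_of_process (P th) (X 0) (W th)].
Hypothesis hX0 : forall th th', Theta A B th -> Theta A B th' ->
    forall U : set R, measurable U -> P th (X 0 @^-1` U) = P th' (X 0 @^-1` U).
Hypothesis t0 : forall n, t n 0%N = 0.
Hypothesis t_lt : forall n i, (i < n)%N -> t n i < t n i.+1.
Hypothesis Too : horizon t n @[n --> \oo] --> +oo.
Hypothesis hmesh : exists M, forall n, mesh t n <= M.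
Hypotheses (cA1 : condA1 f sigma A B) (cA2 : condA2 f sigma A B) (cA3 : condA3 f sigma t A B Jp Jq).
Variables (K : set 'rV[R]_(p + q)) (th_ w_ : nat -> 'rV[R]_(p + q)) (w : 'rV[R]_(p + q)).
Hypotheses (cK : compact K) (KT : K `<=` Theta A B).
Hypothesis Kth : forall n, (0 < n)%N -> K (th_ n) /\ K (th_ n + w_ n *m Phi t Jp Jq n (th_ n)).
Hypothesis cw : w_ n @[n --> \oo] --> w.

Let th' n := alternative t Jp Jq th_ w_ n.
Let Tth n : (0 < n)%N -> Theta A B (th_ n). Proof. by move=> n0; apply: KT; have [] := Kth n0. Qed.
Let Tth' n : (0 < n)%N -> Theta A B (th' n). Proof. by move=> n0; apply: KT; have [] := Kth n0. Qed.
Let Delta n (x : Om) := score f sigma t Jp Jq (th_ n) (obs t X n x).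
Let a n i (u : 'rV[R]_(p + q)) : R := a_lin f sigma t Jp th_ n i (lsubmx u).
Let b n i (u : 'rV[R]_(p + q)) : R := a_quad sigma t Jq th_ n i (rsubmx u) / 2.
Let Q n := tprod (obs_law f sigma t (distribution (P (th_ n)) (initial (X 0))) n (th_ n)) n.+1.
Let kp n i := kappa sigma t Jp Jq th_ w_ n i.
Let sh n i := shift_coef f sigma t Jp Jq th_ w_ n i.

Let A_ex : exists a, A a. Proof. by have [Ath _] := Tth (ltn0Sn 0); exists (lsubmx (th_ 1%N)). Qed.

Let lawE n E : (0 < n)%N -> measurable E -> P (th_ n) (obs t X n @^-1` E) = Q n E.
Proof.
move=> n0 mE; exact: (obs_lawE bsigma t0 t_lt cA2 hproc hX0 (Tth n0) (Tth n0) mE).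
Qed.

Let coef := coef_asymptotics oA cA oB cB bsigma t0 t_lt Too hmesh cA1 cA2 cA3 cK KT Kth cw.

Let dotr_Delta n u (y : n.+1.-tuple R) : (0 < n)%N -> dotr u (score f sigma t Jp Jq (th_ n) y) =
  quad_sum (mean f t n (th_ n)) (sd sigma t n (th_ n)) (a n ^~ u) (b n ^~ u) y.
Proof.
move=> n0; exact: (dotr_score oB cB bsigma t0 t_lt cA1 cA2 cA3 A_ex u y n0 (Tth n0)).
Qed.

Let sd0 n i : (0 < n)%N -> 0 < sd sigma t n (th_ n) i.
Proof. by move=> n0; exact: (sd_gt0 bsigma t0 t_lt cA2 n i (Tth n0)). Qed.

Let var n (u : 'rV[R]_(p + q)) : R := \sum_(i < n) (a n i u ^+ 2 + 2 * b n i u ^+ 2).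

(** With [b] half of the quadratic coefficient, [2 b^2] contributes half of a sum tending to
    [2 |rsubmx u|^2]; the blocks add up to [|u|^2]. *)
Let var_cvg u : var n u @[n --> \oo] --> enorm u ^+ 2.
Proof.
have [ca cb _ _ _] := coef.
rewrite (_ : (fun n => _) = fun n => ssq (fun n i => a_lin f sigma t Jp th_ n i (lsubmx u)) n
    + 2^-1 * ssq (fun n i => a_quad sigma t Jq th_ n i (rsubmx u)) n); last first.
  apply/funext => n; rewrite /var /ssq mulr_sumr -big_split/=; apply: eq_bigr => i _.
  by rewrite /a /b; field.
rewrite enorm_submx -[X in _ --> _ + X](mulKf (_ : 2 != 0 :> R))//.
by apply: cvgD; [exact: ca|apply: cvgMl_tmp; exact: cb].
Qed.

Let chf_cvg c u : \int[P (th_ n)]_x cos (c + dotr u (Delta n x)) @[n --> \oo] -->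
  cos c * expR (- (enorm u ^+ 2 / 2)).
Proof.
have [ca cb ma mb _] := coef.
have herr : 2 * \sum_(i < n) (14 * (`|a n i u| + `|b n i u|) ^+ 3 + (`|a n i u| + `|b n i u|) ^+ 4)
    @[n --> \oo] --> 0.
  apply: (@quad_error_cvg _ (fun n i => a n i u) (fun n i => b n i u) (enorm (lsubmx u) ^+ 2)
    (2^-1 * enorm (rsubmx u) ^+ 2)).
  - exact: ca.
  - rewrite (_ : ssq _ = fun n => 4^-1 * ssq (fun n i => a_quad sigma t Jq th_ n i (rsubmx u)) n); last first.
      apply/funext => n; rewrite /ssq mulr_sumr; by apply: eq_bigr => i _; rewrite /b; field.
    rewrite (_ : 2^-1 * _ = 4^-1 * (2 * enorm (rsubmx u) ^+ 2)); last by field.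
    by apply: cvgMl_tmp; exact: cb.
  - exact: ma.
  - move=> g g0; have g2 : 0 < g * 2 by rewrite mulr_gt0.
    apply: filterS (mb (rsubmx u) _ g2) => n hn i i_lt; rewrite /b normrM (ger0_norm (_ : 0 <= 2^-1))//.
    by rewrite ler_pdivrMr// hn.
have hmain : cos c * expR (- (var n u / 2)) @[n --> \oo] --> cos c * expR (- (enorm u ^+ 2 / 2)).
  apply: cvgMl_tmp; apply: continuous_cvg; first exact: continuous_expR.
  by apply: cvgN; apply: cvgMr_tmp; exact: var_cvg.
have hdiff : \int[P (th_ n)]_x cos (c + dotr u (Delta n x)) - cos c * expR (- (var n u / 2)) @[n --> \oo] --> 0.
  apply/norm_cvg0P; apply: (squeeze_cvgr _ (cvg_cst 0) herr).
  exists 1%N => // n n0; rewrite normr_ge0 /=.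
  have -> : \int[P (th_ n)]_x cos (c + dotr u (Delta n x)) =
      \int[Q n]_y cos (c + quad_sum (mean f t n (th_ n)) (sd sigma t n (th_ n)) (a n ^~ u) (b n ^~ u) y).
    under eq_Rintegral do rewrite dotr_Delta//.
    apply: (@eq_law_Rintegral _ _ _ _ _ (P (th_ n)) (obs t X n) (Q n)
      (fun y => cos (c + quad_sum (mean f t n (th_ n)) (sd sigma t n (th_ n)) (a n ^~ u) (b n ^~ u) y)) 1).
    - exact: measurable_obs.
    - apply: (measurableT_comp measurable_cos); apply: measurable_funD => //.
      exact: measurable_quad_sum.
    - by move=> y; exact: cos_max.
    - by move=> E mE; exact: lawE.
  by apply: quad_sum_cos => // i; exact: sd0.
rewrite -[X in _ --> X]add0r.
rewrite (_ : (fun n => \int[P (th_ n)]_x cos (c + dotr u (Delta n x))) = fun n =>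
  \int[P (th_ n)]_x cos (c + dotr u (Delta n x)) - cos c * expR (- (var n u / 2)) +
  cos c * expR (- (var n u / 2))); last by apply/funext => n; rewrite subrK.
exact: cvgD hdiff hmain.
Qed.

Let measurable_Delta n j : measurable_fun [set: Om] (fun x => Delta n x 0 j).
Proof.
apply: (measurableT_comp (measurable_score f sigma t Jp Jq (th_ n) j)).
exact: measurable_obs.
Qed.

Let second_moment n u : (0 < n)%N -> (\int[P (th_ n)]_x (dotr u (Delta n x) ^+ 2)%:E = (var n u)%:E)%E.
Proof.
move=> n0; under eq_integral do rewrite dotr_Delta//.
rewrite (@eq_law_ge0_integral _ _ _ _ _ (P (th_ n)) (obs t X n) (Q n) (fun y =>
  quad_sum (mean f t n (th_ n)) (sd sigma t n (th_ n)) (a n ^~ u) (b n ^~ u) y ^+ 2))//.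
- transitivity (\int[Q n]_y ((0 + quad_sum (mean f t n (th_ n)) (sd sigma t n (th_ n)) (a n ^~ u) (b n ^~ u) y) ^+ 2)%:E)%E.
    by apply: eq_integral => y _; rewrite add0r.
  by rewrite quad_sum_sqr ?expr0n ?add0r// => i; exact: sd0.
- by apply: measurable_funX; exact: measurable_quad_sum.
- by move=> y; exact: sqr_ge0.
- by move=> E mE; exact: lawE.
Qed.

Let measurable_dotr_Delta n u : measurable_fun [set: Om] (fun x => dotr u (Delta n x)).
Proof.
under eq_fun do rewrite dotrE.
by apply: measurable_sum => j; apply: measurable_funM.
Qed.

Let second_moment_enorm n : (0 < n)%N ->
  (\int[P (th_ n)]_x (enorm (Delta n x) ^+ 2)%:E = (\sum_j var n (delta_mx 0 j))%:E)%E.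
Proof.
move=> n0; rewrite -sumEFin; under eq_bigr do rewrite -second_moment//.
rewrite -ge0_integral_sum//.
- apply: eq_integral => x _; rewrite sumEFin enorm_sqr dotrE; congr _%:E.
  by apply: eq_bigr => j _; rewrite -expr2 dotrC dotr_delta_mx.
- by move=> j; apply/measurable_EFinP; apply: measurable_funX.
- by move=> j x _; rewrite lee_fin sqr_ge0.
Qed.

Let measurable_enorm_Delta n : measurable_fun [set: Om] (fun x => enorm (Delta n x)).
Proof.
apply: (measurableT_comp (continuous_measurable_fun (@sqrt_continuous R))).
by apply: measurable_sum => j; apply: measurable_funX.
Qed.

Let tight_Delta e : 0 < e -> exists2 L : R, 0 < L &
  \forall n \near \oo, fine (P (th_ n) [set x | exists j, L < `|Delta n x 0 j|]) <= e.
Proof.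
move=> e0.
pose l : R := \sum_(j < p + q) enorm (delta_mx 0 j : 'rV[R]_(p + q)) ^+ 2.
have cl : \sum_j var n (delta_mx 0 j) @[n --> \oo] --> l by apply: cvg_sumr => j; exact: var_cvg.
have l0 : 0 <= l by apply: sumr_ge0 => j _; exact: sqr_ge0.
have l1 : 0 < (l + 1) / e by rewrite divr_gt0// ltr_wpDl.
(* The mean of [|Delta|^2] is eventually at most [l + 1], so Chebyshev's inequality at this level
   gives [e]. *)
exists (Num.sqrt ((l + 1) / e)); first by rewrite sqrtr_gt0.
have hn : \forall n \near \oo, \sum_j var n (delta_mx 0 j) <= l + 1.
  move/cvgrPdist_le: cl => /(_ _ ltr01); apply: filterS => n.
  by rewrite distrC => h; have := ler_norm (\sum_j var n (delta_mx 0 j) - l); lra.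
near=> n; have n0 : (0 < n)%N by near: n; exact: nbhs_infty_gt.
have hvar : \sum_j var n (delta_mx 0 j) <= l + 1 by near: n.
have L0 : 0 < Num.sqrt ((l + 1) / e) by rewrite sqrtr_gt0.
have hc := @chebyshev_sqr _ _ R (P (th_ n)) (fun x => enorm (Delta n x)) _ (l + 1) L0 (measurable_enorm_Delta n).
have mS : measurable [set x | exists j, Num.sqrt ((l + 1) / e) < `|Delta n x 0 j|].
  exact: (measurable_exceed (fun j => measurable_Delta n j)).
have : (P (th_ n) [set x | exists j, (Num.sqrt ((l + 1) / e) < `|Delta n x 0 j|)%R] <= e%:E)%E.
  apply: (@le_trans _ _ (P (th_ n) [set x | (Num.sqrt ((l + 1) / e) < `|enorm (Delta n x)|)%R])); last first.
    have -> : e%:E = ((l + 1) / Num.sqrt ((l + 1) / e) ^+ 2)%:E.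
      by congr _%:E; rewrite sqr_sqrtr ?ltW// invfM invrK mulrA mulfV ?mul1r// gt_eqF// ltr_wpDl.
    by apply: hc; rewrite second_moment_enorm// lee_fin.
  apply: le_measure; rewrite ?inE//.
    rewrite -[X in measurable X]setTI; apply: (measurable_fun_ltr (measurable_cst _)) => //.
    by apply: measurableT_comp => //; exact: measurable_enorm_Delta.
  move=> x [j hj] /=; apply: (lt_le_trans hj).
  by rewrite [leRHS]ger0_norm ?enorm_ge0// le_enorm_coord.
by rewrite -{1}(@fineK _ (P (th_ n) _)) ?lee_fin// fin_num_measure.
Unshelve. all: by end_near. Qed.

Let measurable_row_of_tuple j : measurable_fun [set: (p + q).-tuple R] (fun y => row_of_tuple y 0 j).
Proof. by under eq_fun do rewrite mxE; exact: measurable_tnth. Qed.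

Lemma score_cvg_in_law :
  cvg_in_law (fun n => P (th_ n)) Delta (std_normal (p + q)) (@row_of_tuple R (p + q)).
Proof.
move=> g cg [M gM].
have intg (dT : measure_display) (T : measurableType dT) (S : probability T R) (Z : T -> 'rV[R]_(p + q)) :
    (forall j, measurable_fun [set: T] (fun x => Z x 0 j)) ->
    (\int[S]_x (g (Z x))%:E = (\int[S]_x g (Z x))%R%:E)%E.
  move=> mZ; apply: EFin_Rintegral; apply: (@integrable_bounded _ _ _ S (g \o Z) M) => [|x]; last exact: gM.
  exact: (measurable_continuous_rV mZ cg gM).
rewrite intg; last exact: measurable_row_of_tuple.
under eq_fun do rewrite intg//.
apply: cvg_EFin; first exact: nearW.
apply: (levy_continuity measurable_Delta measurable_row_of_tuple tight_Delta
  (tight_single _ measurable_row_of_tuple) _ cg gM) => c u.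
by rewrite std_normal_cos; exact: chf_cvg.
Qed.

(** Defined by subtraction, so that the decomposition holds at every outcome, whatever version of
    the Radon-Nikodym derivative is chosen. *)
Definition remainder n (y : n.+1.-tuple R) : R :=
  ln (fine (Radon_Nikodym (charge_of_finite_measure (Pn t P X n (th' n))) (Pn t P X n (th_ n)) y))
  - (dotr (score f sigma t Jp Jq (th_ n) y) w - 2^-1 * enorm w ^+ 2).

Let ra n i := kp n i * sh n i - a n i w.
Let rb n i := (1 - kp n i) / 2 - b n i w.
Let rc n := \sum_(i < n) ratio_const (kp n i) (sh n i) + 2^-1 * enorm w ^+ 2.

Let remainderE n : (0 < n)%N -> {ae Pn t P X n (th_ n), forall y, remainder y =
  rc n + quad_sum (mean f t n (th_ n)) (sd sigma t n (th_ n)) (ra n) (rb n) y}.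
Proof.
move=> n0; have [_] := log_likelihoodE bsigma t0 t_lt cA2 hproc hX0 n0 (Tth n0) (Tth' n0).
apply: filterS => y hy; rewrite /remainder hy dotrC dotr_Delta// /rc /quad_sum opprB addrA.
rewrite addrAC -sumrB [in RHS]addrAC -big_split/=; congr (_ + _).
apply: eq_bigr => i _; rewrite /log_ratio.
have -> : (sd sigma t n (th_ n) i / sd sigma t n (th' n) i) ^+ 2 = kp n i.
  by rewrite /sd ltn_ord /kp /kappa expr_div_n.
have -> : (mean f t n (th' n) i - mean f t n (th_ n) i) / sd sigma t n (th_ n) i = sh n i.
  by rewrite /sd ltn_ord.
by rewrite /quad_form /ra /rb; ring.
Qed.

(** Second moment of the explicit form of the remainder: the square of its constant plus its
    variance. *)
Let rvar n := rc n ^+ 2 + \sum_(i < n) (ra n i ^+ 2 + 2 * rb n i ^+ 2).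

Let rvar_cvg : rvar n @[n --> \oo] --> 0.
Proof.
have [_ _ _ _ [ca cb cr]] := coef.
rewrite (_ : rvar = fun n => rc n ^+ 2 + (ssq (fun n i => kp n i * sh n i - a_lin f sigma t Jp th_ n i (lsubmx w)) n
    + 2^-1 * ssq (fun n i => 1 - kp n i - a_quad sigma t Jq th_ n i (rsubmx w)) n)); last first.
  apply/funext => n; rewrite /rvar /ssq mulr_sumr -big_split/=; congr (_ + _); apply: eq_bigr => i _.
  by rewrite /ra /rb /a /b; field.
have cc : rc n @[n --> \oo] --> 0.
  by rewrite -(addNr (2^-1 * enorm w ^+ 2)); apply: cvgD; [exact: cr|exact: cvg_cst].
rewrite (_ : 0 = 0 ^+ 2 + (0 + 2^-1 * 0) :> R); last by rewrite expr0n mulr0 !addr0.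
apply: cvgD; first exact: (cvgM cc cc).
by apply: cvgD; [exact: ca|apply: cvgMl_tmp; exact: cb].
Qed.

Lemma remainder_cvg_in_prob0 : cvg_in_prob0 (fun n => P (th_ n)) (fun n x => remainder (obs t X n x)).
Proof.
move=> e e0.
have hle n : (0 < n)%N -> (P (th_ n) [set x | (e < `|remainder (obs t X n x)|)%R] <= (rvar n / e ^+ 2)%:E)%E.
  move=> n0.
  have [mL _] := log_likelihoodE bsigma t0 t_lt cA2 hproc hX0 n0 (Tth n0) (Tth' n0).
  have mr : measurable_fun [set: n.+1.-tuple R] (@remainder n).
    apply: measurable_funB => //; apply: measurable_funB => //.
    under eq_fun do rewrite dotrE.
    by apply: measurable_sum => j; apply: measurable_funM => //; exact: measurable_score.
  have mS (g : n.+1.-tuple R -> R) : measurable_fun [set: n.+1.-tuple R] g -> measurable [set y | e < `|g y|].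
    move=> mg; rewrite -[X in measurable X]setTI; apply: (measurable_fun_ltr (measurable_cst _)) => //.
    exact: measurableT_comp.
  pose g (y : n.+1.-tuple R) : R := rc n + quad_sum (mean f t n (th_ n)) (sd sigma t n (th_ n)) (ra n) (rb n) y.
  have mg : measurable_fun [set: n.+1.-tuple R] g by apply: measurable_funD => //; exact: measurable_quad_sum.
  (* Passage to the explicit form, which differs from [remainder] only on a null set of the law of
     the observations. *)
  have hg : (Pn t P X n (th_ n) [set y | (e < `|remainder y|)%R] <= Pn t P X n (th_ n) [set y | (e < `|g y|)%R])%E.
    have [N [mN N0 hN]] := remainderE n0.
    rewrite -(measureU0 (mS _ mg) mN N0); apply: le_measure; rewrite ?inE//.
    - exact: (mS (@remainder n)).
    - by apply: measurableU => //; exact: (mS g).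
    - move=> y /= hy; have [hr|hr] := pselect (remainder y = g y); first by left; rewrite -hr.
      by right; exact: hN.
  apply: (le_trans hg); rewrite [leLHS](_ : _ = Q n [set y | (e < `|g y|)%R]); last by apply: lawE => //; exact: mS.
  apply: chebyshev_sqr => //; rewrite quad_sum_sqr// => i; exact: sd0.
apply: (@squeeze_cvge _ _ _ _ (cst 0%E) _ (fun n => (rvar n / e ^+ 2)%:E)).
- by exists 1%N => // n n0; rewrite measure_ge0 hle.
- exact: cvg_cst.
- apply: cvg_EFin; first exact: nearW.
  by rewrite -(mul0r (e ^+ 2)^-1); apply: cvgMr_tmp.
Qed.

End Conclusion.

Theorem proposition1 (R : realType) (p q : nat)
    (A : set 'rV[R]_p) (B : set 'rV[R]_q)
    (f : 'rV[R]_p -> R -> R) (sigma : 'rV[R]_q -> R -> R)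
    (dO : measure_display) (Om : measurableType dO)
    (P : 'rV[R]_(p + q) -> probability Om R)
    (X : R -> {mfun Om >-> R}) (W : 'rV[R]_(p + q) -> R -> Om -> R)
    (t : nat -> nat -> R)
    (Jp : 'rV[R]_p -> 'rV[R]_q -> 'M[R]_p) (Jq : 'rV[R]_q -> 'M[R]_q) :
  (0 < p + q)%N ->
  bounded_set A -> open A -> convex_set A ->
  bounded_set B -> open B -> convex_set B ->
  (* the coefficients *)
  borel_fun_on [set x : 'rV[R]_p * R | A x.1 /\ 0 <= x.2]
    (fun x => f x.1 x.2) ->
  borel_fun_on [set x : 'rV[R]_q * R | B x.1 /\ 0 <= x.2]
    (fun x => sigma x.1 x.2) ->
  (forall b s, B b -> 0 <= s -> 0 <= sigma b s) ->
  (forall s, 0 <= s -> {within A, continuous (f ^~ s)}) ->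
  (forall s, 0 <= s -> {within B, continuous (sigma ^~ s)}) ->
  (* the process *)
  (forall th, Theta A B th ->
    [/\ wiener_process (P th) (W th),
        solves_sde (P th) (W th) (fun s => X s) (f (lsubmx th)) (sigma (rsubmx th)) &
        independent_of_process (P th) (X 0) (W th)]) ->
  (forall th th', Theta A B th -> Theta A B th' ->
    forall U : set R, measurable U -> P th (X 0 @^-1` U) = P th' (X 0 @^-1` U)) ->
  (* the observation instants *)
  (forall n, t n 0%N = 0) ->
  (forall n i, (i < n)%N -> t n i < t n i.+1) ->
  horizon t n @[n --> \oo] --> +oo ->
  (exists M, forall n, mesh t n <= M) ->
  condA1 f sigma A B -> condA2 f sigma A B -> condA3 f sigma t A B Jp Jq ->
  exists Delta : forall n, 'rV[R]_(p + q) -> n.+1.-tuple R -> 'rV[R]_(p + q),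
    (forall n th i, (0 < n)%N -> Theta A B th ->
       measurable_fun [set: n.+1.-tuple R] (fun y => Delta n th y 0 i)) /\
    forall (K : set 'rV[R]_(p + q)) (th_ w_ : nat -> 'rV[R]_(p + q))
        (w : 'rV[R]_(p + q)),
      compact K -> K `<=` Theta A B ->
      (forall n, (0 < n)%N ->
        K (th_ n) /\ K (th_ n + w_ n *m Phi t Jp Jq n (th_ n))) ->
      w_ n @[n --> \oo] --> w ->
      exists r : nat -> Om -> R,
        [/\ forall n x, (0 < n)%N ->
              loglik_ratio t P X n (th_ n)
                (th_ n + w_ n *m Phi t Jp Jq n (th_ n)) x =
              (Delta n (th_ n) (obs t X n x) *m w^T) 0 0
                - 2^-1 * enorm w ^+ 2 + r n x,
            cvg_in_law (fun n => P (th_ n))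
              (fun n x => Delta n (th_ n) (obs t X n x))
              (std_normal (p + q)) (@row_of_tuple R (p + q)) &
            cvg_in_prob0 (fun n => P (th_ n)) r].
Proof.
move=> _ _ oA cA _ oB cB _ bsigma _ _ _ hproc hX0 t0 t_lt Too hmesh cA1 cA2 cA3.
exists (fun n th y => score f sigma t Jp Jq th y); split=> [n th i _ _|K th_ w_ w cK KT Kth cw].
  exact: measurable_score.
exists (fun n x => remainder f sigma P X t Jp Jq th_ w_ w (obs t X n x)); split.
- by move=> n x _; rewrite /remainder [RHS]addrC subrK.
- exact: (score_cvg_in_law oA cA oB cB bsigma hproc hX0 t0 t_lt Too hmesh cA1 cA2 cA3 cK KT Kth cw).
- exact: (remainder_cvg_in_prob0 oA cA oB cB bsigma hproc hX0 t0 t_lt Too hmesh cA1 cA2 cA3 cK KT Kth cw).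
Qed.
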